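(* Let $N\ge 0$ be an integer and let $a_0,a_1,\dots,a_N$ be complex numbers (with the convention $a_k=0$ for $k\in\mathbb{Z}\setminus\{0,\dots,N\}$) satisfying $$\sum_{k\in\mathbb{Z}}\bar a_k a_{k+2l}=\delta_{l}\quad\text{for all } l\in\mathbb{Z}\ (\delta_0=1,\ \delta_l=0 \text{ for } l\neq 0),\qquad \sum_{k\in\mathbb{Z}}a_k=\sqrt2 .$$ Let $m_0(z)=\sum_{k=0}^N a_kz^k$, and let $\varphi\in L^2(\mathbb{R})$ be the associated scaling function, defined by $$\hat\varphi(t)=\prod_{k=1}^\infty\frac{m_0\left(e^{-it2^{-k}}\right)}{\sqrt2}\qquad(t\in\mathbb{R}).$$ Let $M$ be the cascade operator $(M\psi)(x)=\sqrt2\sum_{k=0}^N a_k\psi(2x-k)$ on $L^2(\mathbb{R})$. Let $R$ be the Ruelle operator $$(R\xi)(z)=\frac12\sum_{w^2=z}|m_0(w)|^2\xi(w)\qquad (z\in\mathbb{T}),$$ identified with its restriction to $P[-N,N]$ (or to $P[r,s]$ for any integers $r\le -N$, $s\ge N$). Then the following conditions are equivalent. (i) $R$ has $1$ as a simple eigenvalue, and $|\lambda|<1$ for all other eigenvalues $\lambda$ of $R$. (ii) For every function $\psi^{(0)}\in L^2(\mathbb{R})$ with compact support such that $\{\psi^{(0)}(\,\cdot\,-k)\}_{k\in\mathbb{Z}}$ is an orthonormal set in $L^2(\mathbb{R})$ and $\widehat{\psi^{(0)}}(0)=1$, $$\lim_{n\to\infty}\left\|\varphi-M^n\psi^{(0)}\right\|_2=0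 .$$
   Context: $\mathbb{T}=\{z\in\mathbb{C}:|z|=1\}$. The Fourier transform on $\mathbb{R}$ is $\hat f(t)=\int_{\mathbb{R}}f(x)e^{-itx}\,dx$, extended to $L^2(\mathbb{R})$ as usual. Under the stated conditions on $(a_k)$ the infinite product defining $\hat\varphi$ converges uniformly on compact subsets of $\mathbb{R}$ and defines an element of $L^2(\mathbb{R})$, so $\varphi\in L^2(\mathbb{R})$ is well defined. For integers $r\le s$, $P[r,s]$ denotes the finite-dimensional complex vector space of trigonometric polynomials on $\mathbb{T}$ of the form $\sum_{k=r}^s b_kz^k$; for $r\le -N$ and $s\ge N$ it is mapped into itself by $R$. ''$1$ is a simple eigenvalue'' means that the eigenspace of $R$ for the eigenvalue $1$ is one-dimensional. *)

(* Defs.v *)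
From HB Require Import structures.
From mathcomp Require Import all_boot all_order all_algebra.
From mathcomp Require Export complex.
From mathcomp Require Import all_classical all_reals all_analysis.

Set Implicit Arguments.
Unset Strict Implicit.
Unset Printing Implicit Defensive.

Import Order.TTheory GRing.Theory Num.Theory.
Import numFieldNormedType.Exports.

Local Open Scope classical_set_scope.
Local Open Scope ring_scope.
Local Open Scope complex_scope.

Section L2.
Variable R : realType.
Implicit Types f g : R -> R[i].

Definition leb : {measure set (measurableTypeR R) -> \bar R} :=
  @lebesgue_measure R.

Definition Cmeasurable f :=
  measurable_fun [set: R] (fun x => complex.Re (f x)) /\
  measurable_fun [set: R] (fun x => complex.Im (f x)).

Definition Cintegrable f :=
  leb.-integrable [set: R] (fun x => (complex.Re (f x))%:E) /\
  leb.-integrable [set: R] (fun x => (complex.Im (f x))%:E).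

Definition Cintegral f : R[i] :=
  Rintegral leb [set: R] (fun x => complex.Re (f x)) +i*
  Rintegral leb [set: R] (fun x => complex.Im (f x)).

(* [`|f x|] lives in R[i]; its real part is the modulus as an element of R *)
Definition L2norm f : \bar R :=
  Lnorm leb 2%:E (fun x => (complex.Re `|f x|)%:E).

Definition inL2 f := Cmeasurable f /\ (L2norm f < +oo)%E.

Definition L2dist f g : \bar R := L2norm (fun x => f x - g x).

Definition L2cvg (f_ : nat -> R -> R[i]) f :=
  (fun n => L2dist f (f_ n)) @ \oo --> 0%E.

Definition L2inner f g : R[i] := Cintegral (fun x => (f x)^* * g x).

Definition orthonormal_translates f :=
  forall k l : int,
    L2inner (fun x => f (x - k%:~R)) (fun x => f (x - l%:~R)) = (k == l)%:R.

(* elements of L2 being classes of functions, the support is the essential one *)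
Definition compactly_supported f :=
  exists2 K : set R, compact K & {ae leb, forall x, ~ K x -> f x = 0}.

Definition expi (x : R) : R[i] := cos x +i* sin x.

Definition fourier f (t : R) : R[i] :=
  Cintegral (fun x => f x * expi (- (t * x))).

(* graph of the continuous extension of [fourier] from L1 `&` L2 to L2 *)
Definition is_fourierL2 f g :=
  [/\ inL2 f, inL2 g &
   exists f_ : nat -> R -> R[i],
     [/\ forall n, Cintegrable (f_ n) /\ inL2 (f_ n),
         L2cvg f_ f &
         L2cvg (fun n => fourier (f_ n)) g]].

End L2.

Section EigenOn.
Variables (K : fieldType) (V : lmodType K).
Implicit Types (P : set V) (T : V -> V).

(* eigenvectors of the restriction of T to the T-stable subspace P *)
Definition eigenspace_on P T (lambda : K) : set V :=
  [set v | P v /\ T v = lambda *: v].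

Definition eigenvalue_on P T (lambda : K) :=
  exists2 v, eigenspace_on P T lambda v & v != 0.

Definition one_dimensional (E : set V) :=
  exists2 v : V, v != 0 & E = range (fun c : K => c *: v).

Definition simple_eigenvalue_on P T (lambda : K) :=
  one_dimensional (eigenspace_on P T lambda).

End EigenOn.

Section Scaling.
Variable R : realType.
Variables (N : nat) (a : int -> R[i]).

Definition sqrt2 : R[i] := (Num.sqrt 2)%:C.

Definition m0 (z : R[i]) : R[i] := \sum_(0 <= k < N.+1) a k%:Z * z ^+ k.

(* [R[i]^o] carries the topology of the complex modulus *)
Definition phihat (t : R) : R[i] :=
  limn ((fun n => \prod_(1 <= k < n.+1) (m0 (expi (- (t * 2 ^- k))) / sqrt2))
        : nat -> R[i]^o).

Definition is_scaling_function (phi : R -> R[i]) := is_fourierL2 phi phihat.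

Definition cascade (psi : R -> R[i]) (x : R) : R[i] :=
  sqrt2 * \sum_(0 <= k < N.+1) a k%:Z * psi (2 * x - k%:R).

Definition circle := {z : R[i] | `|z| == 1}.

Definition ruelle (xi : circle -> R[i]) (z : circle) : R[i] :=
  2^-1 * \sum_(w \in [set w : circle | val w ^+ 2 = val z])
           (`|m0 (val w)| ^+ 2 * xi w).

Definition trigpoly (r s : int) : set (circle -> R[i]) :=
  [set xi | exists b : int -> R[i], forall z,
     xi z = \sum_(k \in [set k : int | r <= k <= s]) b k * val z ^ k].

End Scaling.

(* Main.v *)
Require Import Defs.
From mathcomp Require Import all_boot all_order all_algebra.
From mathcomp Require Import all_classical all_reals all_analysis.
From mathcomp Require Import measurable_realfun zify ring lra.

(** Why the theorem is true.

    Integer correlations [corr f g m = <f, g (. + m)>] evolve autonomously under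
    the cascade operator [M]: [corr (M f) (M g) = T (corr f g)]
    ([corr_cascade]), where [T] is the action of the Ruelle operator [R] on the
    coefficients of Laurent polynomials ([ruelle_laurent]). The orthogonality
    relations say that [T] fixes the Dirac sequence at 0. Hence [M] preserves
    the orthonormality of integer translates, and
    [|M^n f - M^n g|^2 = 2 - 2 Re (T^n (corr f g) 0)] for two functions with
    orthonormal translates ([nrm_iterB]). Both conditions of the theorem are
    equivalent to a third one, [transfer_cvg]: the powers of [T] send the Dirac
    sequence at any [m] to the Dirac sequence at 0, in the limit.

    The spectral condition and [transfer_cvg] ([spectrum_iff_transfer_cvg]). On
    a window of degrees [T] is a matrix. The value at [z = 1] is invariant under
    [R], because [m0 1 = sqrt 2] and [m0 (- 1) = 0]; this excludes a Jordan block
    for the eigenvalue 1, and on the hyperplane of polynomials vanishing at 1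
    all eigenvalues have modulus less than 1. The Cayley-Hamilton theorem then
    gives the convergence of the powers ([cvg_powers]). As [T] shrinks every
    window to the degrees between [- N] and [N], the choice of [r] and [s] is
    immaterial. Conversely the limits of the powers determine the eigenvectors.

    From the cascade to [transfer_cvg] ([transfer_cvg_of_cascade]). The
    translates by integers of the indicator function of [0, 1), the box, are
    admissible, and the correlation of the box with one of them is a Dirac
    sequence. If all their iterates converge to the same [phi], then their
    correlations converge to that of the iterated box with itself, which is the
    Dirac sequence at 0.

    From [transfer_cvg] to the cascade. The translates of the box are a
    partition of unity, so that the correlation of the box with an admissible
    [g] has sum [int g = 1]; hence [|M^n box - M^n g|] tends to 0, uniformly over
    the admissible [g] carried by a given interval ([cascade_box_close]).
    For [g = psi] this reduces the claim to the box, and for [g = M^k box] it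
    makes [M^n box] a Cauchy sequence ([cascade_box_cauchy]). The Fourier
    transforms of [M^n box] converge pointwise to the infinite product
    ([ccvg_fourier_iter_box]); Fatou's lemma and the Plancherel identity convert
    the Cauchy estimate into an estimate of [|phi - M^n box|] ([fatou_sqn],
    [is_fourierL2_near]).

    The Plancherel identity for integrable and square integrable functions
    ([plancherel]). The square of the modulus of the Fourier transform of a real
    function is the cosine transform of its autocorrelation. Integrated against
    [exp (- |t| / n)] it becomes the mean of the autocorrelation for a Poisson
    kernel of width [1 / n], and the autocorrelation is continuous at 0 because
    translations are continuous in L1 ([translation_cvg]). *)

Set Implicit Arguments.
Unset Strict Implicit.
Unset Printing Implicit Defensive.

Import Order.TTheory GRing.Theory Num.Theory.
Import numFieldNormedType.Exports.

Local Open Scope classical_set_scope.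
Local Open Scope ring_scope.
Local Open Scope complex_scope.

(** * Affine changes of variables *)

Section Affine.
Variable R : realType.
Local Notation mu := (@lebesgue_measure R).
Implicit Types (c d x : R).

Lemma measurable_affine c d :
  measurable_fun [set: measurableTypeR R] (fun x : R => c * x + d : R).
Proof. by apply: measurable_funD => //; apply: measurable_funM. Qed.

(** Lebesgue measure is determined by its values on bounded half-open intervals,
    and there the two sides can be computed. *)
Lemma pushforward_affine c d (A : set (measurableTypeR R)) : c != 0 ->
  measurable A ->
  pushforward mu (fun x : measurableTypeR R => c * x + d : measurableTypeR R) A
  = mscale (NngNum (normr_ge0 c^-1)) mu A.
Proof.
move=> c0 mA.
pose phi (x : measurableTypeR R) : measurableTypeR R := c * x + d.
have mphi : measurable_fun setT phi by exact: measurable_affine.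
pose nu : {measure set (measurableTypeR R) -> \bar R} :=
  mscale (NngNum (normr_ge0 c)) (pushforward mu phi).
have H : forall B, measurable B -> mu B = nu mphi B.
  apply: lebesgue_measure_unique => _ [[a b] _ <-].
  rewrite /nu/= /mscale/= /pushforward.
  case: (ltgtP c 0) c0 => // c0 _.
    have -> : phi @^-1` [set` `]a, b]] = `[(b - d) / c, (a - d) / c[%classic.
      apply/seteqP; split=> x /=; rewrite !in_itv/= /phi ?ler_ndivrMr// ?ltr_ndivlMr//; lra.
    rewrite !lebesgue_measure_itv/= !lte_fin (ltr0_norm c0).
    rewrite ltr_ndivrMr// mulrVK ?unitfE ?lt_eqF// ltrBlDr subrK.
    by case: ifP => _; rewrite ?mule0// -!EFinB -EFinM; congr EFin; field; rewrite lt_eqF.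
  have -> : phi @^-1` [set` `]a, b]] = `](a - d) / c, (b - d) / c]%classic.
    apply/seteqP; split=> x /=; rewrite !in_itv/= /phi ?ler_pdivlMr// ?ltr_pdivrMr//; lra.
  rewrite !lebesgue_measure_itv/= !lte_fin (gtr0_norm c0).
  rewrite ltr_pdivrMr// mulrVK ?unitfE ?gt_eqF// ltrBlDr subrK.
  by case: ifP => _; rewrite ?mule0// -!EFinB -EFinM; congr EFin; field; rewrite gt_eqF.
rewrite /mscale/= H// /nu/= /mscale/= muleA -EFinM normfV mulVf ?normr_eq0// mul1e//.
Qed.

Local Open Scope ereal_scope.

Lemma ge0_integral_affine c d (f : R -> \bar R) : c != 0%R ->
  measurable_fun [set: measurableTypeR R] f -> (forall x, 0 <= f x) ->
  \int[mu]_x f (c * x + d)%R = `|c^-1|%:E * \int[mu]_x f x.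
Proof.
move=> c0 mf f0.
rewrite -(@ge0_integral_mscale _ _ _ mu setT measurableT (NngNum (normr_ge0 c^-1%R)) f)//.
pose phi (x : measurableTypeR R) : measurableTypeR R := (c * x + d)%R.
have mphi : measurable_fun setT phi by exact: measurable_affine.
rewrite -[LHS](@ge0_integral_pushforward _ _ _ _ R phi mphi mu setT)//.
by apply: eq_measure_integral => A mA _; exact: pushforward_affine.
Qed.

Lemma integrable_affine c d (f : R -> \bar R) : c != 0%R ->
  mu.-integrable setT f -> mu.-integrable setT (fun x => f (c * x + d)%R).
Proof.
move=> c0 /integrableP[mf fi]; apply/integrableP; split.
  by apply: measurableT_comp => //; exact: measurable_affine.
rewrite (@ge0_integral_affine c d (abse \o f))//; [|exact: measurableT_comp|by move=> x; exact: abse_ge0].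
by rewrite lte_mul_pinfty.
Qed.

Lemma integral_affine c d (f : R -> \bar R) : c != 0%R ->
  mu.-integrable setT f ->
  \int[mu]_x f (c * x + d)%R = `|c^-1|%:E * \int[mu]_x f x.
Proof.
move=> c0 fi; have mf := measurable_int _ fi.
rewrite [LHS]integralE [in RHS]integralE.
rewrite muleBr//; last first.
  apply: fin_num_adde_defr.
  by have := integrable_pos_fin_num measurableT fi.
rewrite -(@ge0_integral_affine c d f^\+)//; [|exact: measurable_funepos].
rewrite -(@ge0_integral_affine c d f^\-)//; [|exact: measurable_funeneg].
by congr (_ - _); apply: eq_integral => x _; rewrite !(funeposE, funenegE).
Qed.

Lemma Rintegral_affine c d (f : R -> R) : c != 0%R ->
  mu.-integrable setT (EFin \o f) ->
  (\int[mu]_x f (c * x + d) = `|c^-1| * \int[mu]_x f x)%R.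
Proof.
move=> c0 fi; rewrite /Rintegral (integral_affine d c0 fi) fineM//.
exact: integrable_fin_num.
Qed.

End Affine.

(** * Fubini's theorem and the weight exp(-|t|) *)

Section Fubini.
Variable R : realType.
Local Notation mu := (@lebesgue_measure R).
Local Notation L1 f := (mu.-integrable setT (EFin \o f)).

(** The integrable majorant [B] of the inner integrals is Tonelli's criterion.
    All sections are assumed integrable, so that no inner integral takes a
    default value on an exceptional null set. *)
Lemma Rintegral_Fubini (F : R -> R -> R) (B : R -> R) :
  measurable_fun [set: measurableTypeR R * measurableTypeR R]
    (fun z => F z.1 z.2) ->
  (forall x, L1 (F x)) -> (forall y, L1 (F ^~ y)) ->
  L1 B -> (forall x, \int[mu]_y `|F x y| <= B x) ->
  [/\ L1 (fun x => \int[mu]_y F x y), L1 (fun y => \int[mu]_x F x y) &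
   \int[mu]_x \int[mu]_y F x y = \int[mu]_y \int[mu]_x F x y].
Proof.
move=> mF iF1 iF2 iB FB.
have Foo : (\int[mu]_x \int[mu]_y `|F x y|%:E < +oo)%E.
  have /integrableP[mB] := iB; apply: le_lt_trans.
  apply: ge0_le_integral => //.
  - by move=> x _; apply: integral_ge0.
  - apply: (@measurable_fun_fubini_tonelli_F _ _ _ _ _ mu
      (fun z => `|F z.1 z.2|%:E)) => //.
    by apply/measurable_EFinP; exact: measurableT_comp.
  - exact: measurableT_comp.
  - move=> x _; have iFx : L1 (fun y => `|F x y|) by exact: integrable_norm.
    rewrite -[leLHS]fineK ?(integrable_fin_num _ iFx)//.
    by rewrite lee_fin (le_trans (FB x))// ler_norm.
pose G (z : measurableTypeR R * measurableTypeR R) := (F z.1 z.2)%:E.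
have mG : measurable_fun setT G by exact/measurable_EFinP.
have iG : (mu \x mu)%E.-integrable setT G by apply/(integrable12ltyP mu mu mG).
have E1 x : (\int[mu]_y G (x, y))%E = (\int[mu]_y F x y)%:E.
  by rewrite fineK//; exact: integrable_fin_num (iF1 x).
have E2 y : (\int[mu]_x G (x, y))%E = (\int[mu]_x F x y)%:E.
  by rewrite fineK//; exact: integrable_fin_num (iF2 y).
split.
- have := integrable_fubini_F iG; apply: eq_integrable => // x _.
  exact: E1.
- pose G' (z : measurableTypeR R * measurableTypeR R) := G (z.2, z.1).
  have mG' : measurable_fun setT G'.
    by apply: measurableT_comp => //; exact: measurable_fun_pair.
  have iG' : (mu \x mu)%E.-integrable setT G'.
    apply/(integrable12ltyP mu mu mG') => /=.
    by have := (integrable21ltyP mu mu mG).1 iG.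
  by have := integrable_fubini_F iG'; apply: eq_integrable => // y _; exact: E2.
- have := Fubini iG.
  under eq_integral do rewrite E1.
  under [in RHS]eq_integral do rewrite E2.
  by rewrite /Rintegral => ->.
Qed.

End Fubini.

Section Kernel.
Variable R : realType.
Local Notation mu := (@lebesgue_measure R).
Local Notation L1 f := (mu.-integrable setT (EFin \o f)).

(** The fundamental theorem of calculus on a half line asks for an integrand
    of constant sign: the cosine is therefore shifted by 1, and the shift is
    removed at the end by comparison with the case [v = 0]. *)
Let half (v t : R) := expR (- t) * (1 + cos (t * v)).
Let prim (v t : R) : R :=
  - expR (- t) + expR (- t) * (v * sin (t * v) - cos (t * v)) / (1 + v ^+ 2).

Let onev (v : R) : 1 + v ^+ 2 != 0.
Proof. by rewrite gt_eqF// ltr_pwDl// sqr_ge0. Qed.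

Let is_derive_prim (v t : R) : is_derive t 1 (prim v) (half v t).
Proof.
rewrite /prim /half; apply: is_derive_eq.
rewrite /GRing.scale/=; field; exact: onev.
Qed.

Let half_ge0 (v t : R) : 0 <= half v t.
Proof. by rewrite mulr_ge0 ?expR_ge0// -lerBlDl sub0r cos_geN1. Qed.

Let cont_half (v : R) : continuous (half v).
Proof.
move=> t; apply: cvgM.
  apply: continuous_comp; first exact: continuousN.
  exact: continuous_expR.
apply: cvgD; first exact: cvg_cst.
apply: continuous_comp; last exact: continuous_cos.
by apply: cvgM => //; exact: cvg_cst.
Qed.

Let cvg_prim (v : R) : prim v t @[t --> +oo] --> (0 : R).
Proof.
pose c := 1 + (`|v| + 1) / (1 + v ^+ 2).
have ce : c * expR (- t) @[t --> +oo] --> (0 : R).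
  rewrite -[X in _ --> X](mulr0 c); apply: cvgM; first exact: cvg_cst.
  exact: cvgr_expR.
apply/norm_cvg0P; apply: squeeze_cvgr (@cvg_cst _ _ _ _ _) ce.
apply: nearW => t; rewrite normr_ge0/=.
have e0 := expR_ge0 (- t).
have ov : 0 < 1 + v ^+ 2 by rewrite ltr_pwDl// sqr_ge0.
rewrite /prim /c mulrDl mul1r (le_trans (ler_normD _ _))//.
rewrite normrN ger0_norm// lerD2l !normrM (ger0_norm e0).
rewrite normfV (gtr0_norm ov) [leRHS]mulrAC ler_pM2r ?invr_gt0// mulrC.
rewrite ler_wpM2r// (le_trans (ler_normB _ _))// lerD//.
  rewrite normrM ler_piMr// ler_norml sin_geN1 sin_le1//.
by rewrite ler_norml cos_geN1 cos_le1.
Qed.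

Lemma integral_half v :
  (\int[mu]_(t in `[0%R, +oo[) (half v t)%:E = (1 + (1 + v ^+ 2)^-1)%:E)%E.
Proof.
rewrite (ge0_continuous_FTC2y (F := prim v) (l := 0)) //.
- rewrite /prim oppr0 expR0 mul0r sin0 cos0 mulr0 sub0r mul1r -EFinB.
  by congr EFin; rewrite sub0r opprD opprK mulN1r opprK.
- exact: continuous_subspaceT.
- apply: cvg_at_right_filter; apply: differentiable_continuous.
  by apply/derivable1_diffP; have := is_derive_prim v 0; case.
- by move=> x _; rewrite derive1E; have [_ ->] := is_derive_prim v x.
Qed.

Definition laplace (t : R) : R := expR (- `|t|).

Lemma measurable_laplace : measurable_fun [set: measurableTypeR R] laplace.
Proof.
apply: measurableT_comp => //; apply: measurableT_comp => //.
Qed.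

Lemma integral_laplace_cos1 v :
  (\int[mu]_t (laplace t * (1 + cos (t * v)))%:E =
   (2 * (1 + (1 + v ^+ 2)^-1))%:E)%E.
Proof.
rewrite ge0_symfun_integralT.
- rewrite EFinM -integral_half; congr (_ * _)%E.
  rewrite -set_itvcy; apply: eq_integral => t; rewrite inE/= in_itv/= andbT => t0.
  by rewrite /half /laplace ger0_norm.
- by move=> t; rewrite mulr_ge0 ?expR_ge0// -lerBlDl sub0r cos_geN1.
- move=> t; apply: cvgM.
    apply: continuous_comp; last exact: continuous_expR.
    by apply: continuousN; exact: norm_continuous.
  apply: cvgD; first exact: cvg_cst.
  apply: continuous_comp; last exact: continuous_cos.
  by apply: cvgM => //; exact: cvg_cst.
- by move=> t; rewrite /= /laplace normrN mulNr cosN.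
Qed.

Lemma integrable_laplace : L1 laplace.
Proof.
have mE : measurable_fun [set: measurableTypeR R] (EFin \o laplace).
  apply/measurable_EFinP. apply: measurable_laplace.
apply/integrableP; split=> //.
have := integral_laplace_cos1 0.
under eq_integral do rewrite mulr0 cos0.
move=> H; apply: (@le_lt_trans _ _ (\int[mu]_t (laplace t * (1 + 1))%:E)%E);
  last by rewrite H ltry.
apply: ge0_le_integral => //.
- exact: measurableT_comp.
- by apply/measurable_EFinP; apply: measurable_funM => //; exact: measurable_laplace.
- move=> t _; rewrite /= ger0_norm ?expR_ge0// lee_fin.
  by rewrite ler_peMr ?expR_ge0// lerDl.
Qed.

(** The cosine transform of the weight is the Poisson kernel. *)
Lemma Rintegral_laplace_cos v :
  \int[mu]_t (laplace t * cos (t * v)) = 2 / (1 + v ^+ 2).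
Proof.
have cint w : L1 (fun t => laplace t * cos (t * w)).
  apply: le_integrable integrable_laplace => //.
    apply/measurable_EFinP; apply: measurable_funM; first exact: measurable_laplace.
    apply: continuous_measurable_fun => t.
    apply: continuous_comp; last exact: continuous_cos.
    by apply: cvgM => //; exact: cvg_cst.
  move=> t _ /=; rewrite lee_fin normrM ler_piMr//.
  by rewrite ler_norml cos_geN1 cos_le1.
have H w : \int[mu]_t laplace t + \int[mu]_t (laplace t * cos (t * w))
    = 2 * (1 + (1 + w ^+ 2)^-1).
  rewrite -RintegralD//; last exact: integrable_laplace.
  rewrite /Rintegral -[RHS]/(fine (2 * (1 + (1 + w ^+ 2)^-1))%:E).
  rewrite -integral_laplace_cos1; congr fine; apply: eq_integral => t _.
  by rewrite mulrDr mulr1.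
have := H 0; under [X in _ + X = _]eq_Rintegral do rewrite mulr0 cos0 mulr1.
rewrite expr0n/= addr0 invr1 => H0.
have A2 : \int[mu]_t laplace t = 2.
  by apply: (@mulfI _ 2); rewrite ?pnatr_eq0// mulr_natl mulr2n H0.
by have := H v; rewrite A2 mulrDr mulr1 => /addrI.
Qed.

Lemma integral_poisson :
  (\int[mu]_v (2 / (1 + v ^+ 2))%:E = (2 * pi)%:E)%E.
Proof.
transitivity (\int[mu]_v (2%:E * (oneDsqr v)^-1%:E))%E; first by [].
have cV : continuous (fun v : R => (oneDsqr v)^-1) by exact: continuous_oneDsqrV.
have mV : measurable_fun [set: measurableTypeR R] (fun v : R => (oneDsqr v)^-1).
  exact: continuous_measurable_fun.
rewrite ge0_integralZl//; [|exact/measurable_EFinP].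
rewrite ge0_symfun_integralT//.
  by rewrite -set_itvcy integral0y_oneDsqr -!EFinM; congr EFin; field.
by move=> x /=; rewrite /oneDsqr sqrrN.
Qed.
End Kernel.

(** * Continuity of translations in L1 *)

Section RealL1.
Variable R : realType.
Local Notation mu := (@lebesgue_measure R).
Local Notation L1 f := (mu.-integrable setT (EFin \o f)).
Local Notation mfun f := (measurable_fun [set: measurableTypeR R] f).
Implicit Types f g u : R -> R.

Lemma L1_measurable f : L1 f -> mfun f.
Proof. by move=> /measurable_int /measurable_EFinP. Qed.

Lemma L1_le f g : mfun f -> L1 g -> (forall x, `|f x| <= `|g x|) -> L1 f.
Proof.
move=> mf ig fg; apply: le_integrable ig => //; first exact/measurable_EFinP.
by move=> x _ /=; rewrite lee_fin.
Qed.

Lemma L1D f g : L1 f -> L1 g -> L1 (fun x => f x + g x).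
Proof. by move=> hf hg; have := integrableD measurableT hf hg; apply: eq_integrable. Qed.

Lemma L1B f g : L1 f -> L1 g -> L1 (fun x => f x - g x).
Proof. by move=> hf hg; have := integrableB measurableT hf hg; apply: eq_integrable. Qed.

Lemma L1Z c f : L1 f -> L1 (fun x => c * f x).
Proof. by move=> hf; have := integrableZl measurableT c hf; apply: eq_integrable. Qed.

Lemma L1_norm f : L1 f -> L1 (fun x => `|f x|).
Proof.
move=> hf; apply: (L1_le (g := f)) => // [|x]; last by rewrite normr_id.
by apply: measurableT_comp => //; exact: L1_measurable.
Qed.

Lemma L1_affine c d f : c != 0 -> L1 f -> L1 (fun x => f (c * x + d)).
Proof. by move=> c0 hf; exact: (integrable_affine d c0 hf). Qed.

Lemma L1_shift v f : L1 f -> L1 (fun x => f (x + v)).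
Proof.
move=> /(L1_affine v (oner_neq0 R)); apply: eq_integrable => // x _ /=.
by rewrite mul1r.
Qed.

Lemma Rintegral_shift v f : L1 f -> \int[mu]_x f (x + v) = \int[mu]_x f x.
Proof.
move=> /(Rintegral_affine v (oner_neq0 R)).
rewrite invr1 normr1 mul1r => <-; apply: eq_Rintegral => x _.
by rewrite mul1r.
Qed.

Lemma Rintegral_EFin f : L1 f -> (\int[mu]_x (f x)%:E)%E = (\int[mu]_x f x)%:E.
Proof. by move=> hf; rewrite fineK//; exact: (integrable_fin_num measurableT hf). Qed.

Lemma Rdominated_cvg (f_ : nat -> R -> R) f g :
  (forall n, mfun (f_ n)) -> mfun f ->
  {ae mu, forall x, f_ ^~ x @ \oo --> f x} -> L1 g ->
  (forall n x, `|f_ n x| <= g x) ->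
  [/\ L1 f, (fun n => \int[mu]_x `|f_ n x - f x|) @ \oo --> 0 &
    (fun n => \int[mu]_x f_ n x) @ \oo --> \int[mu]_x f x].
Proof.
move=> mf_ mf cf ig fg.
have [] := @dominated_convergence _ _ _ mu setT measurableT
  (fun n x => (f_ n x)%:E) (EFin \o f) (EFin \o g).
- by move=> n; apply/measurable_EFinP.
- by apply/measurable_EFinP.
- have [M [mM M0 cM]] := cf; exists M; split=> // x /= nx; apply: cM => /= fx.
  by apply: nx => _; apply: cvg_EFin => //; exact: nearW.
- exact: ig.
- by apply: nearW => x n _; rewrite lee_fin fg.
move=> if_ c0 c1; split => //.
  exact: (fine_cvg c0).
move: c1; rewrite [X in _ --> X](Rintegral_EFin if_) => c1.
exact: (fine_cvg c1).
Qed.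

Lemma indic_itv_sym (K x : R) : \1_[set` `[- K, K]] x = (`|x| <= K)%R%:R :> R.
Proof. by rewrite indicE mem_setE in_itv/= -ler_norml. Qed.

Lemma indic_itv_in (K x : R) : `|x| <= K -> \1_[set` `[- K, K]] x = 1 :> R.
Proof. by rewrite indic_itv_sym => ->. Qed.

Lemma indic_itv_out (K x : R) : K < `|x| -> \1_[set` `[- K, K]] x = 0 :> R.
Proof. by rewrite indic_itv_sym ltNge => /negbTE ->. Qed.

Lemma indic_itv_bounds (K x : R) : 0 <= (\1_[set` `[- K, K]] x : R) <= 1.
Proof. by rewrite indic_itv_sym ler0n lern1 leq_b1. Qed.

Lemma normr_cutoff (K x a : R) : `|a * \1_[set` `[- K, K]] x| <= `|a|.
Proof.
have /andP[h0 h1] := indic_itv_bounds K x.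
by rewrite normrM ler_piMr// ger0_norm.
Qed.

(** A continuous function cut off to a segment has at most two points of
    discontinuity, and its small translates have a common bounded majorant
    with compact support: dominated convergence applies. *)
Lemma translation_cvg_cutoff (h : R -> R) K (v : nat -> R) :
  continuous h -> v @ \oo --> 0 ->
  let w := fun x => h x * \1_[set` `[- K, K]] x in
  (fun n => \int[mu]_x `|w (x + v n) - w x|) @ \oo --> 0.
Proof.
move=> ch cv w.
have [N _ Nv] : \forall n \near \oo, `|v n| <= 1.
  move/cvgrPdist_le : cv => /(_ _ ltr01).
  by apply: filterS => n; rewrite sub0r normrN.
have [C C0 hC] : exists2 C, 0 <= C & forall x, `|x| <= K -> `|h x| <= C.
  have : compact (h @` `[- K, K]).
    by apply: continuous_compact; [exact: continuous_subspaceT|exact: segment_compact].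
  move=> /compact_bounded[M [_ HM]]; exists (`|M| + 1) => [|x xK].
    by rewrite addr_ge0.
  apply: HM => /=; first by rewrite (le_lt_trans (ler_norm _))// ltrDl.
  by exists x => //; rewrite in_itv/= -ler_norml.
have wC x : `|w x| <= C * \1_[set` `[- K, K]] x.
  rewrite /w; have [xK|xK] := leP `|x| K.
    by rewrite indic_itv_in// !mulr1 hC.
  by rewrite indic_itv_out// !mulr0 normr0.
have mw : mfun w.
  by apply: measurable_funM; [exact: continuous_measurable_fun|exact: measurable_indic].
have mwv y : mfun (fun x => w (x + y)).
  by apply: measurableT_comp => //; exact: measurable_funD.
have := @Rdominated_cvg (fun n x => `|w (x + v (n + N)%N) - w x|) (fun=> 0)
  (fun x => 2 * C * \1_[set` `[- (K + 1), K + 1]] x) _ _ _ _ _.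
move=> [].
- by move=> n; apply: measurableT_comp => //; exact: measurable_funB.
- exact: measurable_cst.
- exists ([set K] `|` [set - K]); split.
  + by apply: measurableU; exact: measurable_set1.
  + by rewrite measureU0//; exact: lebesgue_measure_set1.
  move=> x /=; apply: contra_notP => /not_orP[xK xNK].
  have nK : `|x| != K.
    apply/eqP => e; have [x0|x0] := leP 0 x.
      by apply: xK; rewrite -e ger0_norm.
    by apply: xNK; rewrite -e ltr0_norm// opprK.
  have cx : (fun n => x + v (n + N)%N) @ \oo --> x.
    rewrite -[X in _ --> X]addr0; apply: cvgD; first exact: cvg_cst.
    by rewrite (cvg_shiftn N).
  have cxn : (fun n => `|x + v (n + N)%N|) @ \oo --> `|x| by exact: cvg_norm.
  suff cw : (fun n => w (x + v (n + N)%N)) @ \oo --> w x.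
    rewrite -(@normr0 _ R) -(subrr (w x)); apply: cvg_norm.
    by apply: cvgB => //; exact: cvg_cst.
  rewrite /w; apply: cvgM.
    exact: (continuous_cvg _ (ch x) cx).
  apply: cvg_near_cst; case: (ltgtP `|x| K) nK => // xK' _.
    near=> n; rewrite (indic_itv_in (ltW xK')) indic_itv_in// ltW//; near: n.
    exact: (cvgr_lt _ cxn).
  near=> n; rewrite (indic_itv_out xK') indic_itv_out//; near: n.
  exact: (cvgr_gt _ cxn).
- apply: L1Z.
  exact: integrable_indic_itv.
- move=> n x; rewrite normr_id.
  have vn : `|v (n + N)%N| <= 1 by apply: Nv => /=; exact: leq_addl.
  have wC' y : `|w y| <= C.
    by rewrite (le_trans (wC _))// ler_piMr//; case/andP: (indic_itv_bounds K y).
  have [xK|xK] := leP `|x| (K + 1).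
    by rewrite indic_itv_in// mulr1 (le_trans (ler_normB _ _))// mulr_natl mulr2n lerD.
  have nx : K < `|x| by lra.
  have nxv : K < `|x + v (n + N)%N|.
    have := ler_normB (x + v (n + N)%N) (v (n + N)%N); rewrite addrK; lra.
  by rewrite /w !indic_itv_out// !mulr0 subrr normr0.
move=> _ _; rewrite /Rintegral integral0/=.
by rewrite (cvg_shiftn N (fun n => fine (\int[mu]_x `|w (x + v n) - w x|%:E)%E)).
Unshelve. all: by end_near. Qed.

(** Cutting off the tails of [u] costs little by dominated convergence, and on
    the remaining segment continuous functions are dense in L1. *)
Lemma L1_approx_cutoff u (eps : R) : L1 u -> 0 < eps ->
  exists (h : R -> R) (K : R), [/\ continuous h, L1 (fun x => h x * \1_[set` `[- K, K]] x) &
   \int[mu]_x `|u x - (h x * \1_[set` `[- K, K]] x)| <= eps].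
Proof.
move=> iu e0; have mu_ := L1_measurable iu.
have e2 : 0 < eps / 2 by rewrite divr_gt0.
have muK K : mfun (fun x => u x * \1_[set` `[- K, K]] x).
  by apply: measurable_funM => //; exact: measurable_indic.
have iuK K : L1 (fun x => u x * \1_[set` `[- K, K]] x).
  by apply: (L1_le (g := u)) => // x; exact: normr_cutoff.
have [K uK] : exists K : R, \int[mu]_x `|u x * \1_[set` `[- K, K]] x - u x| < eps / 2.
  have [] := @Rdominated_cvg (fun n x => u x * \1_[set` `[- n%:R, n%:R]] x) u
    (fun x => `|u x|).
  - by [].
  - by [].
  - apply: nearW => x; apply: cvg_near_cst; near=> n.
    rewrite indic_itv_in ?mulr1//; near: n; exact: nbhs_infty_ger.
  - exact: L1_norm.
  - by move=> n x; exact: normr_cutoff.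
  move=> _ /cvgrPdist_lt /(_ _ e2) [N _ HN] _; exists N%:R.
  have := HN N (leqnn _); rewrite /= sub0r normrN; apply: le_lt_trans.
  exact: ler_norm.
have [] := @approximation_continuous_integrable R `[- K, K]%classic u.
- exact: measurable_itv.
- by apply: compact_finite_measure; exact: segment_compact.
- exact: integrableS iu.
move=> g [cg ig]; move=> /fine_cvg /cvgrPdist_lt /(_ _ e2) [k _ /(_ k (leqnn _)) /=].
rewrite sub0r normrN => gk.
have igK : L1 (fun x => g k x * \1_[set` `[- K, K]] x).
  have mI : measurable ([set` `[- K, K]] : set (measurableTypeR R)) by exact: measurable_itv.
  have := (@integrable_mkcond _ _ _ mu _ (EFin \o g k) mI).1 (ig k).
  by apply: eq_integrable => // x _; rewrite /= epatch_indic/= EFinM.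
exists (g k), K; split=> //.
have -> : eps = eps / 2 + eps / 2 by field.
apply: (@le_trans _ _ (\int[mu]_x `|u x * \1_[set` `[- K, K]] x - u x| +
  \int[mu]_x `|u x * \1_[set` `[- K, K]] x - g k x * \1_[set` `[- K, K]] x|)).
  rewrite -RintegralD//; [|exact/L1_norm/L1B|exact/L1_norm/L1B].
  apply: le_Rintegral => //; [exact/L1_norm/L1B| |].
    by apply: L1D; exact/L1_norm/L1B.
  move=> x _; rewrite [`|_ - u x|]distrC (le_trans _ (ler_normD _ _))//.
  by rewrite le_eqVlt; apply/orP; left; apply/eqP; congr `|_|; ring.
apply: lerD; first exact: ltW.
apply: ltW; apply: le_lt_trans gk.
rewrite (le_trans _ (ler_norm _))//.
rewrite /Rintegral [X in _ <= fine X]integral_mkcond le_eqVlt; apply/orP; left; apply/eqP.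
congr fine; apply: eq_integral => x _; rewrite epatch_indic/=.
by rewrite -mulrBl normrM EFinM; congr (_ * _)%E; rewrite indicE; case: (_ \in _); rewrite ?normr1 ?normr0.
Unshelve. all: by end_near. Qed.

(** Translations are isometries of L1, so that the class of functions for which
    the statement holds is closed: it suffices to check a dense subset. *)
Lemma translation_cvg u (v : nat -> R) : L1 u -> v @ \oo --> 0 ->
  (fun n => \int[mu]_x `|u (x + v n) - u x|) @ \oo --> 0.
Proof.
move=> iu cv; apply/cvgrPdist_lt => e e0.
have e3 : 0 < e / 3 by rewrite divr_gt0.
have [h [K [ch iw uw]]] := L1_approx_cutoff iu e3.
set w := (fun x => h x * \1_[set` `[- K, K]] x) in iw uw.
have /cvgrPdist_lt/(_ _ e3) := translation_cvg_cutoff K ch cv.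
apply: filterS => n; rewrite -/w !sub0r !normrN => wn.
have iuv := L1_shift (v n) iu; have iwv := L1_shift (v n) iw.
rewrite ger0_norm; last by apply: Rintegral_ge0.
have -> : e = e / 3 + e / 3 + e / 3 by field.
apply: (@le_lt_trans _ _ (\int[mu]_x `|u (x + v n) - w (x + v n)| +
    \int[mu]_x `|w (x + v n) - w x| + \int[mu]_x `|u x - w x|)); last first.
  rewrite ltr_leD// ler_ltD//.
    by rewrite (Rintegral_shift (v n) (f := fun x => `|u x - w x|))//; exact/L1_norm/L1B.
  by rewrite (le_lt_trans _ wn)// ler_norm.
rewrite -RintegralD//; [|exact/L1_norm/L1B|exact/L1_norm/L1B].
rewrite -RintegralD//; [|by apply: L1D; exact/L1_norm/L1B|exact/L1_norm/L1B].
apply: le_Rintegral => //; [exact/L1_norm/L1B| |].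
  by apply: L1D; [apply: L1D|]; exact/L1_norm/L1B.
move=> x _; rewrite [`|u x - w x|]distrC.
rewrite (le_trans _ (lerD (ler_normD _ _) (lexx _)))//.
by rewrite (le_trans _ (ler_normD _ _))// le_eqVlt; apply/orP; left; apply/eqP; congr `|_|; ring.
Qed.
End RealL1.

(** * The Plancherel identity for real functions *)

Section RealPlancherel.
Variable R : realType.
Local Notation mu := (@lebesgue_measure R).
Local Notation L1 f := (mu.-integrable setT (EFin \o f)).
Local Notation mfun f := (measurable_fun [set: measurableTypeR R] f).
Implicit Types f g u : R -> R.

Lemma L1_mul f g : mfun f -> mfun g -> L1 (fun x => f x ^+ 2) ->
  L1 (fun x => g x ^+ 2) -> L1 (fun x => f x * g x).
Proof.
move=> mf mg if2 ig2; apply: (L1_le _ (L1D if2 ig2)).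
  exact: measurable_funM.
move=> x; rewrite [leRHS]ger0_norm ?addr_ge0 ?sqr_ge0//.
by rewrite ler_norml; apply/andP; split; nra.
Qed.

Lemma measurable_cosM t : mfun (fun x => cos (t * x)).
Proof.
apply: continuous_measurable_fun => x.
apply: continuous_comp; last exact: continuous_cos.
by apply: cvgM => //; exact: cvg_cst.
Qed.

Lemma measurable_sinM t : mfun (fun x => sin (t * x)).
Proof.
apply: continuous_measurable_fun => x.
apply: continuous_comp; last exact: continuous_sin.
by apply: cvgM => //; exact: cvg_cst.
Qed.

Lemma L1_cos f t : L1 f -> L1 (fun x => f x * cos (t * x)).
Proof.
move=> hf; apply: (L1_le _ hf).
  by apply: measurable_funM; [exact: L1_measurable|exact: measurable_cosM].
by move=> x; rewrite normrM ler_piMr ?cos_max.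
Qed.

Lemma L1_sin f t : L1 f -> L1 (fun x => f x * sin (t * x)).
Proof.
move=> hf; apply: (L1_le _ hf).
  by apply: measurable_funM; [exact: L1_measurable|exact: measurable_sinM].
by move=> x; rewrite normrM ler_piMr ?sin_max.
Qed.

Definition costr u t := \int[mu]_x (u x * cos (t * x)).
Definition sintr u t := \int[mu]_x (u x * sin (t * x)).
Definition autocorr u v := \int[mu]_x (u x * u (x + v)).

(** Once multiplied by the integrable weight [laplace t], the transform is the
    partial integral of an integrable function of two variables, hence
    measurable by Fubini's theorem; the weight never vanishes. *)
Lemma measurable_transform (k : R -> R) u : continuous k ->
  (forall x, `|k x| <= 1) -> L1 u -> mfun (fun t => \int[mu]_x (u x * k (t * x))).
Proof.
move=> ck k1 iu; have mu_ := L1_measurable iu.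
have mk : mfun k by exact: continuous_measurable_fun.
have mkl t : mfun (fun x => k (t * x)).
  by apply: measurableT_comp => //; exact: measurable_funM.
have mkr x : mfun (fun t => k (t * x)).
  by apply: measurableT_comp => //; exact: measurable_funM.
have ml := @measurable_laplace R; have il := integrable_laplace R.
have iuk t : L1 (fun x => u x * k (t * x)).
  apply: (L1_le _ iu); first exact: measurable_funM.
  by move=> x; rewrite normrM ler_piMr.
pose F t x := laplace t * (u x * k (t * x)).
have [] := @Rintegral_Fubini _ F (fun t => laplace t * \int[mu]_x `|u x|).
- apply: measurable_funM; first exact: measurableT_comp.
  apply: measurable_funM; first exact: measurableT_comp.
  by apply: measurableT_comp => //; exact: measurable_funM.
- by move=> t; exact: L1Z.
- move=> x; apply: (L1_le _ (L1Z (u x) il)).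
    by apply: measurable_funM => //; exact: measurable_funM.
  by move=> t; rewrite /F mulrCA mulrA normrM ler_piMr.
- under [X in EFin \o X]eq_fun do rewrite mulrC.
  exact: L1Z.
- move=> t; rewrite -RintegralZl//; last exact: L1_norm.
  apply: le_Rintegral => //.
  + exact/L1_norm/L1Z.
  + exact/L1Z/L1_norm.
  + move=> x _; rewrite /F normrM ger0_norm ?expR_ge0// ler_wpM2l ?expR_ge0//.
    by rewrite normrM ler_piMr.
under [X in L1 X]eq_fun do rewrite RintegralZl//.
move=> /L1_measurable mF _ _.
rewrite (_ : (fun t => _) = (fun t => expR `|t| *
    (laplace t * \int[mu]_x (u x * k (t * x))))).
  apply: measurable_funM => //; apply: measurableT_comp => //.
by apply/funext => t; rewrite mulrA /laplace -expRD subrr expR0 mul1r.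
Qed.

Section fixed.
Variable u : R -> R.
Hypotheses (iu : L1 u) (iu2 : L1 (fun x => u x ^+ 2)).
Let mu_ : mfun u := L1_measurable iu.
Let muv v : mfun (fun x => u (x + v)).
Proof. exact: L1_measurable (L1_shift v iu). Qed.
Let mud : measurable_fun [set: measurableTypeR R * measurableTypeR R]
  (fun z => u (z.1 + z.2)).
Proof. by apply: measurableT_comp => //; exact: measurable_funD. Qed.
Let mu1 : measurable_fun [set: measurableTypeR R * measurableTypeR R]
  (fun z => u z.1).
Proof. exact: measurableT_comp. Qed.

Let L1_corr v : L1 (fun x => u x * u (x + v)).
Proof. by apply: L1_mul => //; exact: (L1_shift v iu2). Qed.

(** The square of the modulus of a Fourier transform is the transform of the
    autocorrelation: expand [cos (t * (y - x))], substitute [y = x + v] and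
    exchange the integrals. *)
Let corr_fubini t :
  [/\ L1 (fun v => autocorr u v * cos (t * v)) &
   costr u t ^+ 2 + sintr u t ^+ 2 = \int[mu]_v (autocorr u v * cos (t * v))].
Proof.
pose F x v := u x * u (x + v) * cos (t * v).
have iF1 x : L1 (F x).
  rewrite /F; under [X in EFin \o X]eq_fun do rewrite -mulrA.
  apply: L1Z; apply: L1_cos.
  by have := L1_shift x iu; apply: eq_integrable => // v _ /=; rewrite addrC.
have EF2 v : \int[mu]_x F x v = autocorr u v * cos (t * v).
  by rewrite /F RintegralZr.
have [] := @Rintegral_Fubini _ F (fun x => `|u x| * \int[mu]_y `|u y|).
- apply: measurable_funM; first exact: measurable_funM.
  apply: (@measurableT_comp _ _ _ _ _ _ (fun v => cos (t * v))) => //.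
  exact: measurable_cosM.
- exact: iF1.
- move=> v; rewrite /F; under [X in EFin \o X]eq_fun do rewrite mulrC.
  exact: L1Z.
- under [X in EFin \o X]eq_fun do rewrite mulrC.
  exact/L1Z/L1_norm.
- move=> x; rewrite -(Rintegral_shift x (L1_norm iu)).
  have iux : L1 (fun y => `|u (y + x)|) by exact: (L1_shift x (L1_norm iu)).
  rewrite -RintegralZl//; apply: le_Rintegral => //.
  + exact: L1_norm.
  + exact: L1Z.
  + move=> y _; rewrite /F !normrM [y + x]addrC ler_piMr ?cos_max//.
move=> _; under [X in L1 X]eq_fun do rewrite EF2.
move=> iFv; under [in RHS]eq_Rintegral do rewrite EF2.
move=> <-; split => //.
under eq_Rintegral => x _.
  have -> : \int[mu]_v F x v =
    costr u t * (u x * cos (t * x)) + sintr u t * (u x * sin (t * x)).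
    have iux := L1_shift x iu.
    have ic := L1_cos t iu; have isn := L1_sin t iu.
    rewrite /F; under eq_Rintegral do rewrite -mulrA.
    rewrite RintegralZl//; last first.
      apply: L1_cos.
      by have := L1_shift x iu; apply: eq_integrable => // v _ /=; rewrite addrC.
    rewrite (_ : \int[mu]_v _ = cos (t * x) * costr u t + sin (t * x) * sintr u t).
      by ring.
    transitivity (\int[mu]_v (cos (t * x) * (u (v + x) * cos (t * (v + x)))
       + sin (t * x) * (u (v + x) * sin (t * (v + x))))).
      apply: eq_Rintegral => v _; rewrite [x + v]addrC.
      rewrite (_ : t * v = t * (v + x) - t * x); last by ring.
      by rewrite cosB; ring.
    rewrite (Rintegral_shift x (f := fun v => cos (t * x) * (u v * cos (t * v))
       + sin (t * x) * (u v * sin (t * v)))); last by apply: L1D; exact: L1Z.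
    rewrite RintegralD//; [|exact: L1Z|exact: L1Z].
    by rewrite !RintegralZl.
  over.
have ic := L1_cos t iu; have isn := L1_sin t iu.
rewrite RintegralD//; [|exact: L1Z|exact: L1Z].
by rewrite !RintegralZl// !expr2.
Qed.

Let L1_autocorr : L1 (autocorr u).
Proof.
have [+ _] := corr_fubini 0.
by apply: eq_integrable => // v _ /=; rewrite mul0r cos0 mulr1.
Qed.

(** From [2 * p * q <= p ^+ 2 + q ^+ 2] and the invariance under translation. *)
Let autocorr_le v : `|autocorr u v| <= autocorr u 0.
Proof.
rewrite /autocorr (le_trans (le_normr_Rintegral _ _))//.
have iuv := L1_shift v iu2.
have -> : \int[mu]_x (u x * u (x + 0)) = \int[mu]_x (2^-1 * (u x ^+ 2 + u (x + v) ^+ 2)).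
  rewrite RintegralZl//; last exact: L1D.
  rewrite RintegralD// (Rintegral_shift v iu2).
  rewrite (_ : \int[mu]_x (u x * u (x + 0)) = \int[mu]_x u x ^+ 2); first by field.
  by apply: eq_Rintegral => x _; rewrite addr0 expr2.
apply: le_Rintegral => //; [exact: L1_norm| |].
  by apply: L1Z; exact: L1D.
move=> x _; have p := sqr_ge0 (u x + u (x + v)); have m := sqr_ge0 (u x - u (x + v)).
by rewrite ler_norml; apply/andP; split; lra.
Qed.

(** Split [u] at a height [M]. The part below contributes at most [M] times the
    L1 norm of a difference of translates, which tends to 0; the part above has
    small L2 norm, and the inequality [p * q <= s * p ^+ 2 / 2 + q ^+ 2 / (2 * s)]
    plays the role of the Cauchy-Schwarz inequality. *)
Let autocorr_cvg (v : nat -> R) : v @ \oo --> 0 ->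
  (fun n => autocorr u (v n)) @ \oo --> autocorr u 0.
Proof.
move=> cv; apply/cvgrPdist_lt => e e0.
pose A := autocorr u 0.
have A0 : 0 <= A by rewrite (le_trans _ (autocorr_le 0)).
(* [s] is chosen so that the term in [s^-1], at most [2 * A / s], is below [e / 4]. *)
pose s := (8 * A + 8) / e.
have s0 : 0 < s by rewrite divr_gt0//; lra.
pose r (M : R) x := u x * (1 - \1_[set` `[- M, M]] (u x)).
have rE M x : (r M x = 0 /\ `|u x| <= M) \/ r M x = u x.
  rewrite /r; have [uM|uM] := leP `|u x| M.
    by left; rewrite indic_itv_in// subrr mulr0.
  by right; rewrite indic_itv_out// subr0 mulr1.
have mr M : mfun (r M).
  apply: measurable_funM => //; apply: measurable_funB => //.
  by apply: measurableT_comp => //; exact: measurable_indic.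
have rle M x : `|r M x ^+ 2| <= `|u x ^+ 2|.
  by case: (rE M x) => [[-> _]|->]//; rewrite expr0n/= normr0.
have ir2 M : L1 (fun x => r M x ^+ 2).
  by apply: L1_le iu2 _ => //; exact: measurable_funX.
have [M0 rM] : exists M : nat, \int[mu]_x (r M%:R x ^+ 2) < e / (2 * s).
  have [] := @Rdominated_cvg _ (fun n x => r n%:R x ^+ 2) (fun=> 0)
    (fun x => `|u x ^+ 2|).
  - by move=> n; exact: measurable_funX.
  - exact: measurable_cst.
  - apply: nearW => x; apply: cvg_near_cst; near=> n.
    rewrite /r indic_itv_in ?subrr ?mulr0 ?expr0n//.
    by near: n; exact: nbhs_infty_ger.
  - exact: L1_norm.
  - by move=> n x; exact: rle.
  move=> _ _; have e2 : 0 < e / (2 * s) by rewrite divr_gt0// mulr_gt0.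
  rewrite [X in _ --> X](_ : _ = 0); last by rewrite /Rintegral integral0.
  move=> /cvgrPdist_lt/(_ _ e2)[M _ /(_ M (leqnn _))] rM; exists M.
  by move: rM; rewrite /= sub0r normrN; apply: le_lt_trans; exact: ler_norm.
pose M : R := M0%:R + 1.
have M_gt0 : 0 < M by rewrite ltr_wpDl.
have e4 : 0 < e / (4 * M) by rewrite divr_gt0// mulr_gt0.
have /cvgrPdist_lt/(_ _ e4) := translation_cvg iu cv.
apply: filterS => n; rewrite sub0r normrN => dn.
have iuv := L1_shift (v n) iu; have iuv2 := L1_shift (v n) iu2.
have iD : L1 (fun x => `|u (x + v n) - u x|) by exact/L1_norm/L1B.
have c0 := L1_corr 0; have cn := L1_corr (v n).
rewrite distrC /autocorr -RintegralB// (le_lt_trans (le_normr_Rintegral _ _))//.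
  exact: L1B.
have iI : L1 (fun x => 2^-1 * s * r M0%:R x ^+ 2 +
    s^-1 * (u (x + v n) ^+ 2 + u x ^+ 2)).
  by apply: L1D; apply: L1Z => //; exact: L1D.
apply: (@le_lt_trans _ _ (\int[mu]_x (M * `|u (x + v n) - u x| +
    (2^-1 * s * r M0%:R x ^+ 2 + s^-1 * (u (x + v n) ^+ 2 + u x ^+ 2))))).
  apply: le_Rintegral => //.
  - exact/L1_norm/L1B.
  - by apply: L1D => //; exact: L1Z.
  move=> x _; rewrite addr0 -mulrBr normrM.
  set d := u (x + v n) - u x.
  have dM : `|u x| * `|d| <= M * `|d| + `|r M0%:R x| * `|d|.
    case: (rE M0%:R x) => [[-> uM]|->].
      by rewrite normr0 mul0r addr0 ler_wpM2r// /M; lra.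
    by rewrite lerDr mulr_ge0// ltW.
  rewrite (le_trans dM)// lerD2l.
  have d2 : `|d| ^+ 2 <= 2 * (u (x + v n) ^+ 2 + u x ^+ 2).
    rewrite real_normK ?num_real//.
    by have := sqr_ge0 (u (x + v n) + u x); rewrite /d; lra.
  apply: (@le_trans _ _ (2^-1 * s * r M0%:R x ^+ 2 + s^-1 * (2^-1 * `|d| ^+ 2))); last first.
    by rewrite lerD2l ler_pM2l ?invr_gt0//; lra.
  rewrite -[r M0%:R x ^+ 2]real_normK ?num_real//.
  rewrite -subr_ge0.
  rewrite (_ : _ - _ = (2 * s)^-1 * (s * `|r M0%:R x| - `|d|) ^+ 2).
    by rewrite mulr_ge0 ?sqr_ge0// invr_ge0 mulr_ge0// ltW.
  by field; rewrite gt_eqF.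
rewrite RintegralD//; last exact: L1Z.
rewrite RintegralD//; [|exact: L1Z|by apply: L1Z; exact: L1D].
rewrite !RintegralZl//; last exact: L1D.
rewrite RintegralD// (Rintegral_shift _ iu2).
have -> : \int[mu]_x u x ^+ 2 = A.
  by apply: eq_Rintegral => x _; rewrite addr0 expr2.
have h1 : M * \int[mu]_x `|u (x + v n) - u x| < e / 4.
  rewrite mulrC -ltr_pdivlMr// -mulrA -invfM; apply: le_lt_trans dn.
  exact: ler_norm.
have h2 : 2^-1 * s * \int[mu]_x r M0%:R x ^+ 2 < e / 4.
  rewrite mulrC -ltr_pdivlMr; last by rewrite mulr_gt0// invr_gt0.
  rewrite (_ : e / 4 / (2^-1 * s) = e / (2 * s))//.
  by field; rewrite gt_eqF.
have h3 : s^-1 * (A + A) <= e / 4.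
  rewrite mulrC ler_pdivrMr// /s mulrA.
  rewrite (_ : e / 4 * (8 * A + 8) / e = 2 * A + 2); first lra.
  by field; rewrite gt_eqF.
rewrite (_ : e = e / 4 + (e / 4 + (e / 4 + e / 4))); last by field.
apply: ltrD => //; apply: ltr_leD => //; apply: (le_trans h3).
by rewrite lerDl divr_ge0// ltW.
Unshelve. all: by end_near. Qed.

Let pk (w : R) := 2 / (1 + w ^+ 2).

Let L1_pk : L1 pk.
Proof.
apply/integrableP; split.
  apply/measurable_EFinP; apply: continuous_measurable_fun => w.
  apply: cvgM; first exact: cvg_cst.
  exact: continuous_oneDsqrV.
under eq_integral => w _.
  rewrite /= ger0_norm; last by rewrite divr_ge0// addr_ge0// sqr_ge0.
  over.
by rewrite integral_poisson ltry.
Qed.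

Let E t := costr u t ^+ 2 + sintr u t ^+ 2.

Let E_ge0 t : 0 <= E t. Proof. by rewrite addr_ge0// sqr_ge0. Qed.

Let L1_laplaceZ l : 0 < l -> L1 (fun t => laplace (l * t)).
Proof.
move=> l0; have := L1_affine 0 (lt0r_neq0 l0) (integrable_laplace R).
by apply: eq_integrable => // t _ /=; rewrite addr0.
Qed.

(** Multiplying by the weight makes Fubini's theorem applicable in [(t, v)]; the
    inner integral in [t] is a Poisson kernel of width [l], and the substitution
    [v = l * w] moves this width into the autocorrelation. *)
Let weighted l : 0 < l ->
  L1 (fun t => laplace (l * t) * E t) /\
  \int[mu]_t (laplace (l * t) * E t) = \int[mu]_w (autocorr u (l * w) * pk w).
Proof.
move=> l0; have l_neq0 := lt0r_neq0 l0.
pose F t v := laplace (l * t) * (autocorr u v * cos (t * v)).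
have ile := L1_laplaceZ l0.
have ma := L1_measurable L1_autocorr.
have EF1 t : \int[mu]_v F t v = laplace (l * t) * E t.
  have [h1 h2] := corr_fubini t.
  by rewrite RintegralZl// -h2.
have EF2 v : \int[mu]_t F t v = autocorr u v * (l^-1 * pk (v / l)).
  transitivity (\int[mu]_t (autocorr u v * (laplace (l * t) * cos (l * t * (v / l))))).
    apply: eq_Rintegral => t _; rewrite /F mulrCA; congr (_ * (_ * cos _)).
    by field.
  have icl : L1 (fun t => laplace t * cos (t * (v / l))).
    have := L1_cos (v / l) (integrable_laplace R).
    by apply: eq_integrable => // t _ /=; rewrite [t * _]mulrC.
  have := L1_affine 0 l_neq0 icl => iclt.
  rewrite RintegralZl//; last first.
    by move: iclt; apply: eq_integrable => // t _ /=; rewrite addr0.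
  congr (_ * _).
  have := Rintegral_affine 0 l_neq0 icl.
  under eq_Rintegral do rewrite addr0.
  by move=> ->; rewrite Rintegral_laplace_cos gtr0_norm ?invr_gt0.
have [] := @Rintegral_Fubini _ F (fun t => laplace (l * t) * \int[mu]_v `|autocorr u v|).
- apply: measurable_funM.
    apply: (@measurableT_comp _ _ _ _ _ _ (fun t => laplace (l * t))) => //.
    exact: L1_measurable ile.
  apply: measurable_funM; first exact: measurableT_comp.
  apply: measurableT_comp; first by apply: continuous_measurable_fun; exact: continuous_cos.
  exact: measurable_funM.
- by move=> t; apply: L1Z; exact: L1_cos.
- move=> v; have il := L1Z (autocorr u v) ile.
  apply: (L1_le _ il).
    apply: measurable_funM; first exact: L1_measurable ile.
    apply: measurable_funM => //.
    have := measurable_cosM v; congr (measurable_fun _ _).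
    by apply/funext => t; rewrite mulrC.
  move=> t; rewrite /F mulrCA mulrA normrM ler_piMr ?cos_max//.
- under [X in EFin \o X]eq_fun do rewrite mulrC.
  exact: L1Z.
- move=> t; rewrite -RintegralZl//; last exact: L1_norm.
  apply: le_Rintegral => //.
  + by apply: L1_norm; apply: L1Z; exact: L1_cos.
  + by apply: L1Z; exact: L1_norm.
  + move=> v _; rewrite /F normrM ger0_norm ?expR_ge0// ler_wpM2l ?expR_ge0//.
    by rewrite normrM ler_piMr ?cos_max.
under [X in L1 X]eq_fun do rewrite EF1.
move=> iE _; under eq_Rintegral do rewrite EF1.
under [in RHS]eq_Rintegral do rewrite EF2.
move=> EE; split => //; rewrite EE.
have iap : L1 (fun v => autocorr u v * pk (v / l)).
  apply: (L1_le _ (L1Z 2 L1_autocorr)).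
    apply: measurable_funM => //.
    have := L1_measurable (L1_affine 0 (invr_neq0 l_neq0) L1_pk).
    congr (measurable_fun _ _); apply/funext => v; rewrite addr0 mulrC//.
  move=> v; rewrite mulrC; rewrite normrM [leRHS]normrM ler_wpM2r// [leRHS]ger0_norm//.
  have h : 1 <= 1 + (v / l) ^+ 2 by rewrite lerDl sqr_ge0.
  have h0 : 0 < 1 + (v / l) ^+ 2 by rewrite (lt_le_trans _ h).
  rewrite [`|pk _|]ger0_norm; first by rewrite /pk ler_pdivrMr// ler_peMr.
  by rewrite /pk divr_ge0// ltW.
have := Rintegral_affine 0 l_neq0 iap.
under eq_Rintegral => w _.
  rewrite addr0 (_ : l * w / l = w); last by field.
  over.
move=> ->; rewrite gtr0_norm ?invr_gt0// -RintegralZl//.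
by apply: eq_Rintegral => v _; rewrite mulrCA.
Qed.

Let measurable_E : mfun E.
Proof.
have mc : mfun (costr u).
  apply: measurable_transform => //; [exact: continuous_cos|exact: cos_max].
have ms : mfun (sintr u).
  apply: measurable_transform => //; [exact: continuous_sin|exact: sin_max].
by apply: measurable_funD; exact: measurable_funX.
Qed.

(** Let [l] tend to 0 in [weighted]. The left hand side increases to the integral
    of [E]; on the right the autocorrelation is bounded by its value at 0 and
    continuous there, so that the limit is this value times the mass [2 * pi]
    of the Poisson kernel. *)
Lemma plancherel_real :
  (\int[mu]_t (costr u t ^+ 2 + sintr u t ^+ 2)%:E
   = (2 * pi * \int[mu]_x u x ^+ 2)%:E)%E.
Proof.
pose l (n : nat) : R := n.+1%:R^-1.
have l0 n : 0 < l n by rewrite invr_gt0.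
have cl : l @ \oo --> 0 by exact: cvg_harmonic.
have a0 : autocorr u 0 = \int[mu]_x u x ^+ 2.
  by apply: eq_Rintegral => x _; rewrite addr0 expr2.
have ma := L1_measurable L1_autocorr.
have mpk := L1_measurable L1_pk.
have pk0 w : 0 <= pk w by rewrite divr_ge0// addr_ge0// sqr_ge0.
have Ipk : \int[mu]_w pk w = 2 * pi by rewrite /Rintegral integral_poisson.
have lim2 : (fun n => \int[mu]_w (autocorr u (l n * w) * pk w)) @ \oo -->
    autocorr u 0 * \int[mu]_w pk w.
  rewrite -RintegralZl//.
  have [] // := @Rdominated_cvg _ (fun n w => autocorr u (l n * w) * pk w)
    (fun w => autocorr u 0 * pk w) (fun w => autocorr u 0 * pk w).
  - move=> n; apply: measurable_funM => //.
    have := L1_measurable (L1_affine 0 (lt0r_neq0 (l0 n)) L1_autocorr).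
    by congr (measurable_fun _ _); apply/funext => v; rewrite addr0.
  - exact: measurable_funM.
  - apply: nearW => w; apply: cvgM; last exact: cvg_cst.
    apply: (@autocorr_cvg (fun n => l n * w)).
    rewrite -[X in _ --> X](mul0r w); apply: cvgM => //; exact: cvg_cst.
  - exact: L1Z.
  - by move=> n w; rewrite normrM (ger0_norm (pk0 w)) ler_wpM2r.
have lim1 : (fun n => (\int[mu]_t (laplace (l n * t) * E t)%:E)%E) @ \oo -->
    (\int[mu]_t (E t)%:E)%E.
  have -> : (fun t => (E t)%:E) =
      (fun t => limn (fun n => (laplace (l n * t) * E t)%:E)).
    apply/funext => t; apply/esym/cvg_lim => //.
    apply: cvg_EFin; first exact: nearW.
    rewrite -[X in _ --> X]mul1r; apply: cvgM; last exact: cvg_cst.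
    rewrite /laplace -[X in _ --> X]expR0.
    apply: (continuous_cvg _ (@continuous_expR R 0)).
    rewrite -[X in _ --> X]oppr0; apply: cvgN.
    rewrite -[X in _ --> X](@normr0 _ R); apply: cvg_norm.
    rewrite -[X in _ --> X](mul0r t); apply: cvgM => //; exact: cvg_cst.
  apply: cvg_monotone_convergence => //.
  - move=> n; apply/measurable_EFinP; exact: L1_measurable (weighted (l0 n)).1.
  - by move=> n t _; rewrite lee_fin mulr_ge0// expR_ge0.
  - move=> t _ m n mn; rewrite lee_fin ler_wpM2r// ler_expR lerN2.
    have lmn : l n <= l m by rewrite lef_pV2 ?posrE ?ltr0n// ler_nat.
    by rewrite !normrM ler_wpM2r// (ger0_norm (ltW (l0 n))) (ger0_norm (ltW (l0 m))).
have : (fun n => (\int[mu]_t (laplace (l n * t) * E t)%:E)%E) @ \oo -->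
    (2 * pi * \int[mu]_x u x ^+ 2)%:E.
  rewrite -a0 mulrC -Ipk.
  under eq_fun do rewrite (Rintegral_EFin (weighted (l0 _)).1) (weighted (l0 _)).2.
  apply: cvg_EFin => //.
  exact: nearW.
by move/cvg_lim => <- //; apply/esym/cvg_lim.
Qed.

End fixed.
End RealPlancherel.

(** * Complex-valued square integrable functions *)

Section ComplexNumbers.
Variable R : realType.
Implicit Types z w : R[i].
Local Notation Re := complex.Re.
Local Notation Im := complex.Im.

Lemma cReD z w : Re (z + w) = Re z + Re w. Proof. by case: z w => ? ? []. Qed.
Lemma cImD z w : Im (z + w) = Im z + Im w. Proof. by case: z w => ? ? []. Qed.
Lemma cReN z : Re (- z) = - Re z. Proof. by case: z. Qed.
Lemma cImN z : Im (- z) = - Im z. Proof. by case: z. Qed.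
Lemma cReM z w : Re (z * w) = Re z * Re w - Im z * Im w.
Proof. by case: z w => ? ? []. Qed.
Lemma cImM z w : Im (z * w) = Re z * Im w + Im z * Re w.
Proof. by case: z w => ? ? []. Qed.
Lemma cReJ z : Re z^* = Re z. Proof. by case: z. Qed.
Lemma cImJ z : Im z^* = - Im z. Proof. by case: z. Qed.
Definition ReImE := (cReD, cImD, cReN, cImN, cReM, cImM, cReJ, cImJ).

Lemma complex_ext z w : Re z = Re w -> Im z = Im w -> z = w.
Proof. by case: z w => a b [c d] /= -> ->. Qed.

Definition sqmod z : R := Re z ^+ 2 + Im z ^+ 2.

Lemma sqmod_ge0 z : 0 <= sqmod z.
Proof. by rewrite addr_ge0 ?sqr_ge0. Qed.

Lemma sqmod0 : sqmod 0 = 0. Proof. by rewrite /sqmod/= expr0n addr0. Qed.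

Lemma sqmodE z : (sqmod z)%:C = `|z| ^+ 2.
Proof. exact: add_Re2_Im2. Qed.

Lemma sqmodM z w : sqmod (z * w) = sqmod z * sqmod w.
Proof. by rewrite /sqmod !ReImE; ring. Qed.

Lemma sqmodN z : sqmod (- z) = sqmod z.
Proof. by rewrite /sqmod !ReImE !sqrrN. Qed.

Lemma sqmodD_le z w : sqmod (z + w) <= 2 * (sqmod z + sqmod w).
Proof.
rewrite /sqmod !ReImE.
have := sqr_ge0 (Re z - Re w); have := sqr_ge0 (Im z - Im w); lra.
Qed.

Lemma Re_norm z : Re `|z| = Num.sqrt (sqmod z).
Proof. by rewrite normc_def. Qed.

End ComplexNumbers.

Section ComplexL2.
Variable R : realType.
Local Notation Re := complex.Re.
Local Notation Im := complex.Im.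
Local Notation mu := (@lebesgue_measure R).
Local Notation L1 f := (mu.-integrable setT (EFin \o f)).
Local Notation mfun f := (measurable_fun [set: measurableTypeR R] f).
Implicit Types f g h : R -> R[i].

(** The squared L2 norm, as an extended real number; [nrm] below is the same
    quantity as a real number, meaningful for square integrable functions. *)
Definition sqn f : \bar R := (\int[mu]_x (sqmod (f x))%:E)%E.

Lemma L2normE f : L2norm f = (sqn f `^ 2^-1)%E.
Proof.
rewrite /L2norm unlock /sqn; congr (_ `^ _)%E.
apply: eq_integral => x _.
rewrite Re_norm /= ger0_norm ?sqrtr_ge0//.
by rewrite powR_mulrn ?sqrtr_ge0// sqr_sqrtr ?sqmod_ge0.
Qed.

Lemma sqn_ge0 f : (0 <= sqn f)%E.
Proof. by apply: integral_ge0 => x _; rewrite lee_fin sqmod_ge0. Qed.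

Lemma sqrt_lt_EFin (x : \bar R) (e : R) : (0 <= x)%E -> 0 < e ->
  (x `^ 2^-1 < e%:E)%E = (x < (e ^+ 2)%:E)%E.
Proof.
case: x => [x|_ _|//]; last by rewrite poweRyr ?invr_neq0// !ltNge !leey.
rewrite lee_fin => x0 e0; rewrite poweR_EFin !lte_fin powR12_sqrt//.
by rewrite -[in LHS](ger0_norm (ltW e0)) -sqrtr_sqr ltr_sqrt ?exprn_gt0.
Qed.

Lemma L2norm_cvg0P (F : nat -> R -> R[i]) :
  (fun n => L2norm (F n)) @ \oo --> 0%E <->
  (forall e, 0 < e -> \forall n \near \oo, (sqn (F n) < e%:E)%E).
Proof.
split=> [/fine_cvgP[Ff F0] e e0|H].
  have se0 : 0 < Num.sqrt e by rewrite sqrtr_gt0.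
  move/cvgrPdist_lt : F0 => /(_ _ se0) F0; near=> n.
  have : `|0 - fine (L2norm (F n))| < Num.sqrt e by near: n; exact: F0.
  have fn : L2norm (F n) \is a fin_num by near: n; exact: Ff.
  rewrite sub0r normrN => /(le_lt_trans (ler_norm _)).
  rewrite -lte_fin fineK// L2normE sqrt_lt_EFin ?sqn_ge0// sqr_sqrtr// ltW//.
have H' e : 0 < e -> \forall n \near \oo, (L2norm (F n) < e%:E)%E.
  move=> e0; have := H (e ^+ 2); rewrite exprn_gt0// => /(_ isT).
  by apply: filterS => n; rewrite L2normE sqrt_lt_EFin ?sqn_ge0.
have L0 n : (0 <= L2norm (F n))%E by rewrite L2normE poweR_ge0.
apply/fine_cvgP; split.
  have := H' 1 ltr01; apply: filterS => n h.
  by rewrite ge0_fin_numE// (lt_trans h) ?ltry.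
apply/cvgrPdist_lt => e e0; have := H' e e0; apply: filterS => n h.
have fn : L2norm (F n) \is a fin_num by rewrite ge0_fin_numE// (lt_trans h) ?ltry.
by rewrite sub0r normrN ger0_norm ?fine_ge0// -lte_fin fineK.
Unshelve. all: by end_near. Qed.

Lemma measurable_sqmod f : Cmeasurable f -> mfun (fun x => sqmod (f x)).
Proof. by move=> [mr mi]; apply: measurable_funD; exact: measurable_funX. Qed.

Lemma inL2P f : inL2 f <-> Cmeasurable f /\ L1 (fun x => sqmod (f x)).
Proof.
split=> -[mf h]; split=> //.
  apply/integrableP; split; first by apply/measurable_EFinP; exact: measurable_sqmod.
  under eq_integral do rewrite /= ger0_norm ?sqmod_ge0//.
  by move: h; rewrite L2normE => /lty_poweRy; apply; rewrite invr_neq0.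
rewrite L2normE; move: h => /integrableP[_].
under eq_integral do rewrite /= ger0_norm ?sqmod_ge0//.
by rewrite -/(sqn f) => h; rewrite poweR_lty.
Qed.

Lemma L1_Re2 f : inL2 f -> L1 (fun x => Re (f x) ^+ 2).
Proof.
move=> /inL2P[[mr mi] h]; apply: (L1_le _ h); first exact: measurable_funX.
move=> x; rewrite !ger0_norm ?sqr_ge0 ?sqmod_ge0//.
by rewrite /sqmod lerDl sqr_ge0.
Qed.

Lemma L1_Im2 f : inL2 f -> L1 (fun x => Im (f x) ^+ 2).
Proof.
move=> /inL2P[[mr mi] h]; apply: (L1_le _ h); first exact: measurable_funX.
move=> x; rewrite !ger0_norm ?sqr_ge0 ?sqmod_ge0//.
by rewrite /sqmod lerDr sqr_ge0.
Qed.

Lemma CmeasurableD f g : Cmeasurable f -> Cmeasurable g ->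
  Cmeasurable (fun x => f x + g x).
Proof.
move=> [fr fi] [gr gi]; split.
  by under eq_fun do rewrite cReD; exact: measurable_funD.
by under eq_fun do rewrite cImD; exact: measurable_funD.
Qed.

Lemma CmeasurableM f g : Cmeasurable f -> Cmeasurable g ->
  Cmeasurable (fun x => f x * g x).
Proof.
move=> [fr fi] [gr gi]; split.
  under eq_fun do rewrite cReM.
  by apply: measurable_funB; exact: measurable_funM.
under eq_fun do rewrite cImM.
by apply: measurable_funD; exact: measurable_funM.
Qed.

Lemma Cmeasurable_cst (c : R[i]) : Cmeasurable (fun=> c : R[i]).
Proof. by split; exact: measurable_cst. Qed.

Lemma Cmeasurable_affine c d f : Cmeasurable f ->
  Cmeasurable (fun x => f (c * x + d)).
Proof.
by move=> [fr fi]; split;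
  [exact: (measurableT_comp fr (measurable_affine c d))|exact: (measurableT_comp fi (measurable_affine c d))].
Qed.

Lemma inL2D f g : inL2 f -> inL2 g -> inL2 (fun x => f x + g x).
Proof.
move=> /inL2P[mf hf] /inL2P[mg hg]; apply/inL2P.
have mfg := CmeasurableD mf mg; split=> //.
apply: (L1_le _ (L1Z 2 (L1D hf hg))); first exact: measurable_sqmod.
move=> x; rewrite !ger0_norm ?sqmod_ge0 ?sqmodD_le//.
by rewrite mulr_ge0// addr_ge0// sqmod_ge0.
Qed.

Lemma inL2Z (c : R[i]) f : inL2 f -> inL2 (fun x => c * f x).
Proof.
move=> /inL2P[mf hf]; apply/inL2P; split.
  by apply: CmeasurableM => //; exact: Cmeasurable_cst.
by under [X in EFin \o X]eq_fun do rewrite sqmodM; exact: L1Z.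
Qed.

Lemma inL2B f g : inL2 f -> inL2 g -> inL2 (fun x => f x - g x).
Proof.
move=> hf /(inL2Z (-1)) hg.
by have := inL2D hf hg; under eq_fun do rewrite mulN1r.
Qed.

Lemma inL2_affine (c d : R) f : c != 0 -> inL2 f -> inL2 (fun x => f (c * x + d)).
Proof.
move=> c0 /inL2P[mf hf]; apply/inL2P; split; first exact: (Cmeasurable_affine c d mf).
exact: (L1_affine d c0 hf).
Qed.

Lemma inL2_0 : inL2 (fun=> 0 : R[i]).
Proof.
apply/inL2P; split; first exact: Cmeasurable_cst.
under [X in EFin \o X]eq_fun do rewrite sqmod0.
exact: integrable0.
Qed.

Lemma inL2_sum (I : Type) (s : seq I) (F : I -> R -> R[i]) :
  (forall i, inL2 (F i)) -> inL2 (fun x => \sum_(i <- s) F i x).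
Proof.
move=> hF; elim: s => [|i s IH].
  by under eq_fun do rewrite big_nil; exact: inL2_0.
by under eq_fun do rewrite big_cons; exact: inL2D.
Qed.

Definition nrm f : R := \int[mu]_x sqmod (f x).

Lemma sqnE f : inL2 f -> sqn f = (nrm f)%:E.
Proof. by move=> /inL2P[_ hf]; rewrite /sqn Rintegral_EFin. Qed.

Lemma CintegrableD f g : Cintegrable f -> Cintegrable g ->
  Cintegrable (fun x => f x + g x).
Proof.
move=> [fr fi] [gr gi]; split.
  by under [X in integrable _ _ X]eq_fun do rewrite cReD; exact: L1D.
by under [X in integrable _ _ X]eq_fun do rewrite cImD; exact: L1D.
Qed.

Lemma CintegrableZ (c : R[i]) f : Cintegrable f -> Cintegrable (fun x => c * f x).
Proof.
move=> [fr fi]; split.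
  by under [X in integrable _ _ X]eq_fun do rewrite cReM; apply: L1B; exact: L1Z.
by under [X in integrable _ _ X]eq_fun do rewrite cImM; apply: L1D; exact: L1Z.
Qed.

Lemma Cintegrable_affine (c d : R) f : c != 0 -> Cintegrable f ->
  Cintegrable (fun x => f (c * x + d)).
Proof. by move=> c0 [fr fi]; split; [exact: (L1_affine d c0 fr)|exact: (L1_affine d c0 fi)]. Qed.

Lemma Cintegrable0 : Cintegrable (fun=> 0 : R[i]).
Proof. by split; exact: integrable0. Qed.

Lemma CintegralD f g : Cintegrable f -> Cintegrable g ->
  Cintegral (fun x => f x + g x) = Cintegral f + Cintegral g.
Proof.
move=> [fr fi] [gr gi]; apply: complex_ext; rewrite !ReImE/=.
  by rewrite -RintegralD//; apply: eq_Rintegral => x _; rewrite cReD.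
by rewrite -RintegralD//; apply: eq_Rintegral => x _; rewrite cImD.
Qed.

Lemma CintegralZ (c : R[i]) f : Cintegrable f ->
  Cintegral (fun x => c * f x) = c * Cintegral f.
Proof.
move=> [fr fi]; apply: complex_ext; rewrite !ReImE/=.
  rewrite -!RintegralZl// -RintegralB//; [|exact: L1Z|exact: L1Z].
  by apply: eq_Rintegral => x _; rewrite cReM.
rewrite -!RintegralZl// -RintegralD//; [|exact: L1Z|exact: L1Z].
by apply: eq_Rintegral => x _; rewrite cImM.
Qed.

Lemma Cintegral0 : Cintegral (fun=> 0 : R[i]) = 0.
Proof. by apply: complex_ext; rewrite /= /Rintegral integral0. Qed.

Lemma CintegralJ f : Cintegrable f ->
  Cintegral (fun x => (f x)^*) = (Cintegral f)^*.
Proof.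
move=> [fr fi]; apply: complex_ext; rewrite !ReImE/=.
  by apply: eq_Rintegral => x _; rewrite cReJ.
rewrite -mulN1r -RintegralZl//; apply: eq_Rintegral => x _.
by rewrite cImJ mulN1r.
Qed.

Lemma Cintegral_affine (c d : R) f : c != 0 -> Cintegrable f ->
  Cintegral (fun x => f (c * x + d)) = `|c^-1|%:C * Cintegral f.
Proof.
move=> c0 [fr fi]; apply: complex_ext; rewrite !ReImE/=.
  by rewrite (Rintegral_affine d c0 fr) mul0r subr0.
by rewrite (Rintegral_affine d c0 fi) mul0r addr0.
Qed.

Lemma Cintegrable_sum (I : Type) (s : seq I) (F : I -> R -> R[i]) :
  (forall i, Cintegrable (F i)) -> Cintegrable (fun x => \sum_(i <- s) F i x).
Proof.
move=> hF; elim: s => [|i s IH].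
  by under eq_fun do rewrite big_nil; exact: Cintegrable0.
by under eq_fun do rewrite big_cons; exact: CintegrableD.
Qed.

Lemma Cintegral_sum (I : Type) (s : seq I) (F : I -> R -> R[i]) :
  (forall i, Cintegrable (F i)) ->
  Cintegral (fun x => \sum_(i <- s) F i x) = \sum_(i <- s) Cintegral (F i).
Proof.
move=> hF; elim: s => [|i s IH].
  by under eq_fun do rewrite big_nil; rewrite big_nil Cintegral0.
under eq_fun do rewrite big_cons.
by rewrite CintegralD// ?IH ?big_cons//; exact: Cintegrable_sum.
Qed.

Lemma Cintegrable_inner f g : inL2 f -> inL2 g ->
  Cintegrable (fun x => (f x)^* * g x).
Proof.
move=> hf hg.
have [[fr fi] _] := (inL2P f).1 hf; have [[gr gi] _] := (inL2P g).1 hg.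
have [fr2 fi2] := (L1_Re2 hf, L1_Im2 hf).
have [gr2 gi2] := (L1_Re2 hg, L1_Im2 hg).
split.
  under [X in integrable _ _ X]eq_fun do rewrite !ReImE mulNr opprK.
  by apply: L1D; exact: L1_mul.
under [X in integrable _ _ X]eq_fun do rewrite !ReImE mulNr.
by apply: L1B; exact: L1_mul.
Qed.

Lemma L2innerDr f g h : inL2 f -> inL2 g -> inL2 h ->
  L2inner f (fun x => g x + h x) = L2inner f g + L2inner f h.
Proof.
move=> hf hg hh; rewrite -CintegralD; [|exact: Cintegrable_inner..].
by congr Cintegral; apply/funext => x; rewrite mulrDr.
Qed.

Lemma L2innerZr (c : R[i]) f g : inL2 f -> inL2 g ->
  L2inner f (fun x => c * g x) = c * L2inner f g.
Proof.
move=> hf hg; rewrite -CintegralZ; last exact: Cintegrable_inner.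
by congr Cintegral; apply/funext => x; rewrite mulrCA.
Qed.

Lemma L2innerC f g : inL2 f -> inL2 g -> L2inner g f = (L2inner f g)^*.
Proof.
move=> hf hg; rewrite /L2inner -CintegralJ; last exact: Cintegrable_inner.
by congr Cintegral; apply/funext => x; rewrite rmorphM/= conjcK mulrC.
Qed.

Lemma L2innerZl (c : R[i]) f g : inL2 f -> inL2 g ->
  L2inner (fun x => c * f x) g = c^* * L2inner f g.
Proof.
move=> hf hg; rewrite L2innerC//; last exact: inL2Z.
by rewrite L2innerZr// (L2innerC hg hf) [LHS]rmorphM.
Qed.

Lemma L2inner_sumr (I : Type) (s : seq I) f (G : I -> R -> R[i]) : inL2 f ->
  (forall i, inL2 (G i)) ->
  L2inner f (fun x => \sum_(i <- s) G i x) = \sum_(i <- s) L2inner f (G i).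
Proof.
move=> hf hG; rewrite -Cintegral_sum; last by move=> i; exact: Cintegrable_inner.
by congr Cintegral; apply/funext => x; rewrite mulr_sumr.
Qed.

Lemma L2inner_suml (I : Type) (s : seq I) (F : I -> R -> R[i]) g : inL2 g ->
  (forall i, inL2 (F i)) ->
  L2inner (fun x => \sum_(i <- s) F i x) g = \sum_(i <- s) L2inner (F i) g.
Proof.
move=> hg hF; rewrite L2innerC//; last exact: inL2_sum.
rewrite L2inner_sumr// rmorph_sum; apply: eq_bigr => i _.
by rewrite [RHS](L2innerC hg (hF i)).
Qed.

Lemma L2inner_affine (c d : R) f g : c != 0 -> inL2 f -> inL2 g ->
  L2inner (fun x => f (c * x + d)) (fun x => g (c * x + d))
  = `|c^-1|%:C * L2inner f g.
Proof.
move=> c0 hf hg; rewrite -(Cintegral_affine d c0 (Cintegrable_inner hf hg))//.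
Qed.

Lemma Re_L2inner_nrm f : inL2 f -> complex.Re (L2inner f f) = nrm f.
Proof.
by move=> hf; apply: eq_Rintegral => x _; rewrite !ReImE /sqmod; ring.
Qed.

Lemma Re_L2innerE f g : complex.Re (L2inner f g) = \int[mu]_x complex.Re ((f x)^* * g x).
Proof. by []. Qed.

Lemma nrmB f g : inL2 f -> inL2 g ->
  nrm (fun x => f x - g x) = nrm f + nrm g - 2 * Re (L2inner f g).
Proof.
move=> hf hg; have [ifg _] := Cintegrable_inner hf hg.
have [_ hf'] := (inL2P f).1 hf; have [_ hg'] := (inL2P g).1 hg.
rewrite Re_L2innerE -RintegralZl// -RintegralD// -RintegralB//.
- by apply: eq_Rintegral => x _; rewrite /sqmod !ReImE; ring.
- exact: L1D.
- exact: L1Z.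
Qed.

(** A form of the Cauchy-Schwarz inequality without square roots: the free
    parameter [s] lets one factor be small at the expense of the other. *)
Lemma L2inner_le f g (s : R) : inL2 f -> inL2 g -> 0 < s ->
  `|Re (L2inner f g)| <= s * nrm f + s^-1 * nrm g /\
  `|Im (L2inner f g)| <= s * nrm f + s^-1 * nrm g.
Proof.
move=> hf hg s0; have [ir ii] := Cintegrable_inner hf hg.
have [_ hf'] := (inL2P f).1 hf; have [_ hg'] := (inL2P g).1 hg.
have key (a b c d : R) : `|a * c + b * d| <=
    s * (a ^+ 2 + b ^+ 2) + s^-1 * (c ^+ 2 + d ^+ 2).
  have pos (p q : R) : 0 <= s^-1 * ((p ^+ 2 + q ^+ 2) +
      s ^+ 2 * (a ^+ 2 + b ^+ 2) + (c ^+ 2 + d ^+ 2)).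
    apply: mulr_ge0; first by rewrite invr_ge0 ltW.
    have sq (x y : R) : 0 <= x ^+ 2 + y ^+ 2 by rewrite addr_ge0 ?sqr_ge0.
    by apply: addr_ge0 => //; apply: addr_ge0 => //; apply: mulr_ge0; rewrite ?sqr_ge0.
  have e1 : 0 <= s^-1 * (((s * a + c) ^+ 2 + (s * b + d) ^+ 2) +
      s ^+ 2 * (a ^+ 2 + b ^+ 2) + (c ^+ 2 + d ^+ 2)).
    exact: pos.
  have e2 : 0 <= s^-1 * (((s * a - c) ^+ 2 + (s * b - d) ^+ 2) +
      s ^+ 2 * (a ^+ 2 + b ^+ 2) + (c ^+ 2 + d ^+ 2)).
    exact: pos.
  have e1' : s^-1 * (((s * a + c) ^+ 2 + (s * b + d) ^+ 2) +
      s ^+ 2 * (a ^+ 2 + b ^+ 2) + (c ^+ 2 + d ^+ 2))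
    = 2 * (s * (a ^+ 2 + b ^+ 2) + s^-1 * (c ^+ 2 + d ^+ 2)) + 2 * (a * c + b * d).
    by field; rewrite gt_eqF.
  have e2' : s^-1 * (((s * a - c) ^+ 2 + (s * b - d) ^+ 2) +
      s ^+ 2 * (a ^+ 2 + b ^+ 2) + (c ^+ 2 + d ^+ 2))
    = 2 * (s * (a ^+ 2 + b ^+ 2) + s^-1 * (c ^+ 2 + d ^+ 2)) - 2 * (a * c + b * d).
    by field; rewrite gt_eqF.
  rewrite e1' in e1; rewrite e2' in e2.
  by rewrite ler_norml; apply/andP; split; lra.
rewrite /nrm -!RintegralZl// -RintegralD//; [|exact: L1Z|exact: L1Z].
have iB : L1 (fun x => s * sqmod (f x) + s^-1 * sqmod (g x)) by apply: L1D; exact: L1Z.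
split; rewrite (le_trans (le_normr_Rintegral _ _))//.
  apply: le_Rintegral => //; first exact: L1_norm.
  by move=> x _; rewrite !ReImE mulNr opprK; exact: key.
apply: le_Rintegral => //; first exact: L1_norm.
move=> x _; rewrite !ReImE; apply: (le_trans (key _ _ _ _)).
by rewrite sqrrN [Im (g x) ^+ 2 + _]addrC.
Qed.

Lemma nrmD_le f g : inL2 f -> inL2 g ->
  nrm (fun x => f x + g x) <= 2 * (nrm f + nrm g).
Proof.
move=> hf hg; have [_ hf'] := (inL2P f).1 hf; have [_ hg'] := (inL2P g).1 hg.
have [_ hfg] := (inL2P _).1 (inL2D hf hg).
rewrite -RintegralD// -RintegralZl//; last exact: L1D.
apply: le_Rintegral => //; first by apply: L1Z; exact: L1D.
by move=> x _; exact: sqmodD_le.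
Qed.

End ComplexL2.

(** * The Plancherel identity *)

Section Plancherel.
Variable R : realType.
Local Notation Re := complex.Re.
Local Notation Im := complex.Im.
Local Notation mu := (@lebesgue_measure R).
Local Notation L1 f := (mu.-integrable setT (EFin \o f)).
Local Notation mfun f := (measurable_fun [set: measurableTypeR R] f).
Implicit Types f g h : R -> R[i].
Local Notation re f := (fun x => Re (f x)).
Local Notation im f := (fun x => Im (f x)).

Lemma fourierE f t : Cintegrable f ->
  fourier f t = (costr (re f) t + sintr (im f) t) +i*
                (costr (im f) t - sintr (re f) t).
Proof.
move=> [fr fi].
have cr := L1_cos t fr; have ci := L1_cos t fi.
have sr := L1_sin t fr; have si := L1_sin t fi.
apply: complex_ext => /=.
  rewrite -RintegralD//; apply: eq_Rintegral => x _.
  by rewrite cReM/= cosN sinN mulrN opprK.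
rewrite -RintegralB//; apply: eq_Rintegral => x _.
by rewrite cImM/= cosN sinN mulrN addrC.
Qed.

Lemma measurable_costr u : L1 u -> mfun (costr u).
Proof.
apply: measurable_transform; [exact: continuous_cos|exact: cos_max].
Qed.

Lemma measurable_sintr u : L1 u -> mfun (sintr u).
Proof.
apply: measurable_transform; [exact: continuous_sin|exact: sin_max].
Qed.

Lemma Cmeasurable_fourier f : Cintegrable f -> Cmeasurable (fourier f).
Proof.
move=> hf; have [fr fi] := hf; split.
  under eq_fun do rewrite fourierE//=.
  by apply: measurable_funD; [exact: measurable_costr|exact: measurable_sintr].
under eq_fun do rewrite fourierE//=.
by apply: measurable_funB; [exact: measurable_costr|exact: measurable_sintr].
Qed.

Lemma costrN (u : R -> R) t : costr u (- t) = costr u t.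
Proof. by apply: eq_Rintegral => x _; rewrite mulNr cosN. Qed.

Lemma sintrN (u : R -> R) t : L1 u -> sintr u (- t) = - sintr u t.
Proof.
move=> hu; rewrite /sintr -[RHS]mulN1r -RintegralZl//; last exact: L1_sin.
by apply: eq_Rintegral => x _; rewrite mulNr sinN mulrN mulN1r.
Qed.

(** The cross terms between the transforms of the real and imaginary parts are
    odd in [t]: symmetrization separates the two parts. *)
Lemma sqmod_fourier_sym f t : Cintegrable f ->
  sqmod (fourier f t) + sqmod (fourier f (- t)) =
  2 * ((costr (re f) t ^+ 2 + sintr (re f) t ^+ 2) +
       (costr (im f) t ^+ 2 + sintr (im f) t ^+ 2)).
Proof.
move=> hf; have [fr fi] := hf.
by rewrite !fourierE// /sqmod/= !costrN !sintrN//; ring.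
Qed.

(** The integral is invariant under [t -> - t], so that twice the left hand side
    is the integral of the symmetrized expression, to which the identity for
    real functions applies twice. *)
Theorem plancherel f : Cintegrable f -> inL2 f ->
  sqn (fourier f) = ((2 * pi) * nrm f)%:E.
Proof.
move=> hf hf2; have [fr fi] := hf.
have fr2 := L1_Re2 hf2; have fi2 := L1_Im2 hf2.
have ms := measurable_sqmod (Cmeasurable_fourier hf).
have sym : (\int[mu]_t (sqmod (fourier f (- t)))%:E = sqn (fourier f))%E.
  rewrite /sqn; have := @ge0_integral_affine R (-1) 0 (fun t => (sqmod (fourier f t))%:E).
  rewrite oppr_eq0 oner_eq0 invrN invr1 normrN1 mul1e => /(_ isT) <-.
  - by apply: eq_integral => t _; rewrite mulN1r addr0.
  - exact/measurable_EFinP.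
  - by move=> t; rewrite lee_fin sqmod_ge0.
have ms' : mfun (fun t => sqmod (fourier f (- t))).
  by apply: (@measurableT_comp _ _ _ _ _ _ (fun t => sqmod (fourier f t))).
have dbl : (sqn (fourier f) + sqn (fourier f) = (2 * (2 * pi * nrm f))%:E)%E.
  rewrite -[X in (_ + X = _)%E]sym /sqn -ge0_integralD; last 5 first.
  - exact: measurableT.
  - by move=> t _; rewrite lee_fin sqmod_ge0.
  - exact/measurable_EFinP.
  - by move=> t _; rewrite lee_fin sqmod_ge0.
  - exact/measurable_EFinP.
  pose e (u : R -> R) (t : R) : \bar R := (costr u t ^+ 2 + sintr u t ^+ 2)%:E.
  have me u : L1 u -> measurable_fun [set: measurableTypeR R] (e u).
    move=> hu; apply/measurable_EFinP; apply: measurable_funD; apply: measurable_funX.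
      exact: measurable_costr.
    exact: measurable_sintr.
  have e0 u t : (0 <= e u t)%E by apply: addr_ge0; exact: sqr_ge0.
  transitivity (\int[mu]_t (2%:E * (e (re f) t + e (im f) t)))%E.
    by apply: eq_integral => t _; rewrite -!EFinD -EFinM sqmod_fourier_sym.
  transitivity (2%:E * \int[mu]_t (e (re f) t + e (im f) t))%E.
    have m2 : measurable_fun [set: measurableTypeR R] (fun t => e (re f) t + e (im f) t)%E.
      by apply: emeasurable_funD; exact: me.
    have n2 t : setT t -> (0 <= e (re f) t + e (im f) t)%E by move=> _; apply: adde_ge0.
    have n3 : (0 <= 2%:E :> \bar R)%E by rewrite lee_fin.
    exact: (@ge0_integralZl _ _ _ mu setT measurableT _ m2 2%:E n2 n3).
  transitivity (2%:E * (\int[mu]_t e (re f) t + \int[mu]_t e (im f) t))%E.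
    congr (_ * _)%E.
    exact: (@ge0_integralD _ _ _ mu setT measurableT (e (re f)) (e (im f))
      (fun t _ => e0 _ t) (me _ fr) (fun t _ => e0 _ t) (me _ fi)).
  rewrite (plancherel_real fr fr2) (plancherel_real fi fi2) -EFinD -EFinM -mulrDr; congr (_ * (_ * _))%:E.
  by rewrite -RintegralD.
have : (0 <= sqn (fourier f))%E by exact: sqn_ge0.
move: dbl; case: (sqn _) => [x [e] _|//|//]; congr EFin.
apply: (@mulfI _ 2); first by rewrite pnatr_eq0.
by rewrite [LHS]mulr_natl mulr2n; exact: e.
Qed.

End Plancherel.

(** * The Ruelle operator on coefficients *)

Section Windows.
Variable V : nmodType.
Implicit Types (F : int -> V) (r : int) (D : nat).

Lemma fsbig_window (A : set int) F r D :
  (forall i : nat, (i < D)%N -> A (r + i%:Z)) ->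
  (forall k, A k -> ~~ (r <= k < r + D%:Z) -> F k = 0) ->
  \sum_(k \in A) F k = \sum_(i < D) F (r + i%:Z).
Proof.
move=> sA F0; rewrite (fsbigE [seq r + i%:Z | i <- iota 0 D]).
- rewrite big_map -[in LHS](subn0 D) -/(index_iota 0 D) big_mkord.
  by apply: eq_bigl => i; rewrite mem_set//; apply: sA; exact: ltn_ord.
- by rewrite map_inj_uniq ?iota_uniq// => i j /addrI [].
- move=> k; rewrite /= => hk; case/(@mapP _ _ _ _ _): hk => i; rewrite mem_iota => /= iD ->; apply: sA; lia.
- move=> k Ak kn; apply: F0 => //; apply: contra kn => /andP[rk kD].
  apply/mapP; exists `|k - r|%N; first by rewrite mem_iota; lia.
  lia.
Qed.

Lemma fsbig_segment (r s : int) F : r <= s ->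
  \sum_(k \in [set k : int | r <= k <= s]) F k =
  \sum_(i < `|s - r|%N.+1) F (r + i%:Z).
Proof.
move=> rs; apply: fsbig_window => [i iD|k /= ks kn]; last by exfalso; lia.
by move=> /=; lia.
Qed.

End Windows.

Section Transfer.
Variables (R : realType) (N : nat) (a : int -> R[i]).
Implicit Types (c : int -> R[i]) (r m : int) (D : nat) (z w : R[i]).

(** The coefficient sequence of [R xi] when [c] is that of [xi]: the product by
    [|m0|^2] is a convolution with the autocorrelation of [a], and averaging over
    the two square roots keeps the coefficients of even index. *)
Definition transfer c (j : int) : R[i] :=
  \sum_(k < N.+1) \sum_(l < N.+1)
    (a k%:Z)^* * a l%:Z * c (2 * j + k%:Z - l%:Z).

Definition window r D c := forall m, ~~ (r <= m < r + D%:Z) -> c m = 0.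

(** The windows that [transfer] maps into themselves; here [r] is the lowest
    degree and [D] the number of coefficients. *)
Definition wide r D := (r <= - N%:Z) /\ (N%:Z < r + D%:Z).

Lemma transfer_window r D c : wide r D -> window r D c -> window r D (transfer c).
Proof.
move=> [rN Ns] wc m hm; rewrite /transfer big1// => k _; rewrite big1// => l _.
have := ltn_ord k; have := ltn_ord l => lN kN.
by rewrite wc ?mulr0//; lia.
Qed.

Definition laurent r D c z : R[i] := \sum_(i < D) c (r + i%:Z) * z ^ (r + i%:Z).

Lemma unit_neq0 z : `|z| = 1 -> z != 0.
Proof. by move=> z1; rewrite -normr_eq0 z1 oner_eq0. Qed.

Lemma unit_conj z : `|z| = 1 -> z^* = z^-1.
Proof. by move=> z1; rewrite invc_norm z1 expr1n invr1 mul1r. Qed.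

Lemma sqr_norm_m0 z : `|z| = 1 -> `|m0 N a z| ^+ 2 =
  \sum_(k < N.+1) \sum_(l < N.+1) (a k%:Z)^* * a l%:Z * z ^ (l%:Z - k%:Z).
Proof.
move=> z1; have z0 := unit_neq0 z1.
rewrite sqr_normc mulrC /m0 big_mkord [(\sum_(_ < _) _)^*](rmorph_sum conjc)/= mulr_suml.
apply: eq_bigr => k _; rewrite mulr_sumr; apply: eq_bigr => l _.
rewrite (rmorphM conjc) (rmorphXn conjc)/= (unit_conj z1) expfzDr// -exprz_inv -!exprnP.
by ring.
Qed.

Lemma ruelleE (xi : circle R -> R[i]) (z w w' : circle R) :
  val w ^+ 2 = val z -> val w' = - val w ->
  ruelle N a xi z =
  2^-1 * (`|m0 N a (val w)| ^+ 2 * xi w + `|m0 N a (val w')| ^+ 2 * xi w').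
Proof.
move=> wz ww'; rewrite /ruelle (fsbigE [:: w; w']).
- rewrite !big_cons big_nil ifT; last by apply: mem_set.
  rewrite ifT; first by rewrite /= addr0.
  by apply: mem_set; rewrite /= ww' sqrrN.
- rewrite /= andbT inE -(inj_eq val_inj) ww' -addr_eq0 -mulr2n mulrn_eq0/=.
  by apply: unit_neq0; exact/eqP/(valP w).
- by move=> v /=; rewrite !inE => /orP[] /eqP ->//; rewrite ww' sqrrN.
- move=> v /= vz; rewrite !inE negb_or -!(inj_eq val_inj) ww' => /andP[h1 h2].
  exfalso; have : (val v - val w) * (val v + val w) == 0.
    by rewrite -subr_sqr vz wz subrr.
  by rewrite mulf_eq0 subr_eq0 addr_eq0 (negbTE h1) (negbTE h2).
Qed.

Lemma circle_sqrt (z : circle R) : exists w w' : circle R,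
  val w ^+ 2 = val z /\ val w' = - val w.
Proof.
have z1 : `|val z| = 1 by exact/eqP/(valP z).
have w1 : `|sqrtc (val z)| == 1.
  rewrite -(eqrXn2 (n := 2))// expr1n -normrX sqr_sqrtc z1//.
have w1' : `|- sqrtc (val z)| == 1 by rewrite normrN.
by exists (exist _ (sqrtc (val z)) w1), (exist _ (- sqrtc (val z)) w1'); split => //=; exact: sqr_sqrtc.
Qed.

Lemma int_parity (m : int) : exists j, m = 2 * j \/ m = 2 * j + 1.
Proof.
exists (m %/ 2)%Z; lia.
Qed.

(** Both sides are [z ^ j] if the exponent on the right is an even number
    [2 * j], and 0 if it is odd. A wide window contains all the exponents [j] so
    obtained from exponents in the window. *)
Lemma transfer_delta r D (i : 'I_D) (k l : 'I_N.+1) z w : wide r D ->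
  w != 0 -> w ^+ 2 = z ->
  \sum_(j < D) (2 * (r + j%:Z) + k%:Z - l%:Z == r + i%:Z)%:R * z ^ (r + j%:Z) =
  2^-1 * (w ^ (l%:Z - k%:Z + (r + i%:Z)) + (- w) ^ (l%:Z - k%:Z + (r + i%:Z))).
Proof.
move=> [rN Ns] w0 wz; have kN := ltn_ord k; have lN := ltn_ord l; have iD := ltn_ord i.
have w2 : w ^ (2 : int) = z by rewrite -wz.
have w2' : (- w) ^ (2 : int) = z by rewrite -wz -[RHS]sqrrN.
have [j [e|e]] := int_parity (l%:Z - k%:Z + (r + i%:Z)).
  have hj : (`|j - r| < D)%N by lia.
  rewrite (bigD1 (Ordinal hj))//= big1 ?addr0; last first.
    move=> j' j'j; rewrite (_ : (_ == _) = false) ?mul0r//.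
    apply/negbTE; apply: contra j'j => /eqP e'; apply/eqP/val_inj => /=; lia.
  rewrite (_ : r + `|j - r|%N = j); last lia.
  rewrite (_ : (_ == _) = true) ?mul1r; last by apply/eqP; lia.
  by rewrite e -!exprz_exp w2 w2' -mulr2n -[z ^ j *+ 2]mulr_natl mulKf ?pnatr_eq0.
rewrite big1 => [|j' _]; last first.
  by rewrite (_ : (_ == _) = false) ?mul0r//; apply/negbTE/eqP; lia.
by rewrite e !expfzDr ?oppr_eq0// -!exprz_exp w2 w2' !expr1z mulrN subrr mulr0.
Qed.

Lemma window_expand r D c m : window r D c ->
  c m = \sum_(i < D) (m == r + i%:Z)%:R * c (r + i%:Z).
Proof.
move=> wc; have [hm|hm] := boolP (r <= m < r + D%:Z); last first.
  rewrite wc// big1// => i _; have iD := ltn_ord i.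
  by rewrite (_ : (_ == _) = false) ?mul0r//; apply/negbTE/eqP; lia.
have hi : (`|m - r| < D)%N by lia.
rewrite (bigD1 (Ordinal hi))//= big1 ?addr0; last first.
  move=> j' j'j; rewrite (_ : (_ == _) = false) ?mul0r//.
  apply/negbTE; apply: contra j'j => /eqP e'; apply/eqP/val_inj => /=; lia.
rewrite (_ : r + `|m - r|%N = m); last lia.
by rewrite eqxx mul1r.
Qed.

(** Expand both sides over the triple of indices of [conj a], [a] and [c]; for
    each triple this is [transfer_delta]. *)
Lemma ruelle_laurent r D c : wide r D -> window r D c ->
  ruelle N a (fun z : circle R => laurent r D c (val z)) =
  (fun z : circle R => laurent r D (transfer c) (val z)).
Proof.
move=> wd wc; apply/funext => z.
have [w [w' [wz ww']]] := circle_sqrt z.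
rewrite (ruelleE _ wz ww') ww'.
have w1 : `|val w| = 1 by exact/eqP/(valP w).
have w0 := unit_neq0 w1.
rewrite !sqr_norm_m0 ?normrN// /laurent.
transitivity (\sum_(k < N.+1) \sum_(l < N.+1) (a k%:Z)^* * a l%:Z *
   \sum_(i < D) c (r + i%:Z) * \sum_(j < D)
     (2 * (r + j%:Z) + k%:Z - l%:Z == r + i%:Z)%:R * val z ^ (r + j%:Z)).
  rewrite !mulr_suml -big_split/= mulr_sumr; apply: eq_bigr => k _.
  rewrite !mulr_suml -big_split/= mulr_sumr; apply: eq_bigr => l _.
  have aux (A p q p' q' : R[i]) :
    2^-1 * (A * p * q + A * p' * q') = A * (2^-1 * (p * q + p' * q')) by ring.
  rewrite aux; congr (_ * _).
  rewrite !mulr_sumr -big_split/= mulr_sumr; apply: eq_bigr => i _.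
  rewrite (transfer_delta _ _ _ wd w0 wz) !expfzDr ?oppr_eq0//.
  by ring.
rewrite /transfer.
under [RHS]eq_bigr => j _.
  rewrite mulr_suml; under eq_bigr do rewrite mulr_suml.
  over.
rewrite [RHS]exchange_big/=; apply: eq_bigr => k _.
rewrite [RHS]exchange_big/=; apply: eq_bigr => l _.
rewrite [LHS]mulr_sumr; under [LHS]eq_bigr => i _ do rewrite mulrA mulr_sumr.
rewrite [LHS]exchange_big/=; apply: eq_bigr => j _.
rewrite (window_expand (2 * (r + j%:Z) + k%:Z - l%:Z) wc) mulr_sumr mulr_suml.
by apply: eq_bigr => i _; ring.
Qed.

End Transfer.

(** * Convergence of the powers of a matrix *)

Section ComplexLimits.
Variable R : realType.
Implicit Types (x y : nat -> R[i]) (l c z : R[i]).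

Definition cabs z : R := complex.Re `|z|.

Lemma cabsE z : (cabs z)%:C = `|z|. Proof. exact: RRe_real (normr_real z). Qed.
Lemma cabs_ge0 z : 0 <= cabs z. Proof. by rewrite -ler0c cabsE. Qed.
Lemma cabs0 : cabs 0 = 0. Proof. by rewrite /cabs normr0. Qed.
Lemma cabsN z : cabs (- z) = cabs z. Proof. by rewrite /cabs normrN. Qed.
Lemma cabsM z c : cabs (z * c) = cabs z * cabs c.
Proof. by apply: complexI; rewrite rmorphM/= !cabsE normrM. Qed.
Lemma cabsD z c : cabs (z + c) <= cabs z + cabs c.
Proof. by rewrite -lecR rmorphD/= !cabsE ler_normD. Qed.
Lemma cabs_eq0 z : cabs z = 0 -> z = 0.
Proof. by move=> z0; apply/eqP; rewrite -normr_eq0 -cabsE z0. Qed.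
Lemma cabs_lt1 z : (`|z| < 1) = (cabs z < 1).
Proof. by rewrite -cabsE -ltcR. Qed.
Lemma cabs_sqr z : cabs z ^+ 2 = sqmod z.
Proof. by apply: complexI; rewrite rmorphXn/= cabsE sqmodE. Qed.

(** Convergence of complex sequences, expressed through a modulus with values
    in [R] so that real estimates apply to it. *)
Definition ccvg x l := (fun n => cabs (x n - l)) @ \oo --> (0 : R).

Lemma ccvgP x l : ccvg x l <->
  forall e, 0 < e -> \forall n \near \oo, cabs (x n - l) < e.
Proof.
split=> [/cvgrPdist_lt h e /h|h].
  by apply: filterS => n; rewrite sub0r normrN ger0_norm ?cabs_ge0.
apply/cvgrPdist_lt => e /h; apply: filterS => n.
by rewrite sub0r normrN ger0_norm ?cabs_ge0.
Qed.

Lemma ccvg_le x l (b : nat -> R) : (forall n, cabs (x n - l) <= b n) ->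
  b @ \oo --> (0 : R) -> ccvg x l.
Proof.
move=> xb cb; apply: squeeze_cvgr (cvg_cst 0) cb.
by apply: nearW => n; rewrite cabs_ge0 xb.
Qed.

Lemma ccvgD x y l c : ccvg x l -> ccvg y c -> ccvg (fun n => x n + y n) (l + c).
Proof.
move=> hx hy; apply: (@ccvg_le _ _ (fun n => cabs (x n - l) + cabs (y n - c))).
  by move=> n; rewrite opprD addrACA cabsD.
by rewrite -[X in _ --> X](addr0 0); exact: cvgD.
Qed.

Lemma ccvgZ c x l : ccvg x l -> ccvg (fun n => c * x n) (c * l).
Proof.
move=> hx; apply: (@ccvg_le _ _ (fun n => cabs c * cabs (x n - l))).
  by move=> n; rewrite -mulrBr cabsM.
by rewrite -[X in _ --> X](mulr0 (cabs c)); apply: cvgM => //; exact: cvg_cst.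
Qed.

Lemma ccvg_cst c : ccvg (fun=> c) c.
Proof. by rewrite /ccvg subrr cabs0; exact: cvg_cst. Qed.

Lemma ccvg_sum (I : Type) (s : seq I) (x : I -> nat -> R[i]) (l : I -> R[i]) :
  (forall i, ccvg (x i) (l i)) ->
  ccvg (fun n => \sum_(i <- s) x i n) (\sum_(i <- s) l i).
Proof.
move=> h; elim: s => [|i s IH].
  by under eq_fun do rewrite big_nil; rewrite big_nil; exact: ccvg_cst.
by under eq_fun do rewrite big_cons; rewrite big_cons; exact: ccvgD.
Qed.

Lemma ccvg_shift k x l : ccvg (fun n => x (n + k)%N) l <-> ccvg x l.
Proof. by rewrite /ccvg (cvg_shiftn k (fun n => cabs (x n - l))). Qed.

Lemma ccvg_unique x l c : ccvg x l -> ccvg x c -> l = c.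
Proof.
move=> hl hc; apply/eqP; rewrite -subr_eq0; apply/eqP/cabs_eq0.
have : (fun n => cabs (x n - c) + cabs (x n - l)) @ \oo --> (0 : R).
  by rewrite -[X in _ --> X](addr0 0); exact: cvgD.
move=> h; apply/eqP; rewrite eq_le cabs_ge0 andbT.
apply: (cvgr_to_ge h); apply: nearW => n.
rewrite -[cabs (x n - l)]cabsN (le_trans _ (cabsD _ _))// le_eqVlt.
by apply/orP; left; apply/eqP; congr cabs; ring.
Qed.

(** After the forcing term [y] has become smaller than [e / 2 * (1 - q)], the
    recursion contracts towards the interval of radius [e / 2]. *)
Lemma ccvg_contraction (lam : R[i]) x y : cabs lam < 1 ->
  (forall n, x n.+1 = lam * x n + y n) -> ccvg y 0 -> ccvg x 0.
Proof.
move=> lam1 xS /ccvgP hy; apply/ccvgP => e e0.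
set q := cabs lam in lam1; have q0 : 0 <= q by exact: cabs_ge0.
pose d := e / 2 * (1 - q).
have d0 : 0 < d by rewrite mulr_gt0 ?divr_gt0 ?subr_gt0.
have [M _ Mh] := hy d d0.
have bnd k : cabs (x (M + k)%N) <= q ^+ k * cabs (x M) + e / 2.
  elim: k => [|k IH].
    by rewrite addn0 expr0 mul1r lerDl divr_ge0 ?ltW.
  rewrite addnS xS (le_trans (cabsD _ _))// cabsM -/q.
  have yM : cabs (y (M + k)%N) <= d.
    by have := Mh _ (leq_addr k M); rewrite /= subr0 => /ltW.
  rewrite (le_trans (lerD (ler_wpM2l q0 IH) yM))// exprS mulrDr -!mulrA -addrA.
  by rewrite lerD2l /d; lra.
have cq : (fun k => q ^+ k * cabs (x M)) @ \oo --> (0 : R).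
  rewrite -[X in _ --> X](mul0r (cabs (x M))); apply: cvgM; last exact: cvg_cst.
  by apply: cvg_expr; rewrite ger0_norm.
have e2 : 0 < e / 2 by rewrite divr_gt0.
have /cvgrPdist_lt/(_ _ e2)[M' _ M'h] := cq.
exists (M + M')%N => // n /= Mn; rewrite subr0.
have Mle : (M <= n)%N by apply: leq_trans Mn; exact: leq_addr.
rewrite -(subnKC Mle) (le_lt_trans (bnd _))//.
have /M'h : (M' <= n - M)%N by rewrite leq_subRL.
by rewrite /= sub0r normrN => /(le_lt_trans (ler_norm _)) h; rewrite -ltrBrDr (lt_le_trans h)//; lra.
Qed.

End ComplexLimits.

Section PowersOfMatrices.
Variables (R : realType) (d : nat).
Local Notation C := R[i].
Variables (A : 'M[C]_d.+1) (e : 'rV[C]_d.+1) (o : 'cV[C]_d.+1).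
Hypotheses (eA : e *m A = e) (Ao : A *m o = o) (eo : e *m o = 1%:M).
Implicit Types (v : 'rV[C]_d.+1) (rs : seq C).

Let chi rs : {poly C} := \prod_(z <- rs) ('X - z%:P).

Let horner_chi_cons z rs :
  horner_mx A (chi (z :: rs)) = (A - z%:M) *m horner_mx A (chi rs).
Proof.
by rewrite /chi big_cons rmorphM/= rmorphB/= horner_mx_X horner_mx_C.
Qed.

Let chi_comm z rs : (A - z%:M) *m horner_mx A (chi rs) =
  horner_mx A (chi rs) *m (A - z%:M).
Proof.
rewrite -horner_chi_cons /chi big_cons mulrC rmorphM/= rmorphB/= horner_mx_X.
by rewrite horner_mx_C.
Qed.

Let expmxS v n : v *m A ^+ n.+1 = v *m A ^+ n *m A.
Proof. by rewrite exprSr -mulmxA. Qed.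

Let expmxSl v n : v *m A ^+ n.+1 = v *m A *m A ^+ n.
Proof. by rewrite exprS -mulmxA. Qed.

(** Induction on the factors: [v *m (A - z)] tends to 0 along the powers of [A]
    by induction, and [v *m A ^+ n] obeys a contracting recursion of ratio [z]
    forced by it. *)
Let cvg_small rs v i : (forall z, z \in rs -> cabs z < 1) ->
  v *m horner_mx A (chi rs) = 0 -> ccvg (fun n => (v *m A ^+ n) 0 i) 0.
Proof.
elim: rs v i => [|z rs IH] v i rs1.
  rewrite /chi big_nil rmorph1 mulmx1 => ->.
  by under eq_fun do rewrite mul0mx mxE; exact: ccvg_cst.
rewrite horner_chi_cons mulmxA => vz.
have IHu := IH _ i _ vz.
apply: (@ccvg_contraction _ z _ (fun n => (v *m (A - z%:M) *m A ^+ n) 0 i)).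
- by apply: rs1; rewrite mem_head.
- move=> n; rewrite expmxSl mulmxBr mulmxBl mul_mx_scalar -scalemxAl !mxE; ring.
- by apply: IHu => y ys; apply: rs1; rewrite inE ys orbT.
Qed.

Hypothesis eig_small : forall (z : C) v, v != 0 -> v *m A = z *: v ->
  v *m o = 0 -> cabs z < 1.

(** A factor [z] can be dropped when the other factors annihilate [v]; otherwise
    they map [v] to an eigenvector for [z] on which [o] vanishes, whence
    [|z| < 1]. *)
Let annihilated_small rs v : v *m o = 0 -> v *m horner_mx A (chi rs) = 0 ->
  exists2 rs', (forall z, z \in rs' -> cabs z < 1) & v *m horner_mx A (chi rs') = 0.
Proof.
have keep z (u : 'rV[C]_d.+1) : u *m o = 0 -> u *m (A - z%:M) *m o = 0.
  move=> uo; rewrite mulmxBr mulmxBl -mulmxA Ao uo mul_mx_scalar.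
  by rewrite -scalemxAl uo scaler0 subr0.
have keeps rs0 (u : 'rV[C]_d.+1) : u *m o = 0 -> u *m horner_mx A (chi rs0) *m o = 0.
  elim: rs0 u => [|z rs0 IH] u uo; first by rewrite /chi big_nil rmorph1 mulmx1.
  by rewrite horner_chi_cons mulmxA IH// keep.
elim: rs v => [|z rs IH] v vo; first by exists [::].
have [w0 _|w0] := eqVneq (v *m horner_mx A (chi rs)) 0; first exact: IH.
rewrite horner_chi_cons => h.
have z1 : cabs z < 1.
  apply: (eig_small w0); last exact: keeps.
  apply/eqP; rewrite -subr_eq0 -mul_mx_scalar -mulmxBr -mulmxA -chi_comm mulmxA.
  by rewrite -mulmxA h.
rewrite mulmxA in h; have [rs' rs'1 h'] := IH _ (keep z _ vo) h.
exists (z :: rs'); last by rewrite horner_chi_cons mulmxA.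
by move=> y; rewrite inE => /orP[/eqP ->//|/rs'1].
Qed.

(** On the hyperplane where [o] vanishes every eigenvalue is small, and the
    Cayley-Hamilton theorem provides an annihilating product; there is no Jordan
    block for the eigenvalue of [e], because [o] is invariant and nonzero on [e]. *)
Lemma cvg_powers v i :
  ccvg (fun n => (v *m A ^+ n) 0 i) ((v *m o) 0 0 * e 0 i).
Proof.
pose c := (v *m o) 0 0; pose u := v - c *: e.
have uo : u *m o = 0.
  rewrite mulmxBl -scalemxAl eo; apply/matrixP => j k; rewrite !ord1 !mxE.
  by rewrite mulr1 /c !mxE subrr.
have [rs rsE] := closed_field_poly_normal (char_poly A).
have mon := char_poly_monic A; rewrite monicE in mon.
rewrite (eqP mon) scale1r in rsE.
have ch : u *m horner_mx A (chi rs) = 0 by rewrite /chi -rsE Cayley_Hamilton mulmx0.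
have [rs' rs'1 ch'] := annihilated_small uo ch.
have := ccvgD (cvg_small i rs'1 ch') (ccvg_cst (c * e 0 i)).
rewrite add0r /c; congr ccvg; apply/funext => n.
have eAn : e *m A ^+ n = e.
  by elim: n => [|n IH]; rewrite ?expr0 ?mulmx1// expmxS IH.
have entry (B : 'rV[C]_d.+1) : (B - c *: e) 0 i + c * e 0 i = B 0 i.
  by rewrite !mxE subrK.
by rewrite /u mulmxBl -scalemxAl eAn; exact: entry.
Qed.

End PowersOfMatrices.

Section PowersConverse.
Variables (R : realType) (d : nat).
Local Notation C := R[i].
Variables (A : 'M[C]_d.+1) (e : 'rV[C]_d.+1) (o : 'cV[C]_d.+1).
Implicit Types (v : 'rV[C]_d.+1).
Hypothesis cvgA : forall v i,
  ccvg (fun n => (v *m A ^+ n) 0 i) ((v *m o) 0 0 * e 0 i).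

Let eig_pow (z : C) v n : v *m A = z *: v -> v *m A ^+ n = z ^+ n *: v.
Proof.
move=> vz; elim: n => [|n IH]; first by rewrite !expr0 mulmx1 scale1r.
by rewrite exprSr mulmxA IH -scalemxAl vz scalerA exprSr.
Qed.

Lemma eigenvector_of_cvg v : v *m A = v -> v = (v *m o) 0 0 *: e.
Proof.
move=> vA; apply/rowP => i; rewrite mxE.
apply: (ccvg_unique _ (cvgA v i)).
have vA1 : v *m A = 1 *: v by rewrite scale1r.
by under eq_fun do rewrite (eig_pow _ vA1) expr1n scale1r; exact: ccvg_cst.
Qed.

Lemma eigenvalue_of_cvg (z : C) v : v != 0 -> v *m A = z *: v -> z != 1 ->
  cabs z < 1.
Proof.
move=> /rV0Pn[i vi] vz z1; rewrite ltNge; apply/negP => z_ge1.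
set l := (v *m o) 0 0 * e 0 i.
have hl : ccvg (fun n => z ^+ n * v 0 i) l.
  by have := cvgA v i; congr ccvg; apply/funext => n; rewrite (eig_pow _ vz) mxE.
have l0 : l = 0.
  have /eqP : z * l = l.
    apply: (ccvg_unique _ ((ccvg_shift 1 _ _).2 hl)).
    have := ccvgZ z hl; congr ccvg; apply/funext => n.
    by rewrite addn1 exprS mulrA.
  rewrite -subr_eq0 -[X in _ - X]mul1r -mulrBl mulf_eq0 subr_eq0 (negbTE z1).
  by move/eqP.
rewrite l0 in hl; have vi0 : 0 < cabs (v 0 i).
  by rewrite lt_neqAle cabs_ge0 andbT eq_sym; apply: contra vi => /eqP/cabs_eq0 ->.
have [M _ /(_ M (leqnn _))] := (ccvgP _ _).1 hl _ vi0.
rewrite /= subr0 cabsM ltNge => /negP; apply.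
rewrite ler_peMl// ?cabs_ge0//.
elim: M => [|M IH]; first by rewrite expr0 /cabs normr1.
by rewrite exprS cabsM mulr_ege1.
Qed.

End PowersConverse.

(** * Spectrum of the Ruelle operator and powers of the transfer operator *)

Section TransferLinear.
Variables (R : realType) (N : nat) (a : int -> R[i]).
Local Notation T := (transfer N a).
Implicit Types (c : int -> R[i]).

Definition dirac_seq (m0 m : int) : R[i] := (m == m0)%:R.

Lemma transfer_sum (I : Type) (s : seq I) (x : I -> R[i]) (c : I -> int -> R[i]) :
  T (fun m => \sum_(i <- s) x i * c i m) = (fun m => \sum_(i <- s) x i * T (c i) m).
Proof.
apply/funext => j; rewrite /transfer.
under [RHS]eq_bigr => i _ do rewrite mulr_sumr.
rewrite [RHS]exchange_big/=; apply: eq_bigr => k _.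
under [RHS]eq_bigr => i _ do rewrite mulr_sumr.
rewrite [RHS]exchange_big/=; apply: eq_bigr => l _.
by rewrite mulr_sumr; apply: eq_bigr => i _; rewrite mulrCA.
Qed.

Lemma iter_transfer_sum (I : Type) (s : seq I) (x : I -> R[i]) (c : I -> int -> R[i]) n :
  iter n T (fun m => \sum_(i <- s) x i * c i m) =
  (fun m => \sum_(i <- s) x i * iter n T (c i) m).
Proof. by elim: n => //= n ->; exact: transfer_sum. Qed.

Definition supp_le (L : nat) c := forall m : int, (L < `|m|)%N -> c m = 0.

Lemma supp_le_window L c : supp_le L c -> window (- L%:Z) (L.*2.+1) c.
Proof. by move=> h m hm; apply: h; lia. Qed.

(** The index is halved, up to [N]: every finitely supported sequence is driven
    into the degrees [- N .. N]. *)
Lemma supp_le_transfer L c : supp_le (N + L.+1) c -> supp_le (N + L) (T c).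
Proof.
move=> h m hm; rewrite /transfer big1// => k _; rewrite big1// => l _.
have := ltn_ord k; have := ltn_ord l => lN kN.
by rewrite h ?mulr0//; lia.
Qed.

Lemma supp_le_iter L c : supp_le (N + L) c -> supp_le N (iter L T c).
Proof.
elim: L c => [|L IH] c; first by rewrite addn0.
by move=> /supp_le_transfer /IH; rewrite -iterSr.
Qed.

Definition total c : R[i] := \sum_(k \in [set: int]) c k.

Lemma total_window r D c : window r D c -> total c = laurent r D c 1.
Proof.
move=> wc; rewrite /total (@fsbig_window _ _ _ r D)//.
  by apply: eq_bigr => i _; rewrite exp1rz mulr1.
by move=> k _; exact: wc.
Qed.

Lemma total_dirac m : total (dirac_seq m) = 1.
Proof.
rewrite (@total_window m 1); last first.
  move=> k hk; rewrite /dirac_seq (_ : (_ == _) = false)//.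
  by apply/negbTE/eqP; lia.
by rewrite /laurent big_ord1 /dirac_seq addr0 eqxx exp1rz mulr1.
Qed.

Section Filter.
Hypothesis a_supp : forall k : int, ~~ (0 <= k <= N%:Z) -> a k = 0.
Hypothesis a_orth : forall l : int,
  \sum_(k \in [set: int]) ((a k)^* * a (k + 2 * l)) = (l == 0)%:R.
Hypothesis a_sum : \sum_(k \in [set: int]) a k = sqrt2 R.

Lemma filter_sum : \sum_(k < N.+1) a k%:Z = sqrt2 R.
Proof.
rewrite -a_sum (@fsbig_window _ _ _ 0 N.+1)//.
by move=> k _ hk; apply: a_supp; lia.
Qed.

Lemma filter_orth (l : int) :
  \sum_(k < N.+1) (a k%:Z)^* * a (k%:Z + 2 * l) = (l == 0)%:R.
Proof.
rewrite -a_orth (@fsbig_window _ _ _ 0 N.+1)//.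
move=> k _ hk; rewrite (@a_supp k); last lia.
by rewrite rmorph0 mul0r.
Qed.

(** The coefficients of [R 1] are the sums of the orthogonality relations. *)
Lemma transfer_dirac0 : T (dirac_seq 0) = dirac_seq 0.
Proof.
apply/funext => j; rewrite /dirac_seq -filter_orth; apply: eq_bigr => k _.
have kN := ltn_ord k.
have [h|h] := boolP (0 <= k%:Z + 2 * j <= N%:Z); last first.
  rewrite (@a_supp (k%:Z + 2 * j))// mulr0 big1// => l _; have lN := ltn_ord l.
  by rewrite (_ : (_ == _) = false) ?mulr0//; apply/negbTE/eqP; lia.
have hl : (absz (k%:Z + 2 * j)%R < N.+1)%N by lia.
rewrite (bigD1 (Ordinal hl))//= big1 ?addr0; last first.
  move=> l lj; rewrite (_ : (_ == _) = false) ?mulr0//.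
  apply/negbTE; apply: contra lj => /eqP e'; apply/eqP/val_inj => /=; lia.
rewrite (_ : (_ == _) = true) ?mulr1; last by apply/eqP; lia.
by congr (_ * a _); lia.
Qed.

Lemma laurent_dirac0 r D (z : R[i]) : window r D (dirac_seq 0) ->
  laurent r D (dirac_seq 0) z = 1.
Proof.
move=> w0; have h0 : r <= 0 < r + D%:Z.
  apply/negPn/negP => /w0; rewrite /dirac_seq eqxx => /eqP.
  by rewrite oner_eq0.
have hi : (`|r| < D)%N by lia.
rewrite /laurent (bigD1 (Ordinal hi))//= big1 ?addr0.
  by rewrite (_ : r + `|r|%N = 0) ?expr0z ?mulr1 /dirac_seq//; lia.
move=> j hj; rewrite /dirac_seq (_ : (_ == _) = false) ?mul0r//.
apply/negbTE; apply: contra hj => /eqP e'; apply/eqP/val_inj => /=; lia.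
Qed.

Lemma window_dirac0 r D : wide N r D -> window r D (dirac_seq 0).
Proof.
move=> [rN Ns] k hk; rewrite /dirac_seq (_ : (_ == _) = false)//.
by apply/negbTE/eqP; lia.
Qed.

(** The quadrature mirror identity: it is [R 1 = 1] evaluated at [z ^+ 2]. *)
Lemma qmf (z : R[i]) : `|z| = 1 ->
  `|m0 N a z| ^+ 2 + `|m0 N a (- z)| ^+ 2 = 2.
Proof.
move=> z1.
have w1 : `|z| == 1 by rewrite z1. have w1' : `|- z| == 1 by rewrite normrN z1.
have w2 : `|z ^+ 2| == 1 by rewrite normrX z1 expr1n.
pose w : circle R := exist _ z w1. pose w' : circle R := exist _ (- z) w1'.
pose z2 : circle R := exist _ (z ^+ 2) w2.
have wd : wide N (- N%:Z) (N.*2.+1) by rewrite /wide; lia.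
have w0 := window_dirac0 wd.
have := ruelle_laurent a wd w0; rewrite transfer_dirac0 => /(congr1 (@^~ z2)).
rewrite (@ruelleE _ _ _ _ z2 w w')// !laurent_dirac0// !mulr1 => h.
by apply: (@mulfI _ 2^-1); rewrite ?invr_eq0 ?pnatr_eq0// h mulVf ?pnatr_eq0.
Qed.

Lemma m0_1 : m0 N a 1 = sqrt2 R.
Proof. by rewrite -filter_sum /m0 big_mkord; apply: eq_bigr => i _; rewrite expr1n mulr1. Qed.

Lemma sqrt2_sqr : sqrt2 R ^+ 2 = 2.
Proof. by rewrite /sqrt2 -rmorphXn/= sqr_sqrtr// rmorph_nat. Qed.

Lemma sqrt2_neq0 : sqrt2 R != 0.
Proof. by have := sqrt2_sqr; apply: contra_eqN => /eqP ->; rewrite expr0n/= eq_sym pnatr_eq0. Qed.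

Lemma norm_m0_1 : `|m0 N a 1| ^+ 2 = 2.
Proof.
rewrite m0_1 -sqrt2_sqr; congr (_ ^+ 2); apply: ger0_norm.
by rewrite /sqrt2 ler0c sqrtr_ge0.
Qed.

Lemma m0_N1 : m0 N a (- 1) = 0.
Proof.
have h : `|m0 N a (- 1)| ^+ 2 = 0.
  apply: (addrI (`|m0 N a 1| ^+ 2)); rewrite (qmf (normr1 _)) addr0.
  exact/esym/norm_m0_1.
by move/eqP: h; rewrite sqrf_eq0 normr_eq0 => /eqP.
Qed.

(** At [z = 1] the two square roots are 1, where [|m0|^2 = 2], and -1, where [m0]
    vanishes: evaluation at 1 is invariant under the Ruelle operator. *)
Lemma laurent_transfer1 r D c : wide N r D -> window r D c ->
  laurent r D (T c) 1 = laurent r D c 1.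
Proof.
move=> wd wc.
have w1 : `|1 : R[i]| == 1 by rewrite normr1.
have w1' : `|- 1 : R[i]| == 1 by rewrite normrN normr1.
pose w : circle R := exist _ 1 w1. pose w' : circle R := exist _ (- 1) w1'.
have := ruelle_laurent a wd wc => /(congr1 (@^~ w)) /= <-.
rewrite (@ruelleE _ _ _ _ w w w')//=; last by rewrite expr1n.
rewrite m0_N1 norm_m0_1 normr0 expr0n/= mul0r addr0 mulrA.
by rewrite mulVf ?pnatr_eq0// mul1r.
Qed.

Lemma total_transfer L c : supp_le (N + L) c -> total (T c) = total c.
Proof.
move=> /supp_le_window wc.
have wd : wide N (- (N + L)%N%:Z) ((N + L)%N.*2.+1) by rewrite /wide; lia.
rewrite (total_window (transfer_window a wd wc)) (total_window wc).
exact: laurent_transfer1.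
Qed.

Lemma total_iter L c : supp_le (N + L) c -> total (iter L T c) = total c.
Proof.
elim: L c => // L IH c h; rewrite iterSr IH; first exact: total_transfer h.
exact: supp_le_transfer.
Qed.

(** The condition through which the two statements of the theorem are compared:
    [R^n] maps every Laurent polynomial to its value at 1, in the limit. *)
Definition transfer_cvg := forall m j : int,
  ccvg (fun n => iter n T (dirac_seq m) j) (dirac_seq 0 j).

Section WindowMatrix.
Variables (r : int) (d : nat).
Hypothesis wd : wide N r d.+1.
Local Notation D := d.+1.
Local Notation C := R[i].
Implicit Types v : 'rV[C]_D.

(** Acting on row vectors: the row [i] holds the image of the monomial of
    degree [r + i]. *)
Definition window_mx : 'M[C]_D := \matrix_(i, j) T (dirac_seq (r + i%:Z)) (r + j%:Z).
Definition vec c : 'rV[C]_D := \row_i c (r + i%:Z).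
Definition coef v (m : int) : C := \sum_(i < D) v 0 i * dirac_seq (r + i%:Z) m.
Local Notation A := window_mx.
Let e := vec (dirac_seq 0).
Let o : 'cV[C]_D := const_mx 1.

Lemma coef_window v : window r D (coef v).
Proof.
move=> m hm; rewrite /coef big1// => i _; have iD := ltn_ord i.
by rewrite /dirac_seq (_ : (_ == _) = false) ?mulr0//; apply/negbTE/eqP; lia.
Qed.

Lemma vecK c : window r D c -> coef (vec c) = c.
Proof.
move=> wc; apply/funext => m; rewrite [RHS](window_expand m wc).
by apply: eq_bigr => i _; rewrite mxE mulrC.
Qed.

Lemma coefE v (i : 'I_D) : coef v (r + i%:Z) = v 0 i.
Proof.
rewrite /coef (bigD1 i)//= big1 ?addr0; first by rewrite /dirac_seq eqxx mulr1.
move=> j ji; rewrite /dirac_seq (_ : (_ == _) = false) ?mulr0//.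
apply/negbTE; apply: contra ji => /eqP e'; apply/eqP/val_inj => /=; lia.
Qed.

Lemma coefK v : vec (coef v) = v.
Proof. by apply/rowP => i; rewrite mxE coefE. Qed.

Lemma vec_transfer c : window r D c -> vec (T c) = vec c *m A.
Proof.
move=> wc; rewrite -{1}(vecK wc) /coef transfer_sum; apply/rowP => j.
by rewrite !mxE; apply: eq_bigr => i _; rewrite !mxE.
Qed.

Lemma vec_iter n c : window r D c -> vec (iter n T c) = vec c *m A ^+ n.
Proof.
elim: n c => [|n IH] c wc; first by rewrite expr0 mulmx1.
rewrite iterSr IH; last exact: transfer_window.
by rewrite vec_transfer// exprS mulmxA.
Qed.

Lemma mulmx_ones v : (v *m o) 0 0 = laurent r D (coef v) 1.
Proof.
by rewrite mxE; apply: eq_bigr => i _; rewrite mxE exp1rz coefE.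
Qed.

Let eA : e *m A = e.
Proof. by rewrite -vec_transfer ?transfer_dirac0//; exact: window_dirac0. Qed.

Let eo : e *m o = 1%:M.
Proof.
apply/matrixP => i j; rewrite !ord1 mulmx_ones vecK; last exact: window_dirac0.
by rewrite laurent_dirac0 ?mxE//; exact: window_dirac0.
Qed.

Let ones_preserved v : v *m A *m o = v *m o.
Proof.
apply/matrixP => i j; rewrite !ord1 !mulmx_ones.
rewrite -[v in LHS]coefK -vec_transfer; last exact: coef_window.
rewrite vecK; last exact/transfer_window/coef_window.
by apply: laurent_transfer1 => //; exact: coef_window.
Qed.

Let Ao : A *m o = o.
Proof. by apply/row_matrixP => i; rewrite !rowE mulmxA ones_preserved. Qed.

Definition trig v (z : circle R) : C := laurent r D (coef v) (val z).

Lemma trigZ (x : C) v : trig (x *: v) = x *: trig v.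
Proof.
apply/funext => z; rewrite /trig /laurent [RHS]mulr_sumr.
by apply: eq_bigr => i _; rewrite !coefE mxE mulrA.
Qed.

(** Up to a power of [z], [trig v] is a polynomial with infinitely many roots. *)
Lemma trig_eq0 v : trig v = 0 -> v = 0.
Proof.
move=> v0; pose p : {poly C} := \poly_(i < D) v 0 (inord i).
suff p0 : p = 0.
  apply/rowP => i; rewrite mxE -[RHS](coef0 _ i) -p0 coef_poly ltn_ord.
  by rewrite inord_val.
(* Infinitely many points of the circle, told apart by their real parts since
   the cosine is injective on [0, pi]. *)
pose t (n : nat) : R := pi / n.+1%:R.
have t01 n : 0 <= t n <= pi.
  rewrite divr_ge0 ?pi_ge0 ?ler0n//= ler_pdivrMr ?ltr0n// ler_peMr ?pi_ge0//.
  by rewrite ler1n.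
pose w n : C := expi (t n).
have w1 n : `|w n| = 1.
  by rewrite normc_def /= cos2Dsin2 sqrtr1.
have w_inj : injective w.
  move=> n k [] /cos_inj; rewrite !in_itv/= => /(_ (t01 _) (t01 _)).
  move=> /(mulfI (lt0r_neq0 (pi_gt0 R))) /invr_inj /eqP.
  by rewrite eqr_nat => /eqP [].
have wroot n : root p (w n).
  have wn0 := unit_neq0 (w1 n).
  have h1 : `|w n| == 1 by rewrite w1.
  have := congr1 (@^~ (exist _ (w n) h1)) v0; rewrite /trig /laurent/= => h.
  rewrite /root horner_poly -(mulrI_eq0 _ (mulfI (expfz_neq0 r wn0))) mulr_sumr.
  apply/eqP; rewrite -[RHS]h; apply: eq_bigr => i _.
  by rewrite coefE inord_val expfzDr// mulrCA.
apply: (@roots_geq_poly_eq0 _ p [seq w n | n <- iota 0 D]).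
- by apply/allP => x /mapP[n _ ->].
- by rewrite map_inj_uniq ?iota_uniq.
- by rewrite size_map size_iota size_poly.
Qed.

Lemma ruelle_trig v : ruelle N a (trig v) = trig (v *m A).
Proof.
rewrite ruelle_laurent//; last exact: coef_window.
apply/funext => z; rewrite /trig -[v in v *m A]coefK -vec_transfer; last exact: coef_window.
by rewrite vecK//; exact/transfer_window/coef_window.
Qed.

Lemma trigP (x : C) v w : trig (x *: v + w) = x *: trig v + trig w.
Proof.
apply/funext => z.
transitivity (x * trig v z + trig w z); last by [].
rewrite /trig /laurent mulr_sumr -big_split/=.
by apply: eq_bigr => i _; rewrite !coefE !mxE mulrA mulrDl.
Qed.

Lemma trig_inj : injective trig.
Proof.
move=> v w vw; apply/eqP; rewrite -subr_eq0 addrC -scaleN1r; apply/eqP/trig_eq0.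
by rewrite trigP vw scaleN1r addNr.
Qed.

Lemma trig_neq0 v : (trig v != 0) = (v != 0).
Proof.
congr (~~ _); apply/eqP/eqP => [/trig_eq0//|->].
by rewrite -(scale0r 0) trigZ scale0r.
Qed.

Lemma eigenspace_trig z v :
  eigenspace_on (range trig) (ruelle N a) z (trig v) <-> v *m A = z *: v.
Proof.
split=> [[_]|vz].
  by rewrite ruelle_trig -trigZ => /trig_inj.
by split; [exists v|rewrite ruelle_trig vz trigZ].
Qed.

Lemma eigenvalue_trig z : eigenvalue_on (range trig) (ruelle N a) z <->
  exists2 v : 'rV[C]_D, v != 0 & v *m A = z *: v.
Proof.
split=> [[f]|[v v0 vz]].
  move=> ef; have [[v _ vf] _] := ef; rewrite -vf in ef *.
  by rewrite trig_neq0 => v0; exists v => //; exact/eigenspace_trig.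
by exists (trig v); [exact/eigenspace_trig|rewrite trig_neq0].
Qed.

Let e_neq0 : e != 0.
Proof.
apply/eqP => e0; have := eo; rewrite e0 mul0mx => /matrixP /(_ 0 0).
by rewrite !mxE eqxx => /eqP; rewrite eq_sym oner_eq0.
Qed.

Lemma simple_eigenvalue_trig :
  simple_eigenvalue_on (range trig) (ruelle N a) 1 <->
  (forall v : 'rV[C]_D, v *m A = v -> exists x : C, v = x *: e).
Proof.
split=> [[f f0 fE] v vA|h].
  have [x1 _ ex] : range (fun x : C => x *: f) (trig e).
    by rewrite -fE; apply/eigenspace_trig; rewrite scale1r eA.
  have [x2 _ vx] : range (fun x : C => x *: f) (trig v).
    by rewrite -fE; apply/eigenspace_trig; rewrite scale1r vA.
  have x10 : x1 != 0.
    by apply/eqP => x10; move: e_neq0; rewrite -trig_neq0 -ex x10 scale0r eqxx.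
  exists (x2 / x1); apply: trig_inj; rewrite trigZ -ex -vx scalerA.
  by rewrite divfK.
exists (trig e); first by rewrite trig_neq0 e_neq0.
apply/seteqP; split=> [f ef|_ [x _ <-]].
  have [[v _ vf] _] := ef; rewrite -vf in ef *.
  have : v *m A = v by move/eigenspace_trig : ef; rewrite scale1r.
  by move=> /h[x ->]; exists x => //; rewrite trigZ.
rewrite -trigZ; apply/eigenspace_trig.
by rewrite scale1r -scalemxAl eA.
Qed.

Lemma supp_le_wide c : supp_le N c -> window r D c.
Proof. by move=> h m hm; apply: h; have [] := wd; lia. Qed.

(** The value at 1 is a left eigenvector for the eigenvalue 1, and an eigenvector
    on which it vanishes cannot be a constant, hence belongs to an eigenvalue of
    modulus less than 1: [cvg_powers] applies to the window. A monomial outside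
    of the window enters it after finitely many steps, with the same value at 1. *)
Lemma transfer_cvg_of_spectrum :
  simple_eigenvalue_on (range trig) (ruelle N a) 1 ->
  (forall z, eigenvalue_on (range trig) (ruelle N a) z -> z != 1 -> `|z| < 1) ->
  transfer_cvg.
Proof.
move=> /simple_eigenvalue_trig simple spec m j.
have eig_small (z : C) v : v != 0 -> v *m A = z *: v -> v *m o = 0 -> cabs z < 1.
  move=> v0 vz vo; have [z1|z1] := eqVneq z 1; last first.
    by rewrite -cabs_lt1; apply: spec => //; apply/eigenvalue_trig; exists v.
  exfalso; move: vz; rewrite z1 scale1r => /simple[x vx].
  move: vo v0; rewrite vx -scalemxAl eo => /matrixP/(_ 0 0).
  by rewrite !mxE mulr1 => ->; rewrite scale0r eqxx.
have hm : supp_le (N + `|m|) (dirac_seq m).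
  move=> k hk; rewrite /dirac_seq (_ : (_ == _) = false)//.
  by apply/negbTE/eqP; lia.
set L := `|m|%N in hm; apply/(ccvg_shift L).
under eq_fun do rewrite iterD.
have := supp_le_wide (supp_le_iter hm); set c := iter L T _ => wc.
have wn n : window r D (iter n T c).
  by elim: n => //= n IH; exact: transfer_window.
have [hj|hj] := boolP (r <= j < r + D%:Z); last first.
  rewrite (window_dirac0 wd hj); under eq_fun do rewrite wn//.
  exact: ccvg_cst.
have hi : (`|j - r| < D)%N by lia.
have jE : j = r + (Ordinal hi)%:Z by move=> /=; lia.
have := cvg_powers eA Ao eo eig_small (vec c) (Ordinal hi).
rewrite mulmx_ones vecK// -total_window// total_iter// total_dirac mul1r mxE -jE.
congr ccvg; apply/funext => n.
by rewrite -vec_iter// mxE -jE.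
Qed.

(** An eigenvector [v] for [z] satisfies [z ^+ n *: v --> c *: e] for a scalar
    [c]; this leaves only [|z| < 1], or [z = 1] and [v] proportional to [e]. *)
Lemma spectrum_of_transfer_cvg : transfer_cvg ->
  simple_eigenvalue_on (range trig) (ruelle N a) 1 /\
  (forall z, eigenvalue_on (range trig) (ruelle N a) z -> z != 1 -> `|z| < 1).
Proof.
move=> h.
have cvgA v i : ccvg (fun n => (v *m A ^+ n) 0 i) ((v *m o) 0 0 * e 0 i).
  have -> : (fun n => (v *m A ^+ n) 0 i) =
     (fun n => \sum_(k < D) v 0 k * iter n T (dirac_seq (r + k%:Z)) (r + i%:Z)).
    apply/funext => n; rewrite -[v in LHS]coefK -vec_iter; last exact: coef_window.
    by rewrite mxE /coef iter_transfer_sum.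
  rewrite !mxE mulr_suml; apply: ccvg_sum => k.
  by rewrite mxE mulr1; apply: ccvgZ; exact: h.
split.
  apply/simple_eigenvalue_trig => v vA.
  by exists ((v *m o) 0 0); exact: (eigenvector_of_cvg cvgA).
move=> z /eigenvalue_trig[v v0 vz] z1; rewrite cabs_lt1.
exact: (eigenvalue_of_cvg cvgA v0 vz).
Qed.

End WindowMatrix.

Lemma trigpolyE (r s : int) (rs : r <= s) : @trigpoly R r s = range (@trig r `|s - r|%N).
Proof.
apply/seteqP; split=> [f [b fb]|_ [v _ <-]].
  exists (\row_i b (r + i%:Z)) => //; apply/funext => z; rewrite fb fsbig_segment//.
  by apply: eq_bigr => i _; rewrite coefE mxE.
by exists (coef r v) => z; rewrite fsbig_segment.
Qed.

Theorem spectrum_iff_transfer_cvg (r s : int) : r <= - N%:Z -> N%:Z <= s ->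
  (simple_eigenvalue_on (trigpoly r s) (ruelle N a) 1 /\
   (forall lambda : R[i], eigenvalue_on (trigpoly r s) (ruelle N a) lambda ->
      lambda != 1 -> `|lambda| < 1)) <-> transfer_cvg.
Proof.
move=> rN Ns; have rs : r <= s by lia.
have wd : wide N r `|s - r|%N.+1 by split => //; lia.
rewrite (trigpolyE rs); split=> [[h1 h2]|h].
  exact: (transfer_cvg_of_spectrum wd h1 h2).
exact: (spectrum_of_transfer_cvg wd h).
Qed.

End Filter.
End TransferLinear.

(** * Correlations of square integrable functions under the cascade operator *)

Section Correlation.
Variables (R : realType) (N : nat) (a : int -> R[i]).
Local Notation mu := (@lebesgue_measure R).
Local Notation M := (cascade N a).
Local Notation T := (transfer N a).
Local Notation Re := complex.Re.
Local Notation Im := complex.Im.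
Implicit Types f g : R -> R[i].

Lemma cascadeE f : M f = (fun x => \sum_(k < N.+1)
  (sqrt2 R * a k%:Z) * f (2 * x + - k%:R)).
Proof.
apply/funext => x; rewrite /cascade big_mkord mulr_sumr.
by apply: eq_bigr => k _; rewrite mulrA.
Qed.

Lemma two_neq0 : (2 : R) != 0. Proof. by rewrite pnatr_eq0. Qed.

Lemma inL2_cascade f : inL2 f -> inL2 (M f).
Proof.
move=> hf; rewrite cascadeE; apply: inL2_sum => k; apply: inL2Z.
exact: inL2_affine two_neq0 hf.
Qed.

Lemma inL2_iter f n : inL2 f -> inL2 (iter n M f).
Proof. by move=> hf; elim: n => //= n; exact: inL2_cascade. Qed.

Lemma Cintegrable_cascade f : Cintegrable f -> Cintegrable (M f).
Proof.
move=> hf; rewrite cascadeE; apply: Cintegrable_sum => k; apply: CintegrableZ.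
exact: Cintegrable_affine two_neq0 hf.
Qed.

Lemma Cintegrable_iter f n : Cintegrable f -> Cintegrable (iter n M f).
Proof. by move=> hf; elim: n => //= n; exact: Cintegrable_cascade. Qed.

Lemma inL2_shift (v : R) f : inL2 f -> inL2 (fun x => f (x + v)).
Proof.
move=> /(inL2_affine v (oner_neq0 R)).
by under eq_fun do rewrite mul1r.
Qed.

Lemma L2inner_shift (v : R) f g : inL2 f -> inL2 g ->
  L2inner (fun x => f (x + v)) (fun x => g (x + v)) = L2inner f g.
Proof.
move=> hf hg; have := L2inner_affine v (oner_neq0 R) hf hg.
rewrite invr1 normr1 mul1r => <-; congr L2inner; apply/funext => x; by rewrite mul1r.
Qed.

Definition corr f g (m : int) : R[i] := L2inner f (fun x => g (x + m%:~R)).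

Lemma corr0 f g : corr f g 0 = L2inner f g.
Proof. by congr L2inner; apply/funext => x; rewrite addr0. Qed.

(** The dilation by 2 turns the translation by [j] into a translation by [2 * j],
    as in [transfer]. *)
Lemma corr_cascade f g : inL2 f -> inL2 g -> corr (M f) (M g) = T (corr f g).
Proof.
move=> hf hg; apply/funext => j; rewrite /corr !cascadeE.
have hfk (k : 'I_N.+1) : inL2 (fun x => f (2 * x + - k%:R)).
  exact: inL2_affine two_neq0 hf.
have hgl (l : 'I_N.+1) : inL2 (fun x => g (2 * (x + j%:~R) + - l%:R)).
  exact: (inL2_shift j%:~R (inL2_affine (- l%:R) two_neq0 hg)).
rewrite L2inner_suml; last 2 first.
- by apply: inL2_sum => l; exact: inL2Z.
- by move=> k; exact: inL2Z.
apply: eq_bigr => k _; rewrite L2inner_sumr; last 2 first.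
- exact: inL2Z.
- by move=> l; exact: inL2Z.
apply: eq_bigr => l _.
rewrite L2innerZr//; last exact: inL2Z.
rewrite L2innerZl//.
pose G y := g (y + (2 * j + k%:Z - l%:Z)%:~R).
have hG : inL2 G by exact: inL2_shift.
have -> : L2inner (fun x => f (2 * x + - k%:R)) (fun x => g (2 * (x + j%:~R) + - l%:R))
    = `|2^-1|%:C * L2inner f G.
  rewrite -(L2inner_affine (- k%:R) two_neq0 hf hG); congr L2inner.
  apply/funext => x; rewrite /G; congr g.
  by rewrite !rmorphB/= !rmorphD/= !rmorphM/=; ring.
rewrite ger0_norm ?invr_ge0// fmorphV rmorph_nat.
have s2 : conjc (sqrt2 R) = sqrt2 R by exact: conjc_real.
rewrite [X in _ * (X * _)](_ : _ = sqrt2 R * conjc (a k%:Z)); last first.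
  by rewrite -[in RHS]s2 -[RHS](rmorphM conjc).
have := sqrt2_sqr R; rewrite expr2 => s22.
transitivity ((sqrt2 R * sqrt2 R) * 2^-1 * ((a k)^* * a l * L2inner f G)).
  by ring.
by rewrite s22 mulfV ?pnatr_eq0// mul1r.
Qed.

Lemma corr_iter n f g : inL2 f -> inL2 g ->
  corr (iter n M f) (iter n M g) = iter n T (corr f g).
Proof.
move=> hf hg; elim: n => //= n IH.
by rewrite corr_cascade ?IH//; exact: inL2_iter.
Qed.

Lemma orthonormal_corr f : orthonormal_translates f -> corr f f = dirac_seq R 0.
Proof.
move=> h; apply/funext => m; rewrite /corr.
have := h 0 (- m); rewrite /dirac_seq eq_sym oppr_eq0 => <-; congr L2inner.
  by apply/funext => x; rewrite subr0.
by apply/funext => x; rewrite rmorphN opprK.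
Qed.

Lemma nrm_corr f : inL2 f -> corr f f = dirac_seq R 0 -> nrm f = 1.
Proof. by move=> hf h; rewrite -Re_L2inner_nrm// -corr0 h. Qed.

Section QMF.
Hypothesis T0 : T (dirac_seq R 0) = dirac_seq R 0.

Lemma corr_iter_dirac n f : inL2 f -> corr f f = dirac_seq R 0 ->
  corr (iter n M f) (iter n M f) = dirac_seq R 0.
Proof.
by move=> hf h; rewrite corr_iter// h; elim: n => //= n ->.
Qed.

(** Both iterates keep norm 1, and their inner product is the coefficient of
    index 0 of their correlation. *)
Lemma nrm_iterB n f g : inL2 f -> inL2 g ->
  corr f f = dirac_seq R 0 -> corr g g = dirac_seq R 0 ->
  nrm (fun x => iter n M f x - iter n M g x) =
  2 - 2 * Re (iter n T (corr f g) 0).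
Proof.
move=> hf hg ff gg; have [hfn hgn] := (inL2_iter n hf, inL2_iter n hg).
rewrite nrmB// !nrm_corr//; [|exact: corr_iter_dirac..].
by rewrite -corr0 corr_iter.
Qed.

End QMF.

(** The translates of this function are orthonormal and form a partition of
    unity; it serves as reference among all admissible initial functions. *)
Definition box (x : R) : R[i] := (\1_[set` `[0, 1[] x : R)%:C.

Lemma boxE x : box x = (0 <= x < 1)%R%:R.
Proof. by rewrite /box indicE mem_setE in_itv/= rmorph_nat. Qed.

Lemma Cmeasurable_box : Cmeasurable box.
Proof. by split; [exact: measurable_indic|exact: measurable_cst]. Qed.

Lemma L1_box : mu.-integrable setT (EFin \o (\1_[set` `[0, 1[] : R -> R)).
Proof. exact: integrable_indic_itv. Qed.

Lemma sqmod_box x : sqmod (box x) = \1_[set` `[0, 1[] x.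
Proof.
rewrite /sqmod/box/= expr0n addr0 indicE.
by case: (_ \in _); rewrite ?expr1n ?expr0n.
Qed.

Lemma inL2_box : inL2 box.
Proof.
apply/inL2P; split; first exact: Cmeasurable_box.
by under [X in EFin \o X]eq_fun do rewrite sqmod_box; exact: L1_box.
Qed.

Lemma Cintegrable_box : Cintegrable box.
Proof. by split; [exact: L1_box|exact: integrable0]. Qed.

Lemma Cintegral_box : Cintegral box = 1.
Proof.
apply: complex_ext => /=; last by rewrite /Rintegral integral0.
rewrite /Rintegral integral_indic; [|exact: measurableT|exact: measurable_itv].
rewrite setIT.
transitivity (fine (@lebesgue_measure R [set` `[0%R, 1%R[])); first by [].
by rewrite lebesgue_measure_itv/= lte_fin ltr01 oppr0 adde0.
Qed.

Lemma box_box m x : (box x)^* * box (x + m%:~R) = (m == 0)%:R * box x.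
Proof.
rewrite !boxE -[X in X * _]/(conjc _) conjc_nat.
have [x01|x01] := boolP (0 <= x < 1); last by rewrite mul0r mulr0.
rewrite mul1r mulr1; congr (nat_of_bool _)%:R.
move/andP: x01 => [x0 x1].
have [->|m0] := eqVneq m 0; first by rewrite addr0 x0 x1.
apply/negbTE; rewrite negb_and -ltNge -leNgt.
have [mp|mn] := ltP 0 m.
  have : (1 : R) <= m%:~R by rewrite (_ : 1 = 1%:~R)// ler_int; lia.
  by move=> h; apply/orP; right; lra.
have : m%:~R <= (-1 : R) by rewrite (_ : -1 = (-1)%:~R)// ler_int; lia.
by move=> h; apply/orP; left; lra.
Qed.

Lemma corr_box : corr box box = dirac_seq R 0.
Proof.
apply/funext => m; rewrite /corr /L2inner.
under eq_fun do rewrite box_box.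
by rewrite CintegralZ ?Cintegral_box ?mulr1//; exact: Cintegrable_box.
Qed.

End Correlation.

(** * Convergence of the cascade and powers of the transfer operator *)

Section BoxCorrelation.
Variable R : realType.
Local Notation mu := (@lebesgue_measure R).
Local Notation Re := complex.Re.
Local Notation Im := complex.Im.
Local Notation box := (@box R).
Implicit Types f g : R -> R[i].

Lemma Cintegral_ae f g : Cmeasurable f -> Cmeasurable g ->
  {ae mu, forall x, f x = g x} -> Cintegral f = Cintegral g.
Proof.
move=> [fr fi] [gr gi] [Z [mZ Z0 sZ]].
have ae (p : R[i] -> R) : ae_eq mu setT (fun x => (p (f x))%:E) (fun x => (p (g x))%:E).
  by exists Z; split=> // x /= nx; apply: sZ => /= fg; apply: nx => _; rewrite fg.
apply: complex_ext => /=; congr fine; apply: ae_eq_integral => //;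
  by [exact/measurable_EFinP|exact: ae].
Qed.

Lemma sum_box (r : int) n (x : R) :
  \sum_(i < n) box (x - (r + i%:Z)%:~R) = (r%:~R <= x < (r + n%:Z)%:~R)%R%:R.
Proof.
elim: n => [|n IH].
  by rewrite big_ord0 addr0 (_ : _ && _ = false)//; apply/negbTE/negP => /andP[]; lra.
rewrite big_ord_recr/= IH boxE subr_ge0 ltrBlDl.
rewrite (_ : (r + n.+1%:Z)%:~R = (r + n%:Z)%:~R + 1 :> R); last first.
  by rewrite -[in LHS]addn1 PoszD addrA rmorphD.
have rn : r%:~R <= (r + n%:Z)%:~R :> R by rewrite ler_int lerDl.
rewrite -natrD; congr _%:R; clear IH.
case: (lerP r%:~R x) => h1; case: (ltrP x (r + n%:Z)%:~R) => h2;
  case: (ltrP x ((r + n%:Z)%:~R + 1)) => h3 //=; exfalso; lra.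
Qed.

Lemma corr_boxE g m : inL2 g ->
  corr box g m = L2inner (fun x => box (x - m%:~R)) g.
Proof.
move=> hg; rewrite /corr -(L2inner_shift (- m%:~R) (inL2_box R) (inL2_shift _ hg)).
by congr L2inner; apply/funext => x; rewrite subrK.
Qed.

(** [g] vanishes almost everywhere outside of the interval [- L, L]. *)
Definition carried (L : nat) g :=
  {ae mu, forall x, ~~ (- L%:R <= x < L%:R) -> g x = 0}.

Lemma inL2_box_shift (v : R) : inL2 (fun x => box (x - v)).
Proof. exact: inL2_shift (inL2_box R). Qed.

Lemma inL2_Cmeasurable g : inL2 g -> Cmeasurable g.
Proof. by case. Qed.

Lemma Cmeasurable_inner f g : Cmeasurable f -> Cmeasurable g ->
  Cmeasurable (fun x => (f x)^* * g x).
Proof.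
move=> [fr fi] mg; apply: CmeasurableM => //; split.
  by under eq_fun do rewrite cReJ.
by under eq_fun do rewrite cImJ; exact: measurable_funN.
Qed.

Lemma corr_box_window L g : inL2 g -> carried L g ->
  window (- L%:Z) (L + L) (corr box g).
Proof.
move=> hg [Z [mZ Z0 sZ]] m hm; rewrite corr_boxE// -(@Cintegral0 R).
apply: Cintegral_ae.
- apply: Cmeasurable_inner; apply: inL2_Cmeasurable => //.
  exact: inL2_box_shift.
- exact: Cmeasurable_cst.
exists Z; split=> // x /= nx; apply: sZ => /= gx; apply: nx.
rewrite boxE; have [/andP[h1 h2]|h] := boolP (0 <= x - m%:~R < 1); last first.
  by rewrite rmorph0 mul0r.
rewrite gx ?mulr0//; apply/negP => /andP[h3 h4].
have e1 : m%:~R < L%:R :> R by lra.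
have e2 : - L%:R < (m + 1)%:~R :> R by rewrite rmorphD/=; lra.
move: e1 e2; rewrite -[L%:R]/(L%:Z%:~R) -rmorphN/= !ltr_int; lia.
Qed.

(** The translates of the box add up to 1 on the interval that carries [g]. *)
Lemma sum_corr_box L g : inL2 g -> carried L g ->
  \sum_(i < L + L) corr box g (- L%:Z + i%:Z) = Cintegral g.
Proof.
move=> hg [Z [mZ Z0 sZ]].
under eq_bigr do rewrite corr_boxE//.
rewrite -L2inner_suml//; last by move=> i; exact: inL2_box_shift.
apply: Cintegral_ae.
- apply: Cmeasurable_inner; apply: inL2_Cmeasurable => //.
  by apply: inL2_sum => i; exact: inL2_box_shift.
- exact: inL2_Cmeasurable.
exists Z; split=> // x /= nx; apply: sZ => /= gx; apply: nx.
rewrite sum_box; have [h|h] := boolP (_ <= x < _).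
  by rewrite rmorph1 mul1r.
rewrite gx ?mulr0//; move: h; rewrite (_ : - L%:Z + (L + L)%:Z = L%:Z); last lia.
by rewrite rmorphN/=.
Qed.

Lemma cabs_le (z : R[i]) : cabs z <= `|Re z| + `|Im z|.
Proof.
rewrite -(ler_pXn2r (n := 2))// ?nnegrE ?cabs_ge0 ?addr_ge0//.
rewrite cabs_sqr /sqmod sqrrD !real_normK ?num_real//.
by rewrite lerD2r lerDl mulrn_wge0// mulr_ge0.
Qed.

Lemma Re_le_cabs (z : R[i]) : Re z <= cabs z.
Proof.
rewrite (le_trans (ler_norm _))// -(ler_pXn2r (n := 2))// ?nnegrE ?cabs_ge0//.
by rewrite cabs_sqr /sqmod real_normK ?num_real// lerDl sqr_ge0.
Qed.

Lemma nrm_shift (v : R) f : inL2 f -> nrm (fun x => f (x + v)) = nrm f.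
Proof. by move=> /inL2P[_ hf]; exact: (Rintegral_shift v hf). Qed.

Lemma cabs_corr_le f g m s : inL2 f -> inL2 g -> 0 < s ->
  cabs (corr f g m) <= 2 * (s * nrm f + s^-1 * nrm g).
Proof.
move=> hf hg s0; have [h1 h2] := L2inner_le hf (inL2_shift m%:~R hg) s0.
rewrite nrm_shift// in h1 h2.
by rewrite (le_trans (cabs_le _))// mulr_natl mulr2n lerD.
Qed.

Lemma corrBr f g h m : inL2 f -> inL2 g -> inL2 h ->
  corr f (fun x => g x - h x) m = corr f g m - corr f h m.
Proof.
move=> hf hg hh.
have hg' := inL2_shift m%:~R hg; have hh' := inL2_shift m%:~R hh.
have := L2innerDr hf hg' (inL2Z (-1) hh').
rewrite (L2innerZr (-1) hf hh') mulN1r => e; rewrite -[RHS]e.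
by congr L2inner; apply/funext => x; rewrite mulN1r.
Qed.

End BoxCorrelation.

Section Cascade.
Variables (R : realType) (N : nat) (a : int -> R[i]).
Local Notation mu := (@lebesgue_measure R).
Local Notation M := (cascade N a).
Local Notation T := (transfer N a).
Local Notation Re := complex.Re.
Local Notation Im := complex.Im.
Local Notation box := (@box R).
Implicit Types f g : R -> R[i].
Hypothesis T0 : T (dirac_seq R 0) = dirac_seq R 0.

Lemma cabs_sum (I : Type) (s : seq I) (F : I -> R[i]) :
  cabs (\sum_(i <- s) F i) <= \sum_(i <- s) cabs (F i).
Proof.
elim: s => [|i s IH]; first by rewrite !big_nil cabs0.
by rewrite !big_cons (le_trans (cabsD _ _))// lerD2l.
Qed.

(** The correlation of the box with [g] is a combination of [L + L] Dirac
    sequences whose coefficients are bounded and add up to the integral of [g],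
    which is 1: its images under the powers of [T] have coefficients of index 0
    tending to 1, uniformly in [g]. *)
Lemma cascade_box_close L : transfer_cvg N a ->
  exists2 b : nat -> R, b @ \oo --> (0 : R) &
  forall g n, inL2 g -> corr g g = dirac_seq R 0 -> carried L g ->
    Cintegral g = 1 ->
    nrm (fun x => iter n M box x - iter n M g x) <= b n.
Proof.
move=> TC; pose t n i := iter n T (dirac_seq R (- L%:Z + i%:Z)) 0.
exists (fun n => \sum_(i < L + L) 8 * cabs (t n i - 1)).
  have H (s : seq 'I_(L + L)) :
      (fun n => \sum_(i <- s) 8 * cabs (t n i - 1)) @ \oo --> (0 : R).
    elim: s => [|i s IH].
      by under eq_fun do rewrite big_nil; exact: cvg_cst.
    have -> : (fun n => \sum_(j <- i :: s) 8 * cabs (t n j - 1)) =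
        (fun n => 8 * cabs (t n i - 1) + \sum_(j <- s) 8 * cabs (t n j - 1)).
      by apply/funext => n; rewrite big_cons.
    rewrite -[X in _ --> X](addr0 0); apply: cvgD => //.
    rewrite -[X in _ --> X](mulr0 8); apply: cvgM; first exact: cvg_cst.
    exact: TC.
  exact: H.
move=> g n hg gg cg ig.
have hb := inL2_box R.
rewrite (nrm_iterB T0 n hb hg (corr_box R) gg).
have wc := corr_box_window hg cg.
pose c i := corr box g (- L%:Z + i%:Z).
have cE : corr box g = (fun m => \sum_(i < L + L) c i * dirac_seq R (- L%:Z + i%:Z) m).
  apply/funext => m; rewrite (window_expand m wc); apply: eq_bigr => i _.
  by rewrite mulrC.
have c1 : \sum_(i < L + L) c i = 1 by rewrite sum_corr_box.
have zE : iter n T (corr box g) 0 = \sum_(i < L + L) c i * t n i.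
  by rewrite {1}cE iter_transfer_sum.
have -> : 2 - 2 * Re (iter n T (corr box g) 0) =
    2 * Re (\sum_(i < L + L) - c i * (t n i - 1)).
  have -> : \sum_(i < L + L) - c i * (t n i - 1) = 1 - \sum_(i < L + L) c i * t n i.
    by rewrite -[X in _ = X - _]c1 -sumrB; apply: eq_bigr => i _; ring.
  by rewrite zE !ReImE/= mulrBr mulr1.
rewrite (@le_trans _ _ (2 * \sum_(i < L + L) cabs (- c i * (t n i - 1))))//.
  by rewrite ler_pM2l// (le_trans (Re_le_cabs _))// cabs_sum.
rewrite mulr_sumr ler_sum// => i _; rewrite cabsM cabsN mulrA ler_wpM2r ?cabs_ge0//.
have := cabs_corr_le (- L%:Z + i%:Z) hb hg ltr01.
rewrite invr1 !mul1r !nrm_corr// ?corr_box// /c; lra.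
Qed.

Lemma cascade_supported L f : (N <= L)%N ->
  (forall x, ~~ (- L%:R <= x < L%:R) -> f x = 0) ->
  (forall x, ~~ (- L%:R <= x < L%:R) -> M f x = 0).
Proof.
move=> NL hf x hx; rewrite cascadeE big1// => k _.
rewrite hf ?mulr0//; apply: contra hx => /andP[h1 h2].
have kN : (k%:R : R) <= L%:R by rewrite ler_nat (leq_trans _ NL)// -ltnS.
have k0 : 0 <= (k%:R : R) by [].
by apply/andP; split; lra.
Qed.

Lemma carried_iter_box k : carried N.+1 (iter k M box).
Proof.
apply: nearW; elim: k => [|k IH] x.
  move=> /= hx; rewrite boxE (_ : _ && _ = false)//; apply/negbTE; apply: contra hx.
  move=> /andP[h1 h2]; have : (1 : R) <= N.+1%:R by rewrite ler1n.
  by move=> ?; apply/andP; split; lra.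
exact: cascade_supported.
Qed.

Lemma Cintegral_cascade f : \sum_(k < N.+1) a k%:Z = sqrt2 R -> Cintegrable f ->
  Cintegral (M f) = Cintegral f.
Proof.
move=> asum hf; rewrite cascadeE Cintegral_sum; last first.
  by move=> k; apply: CintegrableZ; exact: Cintegrable_affine (two_neq0 R) hf.
under eq_bigr => k _.
  rewrite CintegralZ; last exact: Cintegrable_affine (two_neq0 R) hf.
  rewrite Cintegral_affine ?two_neq0//.
  over.
rewrite -mulr_suml -mulr_sumr asum -expr2 sqrt2_sqr mulrA.
rewrite ger0_norm ?invr_ge0// fmorphV rmorph_nat mulfV ?pnatr_eq0//.
by rewrite mul1r.
Qed.

(** Take the iterates [iter k M box] themselves for [g]: they are carried by one
    interval, and keep integral 1 and orthonormal translates. *)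
Lemma cascade_box_cauchy : \sum_(k < N.+1) a k%:Z = sqrt2 R -> transfer_cvg N a ->
  exists2 b : nat -> R, b @ \oo --> (0 : R) &
  forall n k, nrm (fun x => iter n M box x - iter (n + k) M box x) <= b n.
Proof.
move=> asum /(cascade_box_close N.+1)[b b0 hb]; exists b => // n k.
under [X in nrm X]eq_fun do rewrite iterD.
apply: hb.
- exact/inL2_iter/inL2_box.
- by apply: corr_iter_dirac => //; [exact: inL2_box|exact: corr_box].
- exact: carried_iter_box.
- elim: k => [|k IH]; first exact: Cintegral_box.
  by rewrite iterS Cintegral_cascade//; exact/Cintegrable_iter/Cintegrable_box.
Qed.

Lemma compact_carried f : compactly_supported f -> exists L, carried L f.
Proof.
move=> [K cK [Z [mZ Z0 sZ]]].
have [B [_ HB]] := compact_bounded cK.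
pose L := (Num.truncn (`|B| + 1)).+1; exists L; exists Z; split=> // x /= nx.
apply: sZ => /= h; apply: nx => hx; apply: h => Kx; move/negP: hx; apply.
have xB : `|x| <= `|B| + 1.
  by apply: HB => //; rewrite (le_lt_trans (ler_norm _))// ltrDl.
have BL : `|B| + 1 < L%:R.
  by rewrite /L; apply: truncnS_gt.
have := le_lt_trans xB BL; rewrite ltr_norml => /andP[h1 h2].
by rewrite ltW.
Qed.

Definition boxs (m : int) (x : R) := box (x + m%:~R).

Lemma inL2_boxs m : inL2 (boxs m).
Proof. exact: inL2_shift (inL2_box R). Qed.

Lemma compactly_supported_boxs m : compactly_supported (boxs m).
Proof.
exists [set` `[- m%:~R, 1 - m%:~R]]; first exact: segment_compact.
apply: nearW => x /= hx; rewrite /boxs boxE (_ : _ && _ = false)//.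
apply/negbTE/negP => /andP[h1 h2]; apply: hx; rewrite in_itv/=.
by apply/andP; split; lra.
Qed.

Lemma corr_boxs m : corr box (boxs m) = dirac_seq R (- m).
Proof.
apply/funext => k.
transitivity (corr box box (k + m)); last by rewrite corr_box /dirac_seq addr_eq0.
by congr L2inner; apply/funext => x; rewrite /boxs rmorphD/= addrA.
Qed.

Lemma orthonormal_boxs m : orthonormal_translates (boxs m).
Proof.
move=> k l; have hb := inL2_boxs m.
have -> : (fun x => boxs m (x - k%:~R)) = (fun x => box (x + (m - k)%:~R)).
  by apply/funext => x; rewrite /boxs rmorphB/=; congr box; ring.
have -> : (fun x => boxs m (x - l%:~R)) =
    (fun x => (fun y => box (y + (k - l)%:~R)) (x + (m - k)%:~R)).
  by apply/funext => x; rewrite /boxs !rmorphB/=; congr box; ring.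
transitivity (corr box box (k - l)).
  exact: (L2inner_shift _ (inL2_box R) (inL2_shift (k - l)%:~R (inL2_box R))).
by rewrite corr_box /dirac_seq subr_eq0.
Qed.

Lemma fourier0 f : fourier f 0 = Cintegral f.
Proof.
congr Cintegral; apply/funext => x.
rewrite mul0r oppr0 /expi cos0 sin0 -[X in _ * X]/(1 : R[i]).
by rewrite mulr1.
Qed.

Lemma fourier0_boxs m : fourier (boxs m) 0 = 1.
Proof.
rewrite fourier0 -(Cintegral_box R).
have := Cintegral_affine m%:~R (oner_neq0 R) (Cintegrable_box R).
rewrite invr1 normr1 mul1r => <-.
by congr Cintegral; apply/funext => x; rewrite mul1r.
Qed.

(** The correlation of the box with its translate by [- m] is the Dirac sequence
    at [m]. Since all translates of the box have the same limit [phi] under the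
    cascade, the correlation of their iterates approaches that of the iterated
    box with itself, which is the Dirac sequence at 0. *)
Lemma transfer_cvg_of_cascade (phi : R -> R[i]) : inL2 phi ->
  (forall (m : int) (e : R), 0 < e -> \forall n \near \oo,
     (sqn (fun x => phi x - iter n M (boxs m) x)%R < e%:E)%E) ->
  transfer_cvg N a.
Proof.
move=> hphi H m j; apply/ccvgP => e e0.
pose s := e / 8. have s0 : 0 < s by rewrite divr_gt0.
pose e' := e * s / 32. have e'0 : 0 < e' by rewrite divr_gt0// mulr_gt0.
have H0 := H 0 e' e'0; have Hm := H (- m) e' e'0.
near=> n.
have hb0 := inL2_iter N a n (inL2_boxs 0).
have hbm := inL2_iter N a n (inL2_boxs (- m)).
have n0 : nrm (fun x => phi x - iter n M (boxs 0) x) < e'.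
  by rewrite -lte_fin -sqnE; [near: n|exact: inL2B].
have nm : nrm (fun x => phi x - iter n M (boxs (- m)) x) < e'.
  by rewrite -lte_fin -sqnE; [near: n|exact: inL2B].
have box0 : boxs 0 = box by apply/funext => x; rewrite /boxs addr0.
rewrite box0 in hb0 n0.
have nd : nrm (fun x => iter n M (boxs (- m)) x - iter n M box x) <= 4 * e'.
  have -> : (fun x => iter n M (boxs (- m)) x - iter n M box x) =
    (fun x => (phi x - iter n M box x) + -1 * (phi x - iter n M (boxs (- m)) x)).
    by apply/funext => x; ring.
  have h1 := inL2B hphi hb0; have h2 := inL2B hphi hbm.
  rewrite (le_trans (nrmD_le h1 (inL2Z (-1) h2)))//.
  have -> : nrm (fun x => -1 * (phi x - iter n M (boxs (- m)) x)) =
    nrm (fun x => phi x - iter n M (boxs (- m)) x).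
    by apply: eq_Rintegral => x _; rewrite mulN1r sqmodN.
  by lra.
have -> : iter n T (dirac_seq R m) j - dirac_seq R 0 j =
    corr (iter n M box) (fun x => iter n M (boxs (- m)) x - iter n M box x) j.
  have -> : dirac_seq R 0 j = corr (iter n M box) (iter n M box) j.
    by rewrite (corr_iter_dirac T0 _ (inL2_box R) (corr_box R)).
  have -> : dirac_seq R m = corr box (boxs (- m)) by rewrite corr_boxs opprK.
  rewrite -corr_iter; [|exact: inL2_box|exact: inL2_boxs].
  by rewrite corrBr.
rewrite (le_lt_trans (cabs_corr_le _ hb0 (inL2B hbm hb0) s0))//.
rewrite nrm_corr//; last by exact: (corr_iter_dirac T0 _ (inL2_box R) (corr_box R)).
rewrite (@le_lt_trans _ _ (2 * (s * 1 + s^-1 * (4 * e'))))//.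
  by rewrite ler_pM2l// lerD2l ler_pM2l ?invr_gt0.
rewrite /e' (_ : s^-1 * (4 * (e * s / 32)) = e / 8); last by field; rewrite gt_eqF.
by rewrite /s; lra.
Unshelve. all: by end_near. Qed.

End Cascade.

(** * Fourier transforms of the iterates of the box *)

Section Expi.
Variable R : realType.
Local Notation Re := complex.Re.
Local Notation Im := complex.Im.
Implicit Types x y s t : R.

Lemma expiD x y : expi (x + y) = expi x * expi y.
Proof. by apply: complex_ext; rewrite ?cReM ?cImM /= ?cosD ?sinD//; ring. Qed.

Lemma expi0 : expi 0 = 1 :> R[i].
Proof. by rewrite /expi cos0 sin0. Qed.

Lemma expi_natmul x n : expi (x * n%:R) = expi x ^+ n.
Proof.
elim: n => [|n IH]; first by rewrite mulr0 expi0 expr0.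
by rewrite -natr1 mulrDr mulr1 expiD IH exprSr.
Qed.

Lemma norm_expi x : `|expi x| = 1.
Proof. by rewrite normc_def /= cos2Dsin2 sqrtr1. Qed.

Lemma lipschitz_sin_cos x : `|sin x| <= `|x| /\ `|cos x - 1| <= `|x|.
Proof.
wlog x0 : x / 0 <= x.
  move=> h; have [x0|x0] := leP 0 x; first exact: h.
  by have := h (- x); rewrite oppr_ge0 ltW// => /(_ isT); rewrite sinN cosN !normrN.
split.
  have [] := @MVT_segment R sin cos 0 x x0.
  - by apply: continuous_subspaceT; exact: continuous_sin.
  move=> c _; rewrite sin0 !subr0 => ->.
  by rewrite normrM ler_piMl// cos_max.
have [] := @MVT_segment R cos (fun y => - sin y) 0 x x0.
- by apply: continuous_subspaceT; exact: continuous_cos.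
move=> c _; rewrite cos0 subr0 => ->.
by rewrite normrM normrN ler_piMl// sin_max.
Qed.

Lemma cabs_expi_sub1 x : cabs (expi x - 1) <= 2 * `|x|.
Proof.
have [h1 h2] := lipschitz_sin_cos x.
rewrite (le_trans (cabs_le _))//= subr0 mulr_natl mulr2n.
exact: lerD.
Qed.

Lemma cabs_expr_sub1 (z : R[i]) n : cabs z = 1 ->
  cabs (z ^+ n - 1) <= n%:R * cabs (z - 1).
Proof.
move=> z1; elim: n => [|n IH]; first by rewrite expr0 subrr cabs0 mul0r.
have -> : z ^+ n.+1 - 1 = z * (z ^+ n - 1) + (z - 1) by rewrite exprS; ring.
rewrite (le_trans (cabsD _ _))// cabsM z1 mul1r -natr1 mulrDl mul1r.
by rewrite lerD2r.
Qed.

End Expi.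

Section FourierCascade.
Variables (R : realType) (N : nat) (a : int -> R[i]).
Local Notation mu := (@lebesgue_measure R).
Local Notation M := (cascade N a).
Local Notation Re := complex.Re.
Local Notation Im := complex.Im.
Implicit Types f g : R -> R[i].

Lemma Cintegrable_expi f t : Cintegrable f ->
  Cintegrable (fun x => f x * expi (- (t * x))).
Proof.
move=> [fr fi]; split.
  under [X in integrable _ _ X]eq_fun do rewrite cReM/= cosN sinN mulrN opprK.
  by apply: L1D; [exact: L1_cos|exact: L1_sin].
under [X in integrable _ _ X]eq_fun do rewrite cImM/= cosN sinN mulrN addrC.
by apply: L1B; [exact: L1_cos|exact: L1_sin].
Qed.

Lemma fourierB f g t : Cintegrable f -> Cintegrable g ->
  fourier (fun x => f x - g x) t = fourier f t - fourier g t.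
Proof.
move=> hf hg; have hf' := Cintegrable_expi t hf; have hg' := Cintegrable_expi t hg.
have := CintegralD hf' (CintegrableZ (-1) hg'); rewrite CintegralZ// mulN1r => e.
by rewrite -[RHS]e; congr Cintegral; apply/funext => x; ring.
Qed.

(** The substitution [y = 2 * x - k] produces the factor [w ^+ k / 2] with
    [w = exp (- i * t / 2)]. *)
Lemma fourier_cascade f t : Cintegrable f ->
  fourier (M f) t = m0 N a (expi (- (t / 2))) / sqrt2 R * fourier f (t / 2).
Proof.
move=> hf; pose w := expi (- (t / 2)).
pose F (k : 'I_N.+1) y := (sqrt2 R * a k%:Z * w ^+ k) * (f y * expi (- (t / 2 * y))).
have hF k : Cintegrable (F k) by apply: CintegrableZ; exact: Cintegrable_expi.
transitivity (Cintegral (fun x => \sum_(k < N.+1) F k (2 * x + - k%:R))).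
  congr Cintegral; apply/funext => x; rewrite cascadeE mulr_suml.
  apply: eq_bigr => k _; rewrite /F.
  have -> : - (t * x) = - (t / 2) * k%:R + - (t / 2 * (2 * x + - k%:R)) by field.
  by rewrite expiD expi_natmul -/w; ring.
rewrite Cintegral_sum; last by move=> k; exact: Cintegrable_affine (two_neq0 R) (hF k).
have h2 : `|2^-1|%:C = 2^-1 :> R[i] by rewrite ger0_norm ?invr_ge0// fmorphV rmorph_nat.
under eq_bigr => k _.
  rewrite (Cintegral_affine (- k%:R) (two_neq0 R) (hF k)) h2 CintegralZ; last exact: Cintegrable_expi.
  rewrite -/(fourier f (t / 2)) mulrA.
  over.
rewrite -mulr_suml; congr (_ * _).
rewrite /m0 big_mkord mulr_suml; apply: eq_bigr => k _; rewrite -/w.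
have s0 := sqrt2_neq0 R; have s22 := sqrt2_sqr R.
have -> : (sqrt2 R)^-1 = 2^-1 * sqrt2 R.
  by apply: (mulIf s0); rewrite mulVf// -mulrA -expr2 s22 mulVf ?pnatr_eq0.
by ring.
Qed.

Definition partial_product (n : nat) (t : R) : R[i] :=
  \prod_(1 <= k < n.+1) (m0 N a (expi (- (t * 2 ^- k))) / sqrt2 R).

Lemma fourier_iter f n t : Cintegrable f ->
  fourier (iter n M f) t = partial_product n t * fourier f (t * 2 ^- n).
Proof.
move=> hf; elim: n t => [|n IH] t.
  by rewrite /partial_product big_nil expr0 invr1 mulr1 mul1r.
rewrite iterS fourier_cascade; last exact: Cintegrable_iter.
rewrite IH mulrA; congr (_ * fourier f _); last by rewrite exprS invfM mulrA.
rewrite /partial_product [RHS]big_nat_recl; last by [].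
rewrite expr1; congr (_ * _).
apply: eq_big_nat => k _.
by rewrite exprS invfM mulrA.
Qed.

Section Convergence.
Hypothesis asum : \sum_(k < N.+1) a k%:Z = sqrt2 R.
Hypothesis Qmf : forall z : R[i], `|z| = 1 ->
  `|m0 N a z| ^+ 2 + `|m0 N a (- z)| ^+ 2 = 2.

Let factor (s : R) : R[i] := m0 N a (expi (- s)) / sqrt2 R.

(** By the quadrature mirror identity, [|m0|^2 <= 2] on the circle. *)
Lemma cabs_factor_le1 s : cabs (factor s) <= 1.
Proof.
have h := Qmf (norm_expi (- s)).
have s0 := sqrt2_neq0 R.
rewrite -(ler_pXn2r (n := 2))// ?nnegrE ?cabs_ge0// expr1n.
rewrite -lecR rmorphXn/= cabsE /factor normrM exprMn normfV exprVn.
rewrite -[`|sqrt2 R| ^+ 2]normrX sqrt2_sqr normr_nat ler_pdivrMr ?ltr0n// mul1r.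
by rewrite -h lerDl exprn_ge0.
Qed.

Let C := 2 * (\sum_(k < N.+1) cabs (a k%:Z) * k%:R) * cabs (sqrt2 R)^-1.

(** [m0] is Lipschitz on the circle and takes the value [sqrt 2] at 1. *)
Lemma cabs_factor_sub1 s : cabs (factor s - 1) <= C * `|s|.
Proof.
have s0 := sqrt2_neq0 R.
have -> : factor s - 1 = (m0 N a (expi (- s)) - sqrt2 R) * (sqrt2 R)^-1.
  by rewrite mulrBl mulfV.
rewrite cabsM /C mulrAC ler_wpM2r ?cabs_ge0//.
have -> : m0 N a (expi (- s)) - sqrt2 R =
    \sum_(k < N.+1) a k%:Z * (expi (- s) ^+ k - 1).
  rewrite -asum /m0 big_mkord -sumrB; apply: eq_bigr => k _; ring.
rewrite (le_trans (cabs_sum _ _))// -mulrA mulrCA mulr_suml ler_sum// => k _.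
rewrite cabsM -mulrA ler_wpM2l ?cabs_ge0//.
have w1 : cabs (expi (- s)) = 1 by rewrite /cabs norm_expi.
rewrite (le_trans (cabs_expr_sub1 _ w1))// ler_wpM2l//.
by rewrite -(normrN s) cabs_expi_sub1.
Qed.

Let C_ge0 : 0 <= C.
Proof.
rewrite mulr_ge0 ?cabs_ge0// mulr_ge0// sumr_ge0// => k _.
by rewrite mulr_ge0 ?cabs_ge0.
Qed.

Lemma cabs_partial_product n t : cabs (partial_product n t) <= 1.
Proof.
elim: n => [|n IH]; first by rewrite /partial_product big_nil /cabs normr1.
rewrite /partial_product big_nat_recr//= -/(partial_product n t) cabsM.
by rewrite mulr_ile1 ?cabs_ge0// cabs_factor_le1.
Qed.

Lemma partial_productS n t : cabs (partial_product n.+1 t - partial_product n t)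
  <= C * `|t| * 2^-1 ^+ n.
Proof.
rewrite {1}/partial_product big_nat_recr//= -/(partial_product n t).
rewrite -/(factor (t * 2 ^- n.+1)) -[X in _ - X]mulr1 -mulrBr cabsM.
rewrite (@le_trans _ _ (1 * (C * `|t * 2 ^- n.+1|)))//.
  by rewrite ler_pM ?cabs_ge0 ?cabs_partial_product ?cabs_factor_sub1.
rewrite mul1r -[leRHS]mulrA ler_wpM2l// normrM ler_wpM2l//.
rewrite -exprVn ger0_norm ?exprn_ge0 ?invr_ge0// exprS ler_piMl ?exprn_ge0 ?invr_ge0//.
by rewrite invf_le1// ler1n.
Qed.

Lemma ccvg_of_geometric_increments (x : nat -> R[i]) (b q : R) : 0 <= q < 1 ->
  (forall n, cabs (x n.+1 - x n) <= b * q ^+ n) -> exists l, ccvg x l.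
Proof.
move=> /andP[q0 q1] hx.
have key (u : nat -> R) : (forall n, `|u n.+1 - u n| <= b * q ^+ n) -> cvgn u.
  move=> hu.
  have b0 : 0 <= b by have := le_trans (normr_ge0 _) (hu 0); rewrite expr0 mulr1.
  have -> : u = (fun n => u 0 + series (telescope u) n).
    by apply/funext => n; exact: eq_sum_telescope.
  apply: is_cvgD; first exact: is_cvg_cst.
  apply: normed_cvg; apply: (@series_le_cvg _ _ (geometric b q)) => //.
  - by move=> n; exact: normr_ge0.
  - by move=> n; apply: mulr_ge0 => //; exact: exprn_ge0.
  - by apply: is_cvg_geometric_series; rewrite ger0_norm.
have cr : cvgn (fun n => Re (x n)).
  apply: key => n; apply: le_trans (hx n); rewrite -cReN -cReD.
  rewrite -(ler_pXn2r (n := 2))// ?nnegrE ?cabs_ge0//.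
  by rewrite cabs_sqr /sqmod real_normK ?num_real// lerDl sqr_ge0.
have ci : cvgn (fun n => Im (x n)).
  apply: key => n; apply: le_trans (hx n); rewrite -cImN -cImD.
  rewrite -(ler_pXn2r (n := 2))// ?nnegrE ?cabs_ge0//.
  by rewrite cabs_sqr /sqmod real_normK ?num_real// lerDr sqr_ge0.
exists (limn (fun n => Re (x n)) +i* limn (fun n => Im (x n))).
apply: (@ccvg_le _ _ _ (fun n => `|Re (x n) - limn (fun n => Re (x n))| +
   `|Im (x n) - limn (fun n => Im (x n))|)).
  by move=> n; rewrite (le_trans (cabs_le _))// cReD cImD cReN cImN.
have z (u : nat -> R) : cvgn u -> (fun n => `|u n - limn u|) @ \oo --> (0 : R).
  move=> cu; rewrite -(@normr0 _ R) -(subrr (limn u)); apply: cvg_norm.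
  by apply: cvgB => //; exact: cvg_cst.
by rewrite -[X in _ --> X](addr0 0); apply: cvgD; exact: z.
Qed.

Lemma ccvg_lim (x : nat -> R[i]) (l : R[i]) : ccvg x l ->
  limn (x : nat -> R[i]^o) = l.
Proof.
move=> /ccvgP hx; apply/cvg_lim => //.
apply/cvgrPdist_lt => e e0.
have er : (Re e)%:C = e by apply: RRe_real; exact: gtr0_real.
have e0' : 0 < Re e by rewrite -ltcR er.
have := hx _ e0'; apply: filterS => n h.
by rewrite -er -cabsE ltcR -cabsN opprB.
Qed.

(** The partial products are bounded by 1 and the factors approach 1
    geometrically, so that the increments are summable: the limit that defines
    [phihat] exists. *)
Lemma ccvg_phihat t : ccvg (fun n => partial_product n t) (phihat N a t).
Proof.
have [l hl] : exists l, ccvg (fun n => partial_product n t) l.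
  apply: (@ccvg_of_geometric_increments _ (C * `|t|) 2^-1).
    by rewrite invr_ge0 ler0n/= invf_lt1 ?ltr1n// ltr0n.
  by move=> n; exact: partial_productS.
by rewrite [phihat N a t](ccvg_lim hl).
Qed.

Lemma cabs_fourier_box s : cabs (fourier (@box R) s - 1) <= 2 * `|s|.
Proof.
have ib := Cintegrable_box R; have ibs := Cintegrable_expi s ib.
pose D x := box x * (expi (- (s * x)) - 1).
have iD : Cintegrable D.
  have := CintegrableD ibs (CintegrableZ (-1) ib).
  by rewrite (_ : (fun x => _ + _) = D)//; apply/funext => x; rewrite /D; ring.
have -> : fourier (@box R) s - 1 = Cintegral D.
  rewrite -(Cintegral_box R) -mulN1r -CintegralZ// -CintegralD//; last exact: CintegrableZ.
  by congr Cintegral; apply/funext => x; rewrite /D; ring.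
have [iDr iDi] := iD.
have ibx : mu.-integrable setT (EFin \o (fun x => `|s| * \1_[set` `[0, 1[] x)).
  by apply: L1Z; exact: L1_box.
have Ib : \int[mu]_x (`|s| * \1_[set` `[0, 1[] x) = `|s|.
  rewrite RintegralZl//; last exact: L1_box.
  have := congr1 (@complex.Re R) (Cintegral_box R) => /= e1.
  by rewrite [X in _ * X]e1 mulr1.
have sx x : 0 <= x < 1 -> `|- (s * x)| <= `|s|.
  by move=> /andP[x0 x1]; rewrite normrN normrM ler_piMr// ger0_norm// ltW.
have bE x : (\1_[set` `[0%R, 1%R[] x : R) = (0 <= x < 1)%R%:R.
  by rewrite indicE mem_setE in_itv.
rewrite (le_trans (cabs_le _))// mulr_natl mulr2n lerD//.
  rewrite -[leRHS]Ib (le_trans (le_normr_Rintegral _ _))//.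
  apply: le_Rintegral => //; first exact: L1_norm.
  move=> x _; rewrite /D boxE bE.
  have [hx|hx] := boolP (0 <= x < 1); last by rewrite mul0r normr0 mulr0.
  rewrite mul1r mulr1 /=; apply: le_trans (sx x hx).
  by have [_] := lipschitz_sin_cos (- (s * x)).
rewrite -[leRHS]Ib (le_trans (le_normr_Rintegral _ _))//.
apply: le_Rintegral => //; first exact: L1_norm.
move=> x _; rewrite /D boxE bE.
have [hx|hx] := boolP (0 <= x < 1); last by rewrite mul0r normr0 mulr0.
rewrite mul1r mulr1 /= subr0; apply: le_trans (sx x hx).
by have [] := lipschitz_sin_cos (- (s * x)).
Qed.

Lemma ccvg_fourier_iter_box t :
  ccvg (fun n => fourier (iter n M (@box R)) t) (phihat N a t).
Proof.
have hp := ccvg_phihat t.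
apply: (@ccvg_le _ _ _ (fun n => 2 * `|t| * 2^-1 ^+ n +
   cabs (partial_product n t - phihat N a t))).
  move=> n; rewrite fourier_iter; last exact: Cintegrable_box.
  set p := partial_product n t; set z := fourier _ _.
  have -> : p * z - phihat N a t = p * (z - 1) + (p - phihat N a t) by ring.
  rewrite (le_trans (cabsD _ _))// lerD2r cabsM.
  rewrite (@le_trans _ _ (1 * (2 * `|t * 2 ^- n|)))//.
    by rewrite ler_pM ?cabs_ge0 ?cabs_partial_product ?cabs_fourier_box.
  have p2 : `|2 ^- n| = 2^-1 ^+ n :> R by rewrite exprVn ger0_norm ?invr_ge0 ?exprn_ge0.
  by rewrite mul1r normrM mulrA p2.
rewrite -[X in _ --> X](addr0 0); apply: cvgD => //.
rewrite -[X in _ --> X](mulr0 (2 * `|t|)); apply: cvgM; first exact: cvg_cst.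
by apply: cvg_expr; rewrite ger0_norm ?invr_ge0// invf_lt1 ?ltr1n ?ltr0n.
Qed.

End Convergence.
End FourierCascade.

(** * The limit of the cascade *)

Section Identification.
Variables (R : realType).
Local Notation mu := (@lebesgue_measure R).
Implicit Types f g : R -> R[i].

Lemma inL2_fourier f : Cintegrable f -> inL2 f -> inL2 (fourier f).
Proof.
move=> hf hf2; split; first exact: Cmeasurable_fourier.
by rewrite L2normE plancherel// poweR_lty// ltry.
Qed.

Lemma nrm_fourier f : Cintegrable f -> inL2 f -> nrm (fourier f) = 2 * pi * nrm f.
Proof.
move=> hf hf2; have := plancherel hf hf2; rewrite sqnE; last exact: inL2_fourier.
by move=> [].
Qed.

Lemma ccvg_cabs (x : nat -> R[i]) l c : ccvg x l ->
  (fun n => cabs (c - x n)) @ \oo --> cabs (c - l).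
Proof.
move=> h; apply/subr_cvg0/norm_cvg0P; apply: squeeze_cvgr (cvg_cst 0) h.
apply: nearW => n; rewrite normr_ge0/= ler_norml.
have h1 := cabsD (c - l) (- (x n - l)); have h2 := cabsD (c - x n) (x n - l).
rewrite cabsN (_ : c - l - (x n - l) = c - x n) in h1; last by ring.
rewrite (_ : c - x n + (x n - l) = c - l) in h2; last by ring.
by apply/andP; split; lra.
Qed.

Lemma limn_einf_le (u : nat -> \bar R) (c : \bar R) : (forall n, u n <= c)%E ->
  (limn_einf u <= c)%E.
Proof.
move=> uc; rewrite limn_einf_lim; apply: lime_le; first exact: is_cvg_einfs.
apply: nearW => n; apply: le_trans (uc n).
by apply: ereal_inf_lbound; exists n => /=.
Qed.

Lemma fatou_sqn (F : nat -> R -> R[i]) f g (c : \bar R) :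
  (forall k, Cmeasurable (F k)) -> Cmeasurable g ->
  (forall t, ccvg (fun k => F k t) (f t)) ->
  (forall k, sqn (fun t => g t - F k t)%R <= c)%E ->
  (sqn (fun t => g t - f t)%R <= c)%E.
Proof.
move=> mF mg cF Fc.
have mD k : measurable_fun [set: measurableTypeR R] (fun t => (sqmod (g t - F k t))%:E).
  apply/measurable_EFinP; apply: measurable_sqmod; apply: CmeasurableD => //.
  have := CmeasurableM (Cmeasurable_cst (- 1 : R[i])) (mF k).
  by under eq_fun do rewrite mulN1r.
have -> : sqn (fun t => g t - f t) =
    (\int[mu]_t limn_einf (fun k => (sqmod (g t - F k t))%:E))%E.
  apply: eq_integral => t _; apply/esym.
  have ct : (fun k => (sqmod (g t - F k t))%:E) @ \oo --> (sqmod (g t - f t))%:E.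
    apply: cvg_EFin; first exact: nearW.
    rewrite -cabs_sqr; apply: cvg_trans (cvgM (ccvg_cabs (c := g t) (cF t)) (ccvg_cabs (c := g t) (cF t))).
    by apply: near_eq_cvg; apply: nearW => n /=; rewrite -cabs_sqr expr2.
  rewrite is_cvg_limn_einfE; first exact/cvg_lim.
  by apply/cvg_ex; exists (sqmod (g t - f t))%:E.
apply: le_trans (fatou _ _ _ _) _ => //.
  by move=> k t _; rewrite lee_fin sqmod_ge0.
exact: limn_einf_le.
Qed.

Lemma nrmBC f g : nrm (fun x => f x - g x) = nrm (fun x => g x - f x).
Proof. by apply: eq_Rintegral => x _; rewrite -sqmodN opprB. Qed.

Lemma nrmB_le f g h : inL2 f -> inL2 g -> inL2 h ->
  nrm (fun x => f x - h x) <=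
  2 * (nrm (fun x => f x - g x) + nrm (fun x => g x - h x)).
Proof.
move=> hf hg hh; rewrite (le_trans _ (nrmD_le (inL2B hf hg) (inL2B hg hh)))//.
by rewrite le_eqVlt; apply/orP; left; apply/eqP/eq_Rintegral => x _; congr sqmod; ring.
Qed.

(** Compare [f] with the approximations [g k] of [phi]: by the Plancherel identity
    their distance to [f] is read off from the Fourier transforms, where [g k]
    is close to [hat] for large [k]. *)
Lemma is_fourierL2_near phi hat f c : is_fourierL2 phi hat ->
  Cintegrable f -> inL2 f ->
  (sqn (fun t => fourier f t - hat t)%R <= (2 * pi * c)%:E)%E ->
  nrm (fun x => phi x - f x) <= 4 * c.
Proof.
move=> [hphi hhat [g [hg cg cgh]]] if1 if2 fc.
have hff := inL2_fourier if1 if2.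
rewrite sqnE in fc; last exact: inL2B.
rewrite lee_fin nrmBC in fc.
have pi0 : 0 < (pi : R) by exact: pi_gt0.
have p2 : 0 < 2 * (pi : R) by rewrite mulr_gt0.
apply/ler_addgt0Pr => e e0.
have e8 : 0 < e / 8 by rewrite divr_gt0.
have ep : 0 < e / 8 * (2 * pi) by rewrite mulr_gt0.
have := (L2norm_cvg0P _).1 cg _ e8; have := (L2norm_cvg0P _).1 cgh _ ep.
move=> [n1 _ /(_ _ (leq_maxl n1 _)) h1] [n2 _ /(_ _ (leq_maxr _ n2)) h2].
have {}h1 := h1 n2; have {}h2 := h2 n1.
set k := maxn n1 n2 in h1 h2.
have [ig ig2] := hg k; have hgg := inL2_fourier ig ig2.
rewrite sqnE in h1; last exact: inL2B.
rewrite sqnE in h2; last exact: inL2B.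
rewrite !lte_fin in h1 h2.
have hgf : nrm (fun x => g k x - f x) <= 2 * (e / 8) + 2 * c.
  have iB : Cintegrable (fun x => g k x - f x).
    have := CintegrableD ig (CintegrableZ (-1) if1).
    by rewrite (_ : (fun x => _ + _) = (fun x => g k x - f x))//; apply/funext => x; rewrite mulN1r.
  have := nrm_fourier iB (inL2B ig2 if2).
  have -> : fourier (fun x => g k x - f x) = (fun t => fourier (g k) t - fourier f t).
    by apply/funext => t; exact: fourierB.
  move=> hn; rewrite -(ler_pM2l p2) -hn (le_trans (nrmB_le hgg hhat hff))//.
  rewrite nrmBC in h1.
  by move/ltW: h1 => h1; rewrite (le_trans (_ : _ <= 2 * (e / 8 * (2 * pi) + 2 * pi * c)))//;
    [rewrite ler_pM2l// lerD|lra].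
rewrite (le_trans (nrmB_le hphi ig2 if2))//.
apply: (@le_trans _ _ (2 * (e / 8 + (2 * (e / 8) + 2 * c)))).
  by rewrite ler_pM2l// lerD// ltW.
by clear -e0; lra.
Qed.

End Identification.

Theorem theorem2p5 (R : realType) (N : nat) (a : int -> R[i])
    (a_supp : forall k : int, ~~ (0 <= k <= N%:Z) -> a k = 0)
    (a_orth : forall l : int,
       \sum_(k \in [set: int]) ((a k)^* * a (k + 2 * l)) = (l == 0)%:R)
    (a_sum : \sum_(k \in [set: int]) a k = sqrt2 R)
    (phi : R -> R[i]) (phi_scaling : is_scaling_function N a phi)
    (r s : int) (r_le : r <= - N%:Z) (s_ge : N%:Z <= s) :
  (simple_eigenvalue_on (trigpoly r s) (ruelle N a) 1 /\
   (forall lambda : R[i],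
      eigenvalue_on (trigpoly r s) (ruelle N a) lambda ->
      lambda != 1 -> `|lambda| < 1))
  <->
  (forall psi : R -> R[i],
     inL2 psi -> compactly_supported psi -> orthonormal_translates psi ->
     fourier psi 0 = 1 ->
     (fun n => L2norm (fun x => phi x - iter n (cascade N a) psi x)) @ \oo
       --> 0%E).
Proof.
have T0 := transfer_dirac0 a_supp a_orth.
have asum := filter_sum a_supp a_sum.
have hphi : inL2 phi by case: phi_scaling.
rewrite (spectrum_iff_transfer_cvg a_supp a_orth a_sum r_le s_ge); split; last first.
  move=> H; apply: (transfer_cvg_of_cascade T0 hphi) => m e e0.
  have := H (boxs m) (inL2_boxs R m) (@compactly_supported_boxs R m)
    (orthonormal_boxs R m) (fourier0_boxs R m).
  by move/(L2norm_cvg0P (fun n x => phi x - iter n (cascade N a) (boxs m) x)); apply.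
move=> TC psi hpsi cpsi opsi psi1.
apply/(L2norm_cvg0P (fun n x => phi x - iter n (cascade N a) psi x)) => e e0.
have hbox := inL2_box R; have ibox := Cintegrable_box R.
pose f n := iter n (cascade N a) (@box R).
have hf n : inL2 (f n) by exact: inL2_iter.
have if1 n : Cintegrable (f n) by exact: Cintegrable_iter.
have [b b0 hb] := cascade_box_cauchy T0 asum TC.
have phif n : nrm (fun x => phi x - f n x) <= 4 * b n.
  apply: (is_fourierL2_near phi_scaling) => //.
  apply: (@fatou_sqn _ (fun k => fourier (f (n + k)%N))).
  - by move=> k; exact: Cmeasurable_fourier.
  - exact: Cmeasurable_fourier.
  - move=> t; have Q := qmf a_supp a_orth.
    have := (ccvg_shift n _ _).2 (ccvg_fourier_iter_box asum Q t).
    by under eq_fun => k do rewrite addnC.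
  - move=> k; have iB : Cintegrable (fun x => f n x - f (n + k)%N x).
      have := CintegrableD (if1 n) (CintegrableZ (-1) (if1 (n + k)%N)).
      by rewrite (_ : (fun x => _ + _) = (fun x => f n x - f (n + k)%N x))//; apply/funext => x; rewrite mulN1r.
    have -> : (fun t => fourier (f n) t - fourier (f (n + k)%N) t) =
        fourier (fun x => f n x - f (n + k)%N x).
      by apply/funext => t; rewrite fourierB.
    rewrite plancherel//; last exact: inL2B.
    rewrite lee_fin ler_pM2l ?mulr_gt0 ?pi_gt0//.
    exact: hb.
have [L cL] := compact_carried cpsi.
have [b' b'0 hb'] := cascade_box_close T0 L TC.
have pf n : nrm (fun x => f n x - iter n (cascade N a) psi x) <= b' n.
  apply: hb' => //; first exact: orthonormal_corr.
  by rewrite -fourier0.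
have cb : (fun n => 2 * (4 * b n + b' n)) @ \oo --> (0 : R).
  rewrite -[X in _ --> X](mulr0 2); apply: cvgM; first exact: cvg_cst.
  rewrite -[X in _ --> X](addr0 0); apply: cvgD => //.
  rewrite -[X in _ --> X](mulr0 4); apply: cvgM => //; exact: cvg_cst.
move/cvgrPdist_lt : cb => /(_ _ e0); apply: filterS => n.
rewrite sub0r normrN => /(le_lt_trans (ler_norm _)) h.
have hn := inL2_iter N a n hpsi.
rewrite sqnE ?lte_fin; last exact: inL2B.
apply: le_lt_trans h; rewrite (le_trans (nrmB_le hphi (hf n) hn))//.
by rewrite ler_pM2l// lerD.
Qed.
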